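(* Let $\{\varepsilon_n\}$ be a sequence of positive numbers converging to zero and let $(S^3,g_n)$ be the corresponding Berger 3-spheres. Then the tangent bundles $TS^3$ of the Berger 3-spheres $(S^3,g_n)$, endowed with their Sasaki metrics $g_n^S$ and based at a zero vector, converge in the pointed Gromov-Hausdorff sense to $\mathbb R\times TS^2$ with the product metric.
   Context: Berger 3-spheres: consider the Hopf fibration $\pi:S^3\to S^2$, a principal circle bundle, with connection given by the orthogonal complement of the fibers in the round metric. The base $S^2$ carries the round metric $g_{S^2}$ making $\pi$ a Riemannian submersion from the unit round $S^3$. The Berger metric $g_n$ is obtained from the round metric by multiplying it by $\varepsilon_n^2$ on the fiber direction, leaving the horizontal part and orthogonality unchanged, i.e. $g_n=\pi^*g_{S^2}+\varepsilon_n^2g_{S^1}$ as a connection metric. As $n\to\infty$, $(S^3,g_n)$ converges to $(S^2,g_{S^2})$. Sasaki metric: the Sasaki metric $g^S$ on the tangent bundle of a Riemannian manifold with metric $g$ and Levi-Civita connection $\nabla$ is the unique Riemannian metric such that every curve $\gamma$ in the tangent bundle, with projected curve $\delta$ in the base, satisfies $\|\dot\gamma\|^2=\|\dot\delta\|_g^2+\|\nabla_{\dot\delta}\gamma\|_g^2$. In the limit, $TS^2$ carries the Sasaki metric of $g_{S^2}$ and $\mathbb R$ its standard metric. Pointed Gromov-Hausdorff convergence: a sequence of pointed proper metric spaces $(X_i,x_i)$ converges to $(X,x)$ if for all $R,\varepsilon>0$ there is $N$ such that for all $i>N$ there is a (possibly discontinuous) $f_i:B_R(x_i)\to B_R(x)$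 with $f_i(x_i)=x$, distorting distances (restricted metrics) by less than $\varepsilon$, and with $\varepsilon$-dense image. *)

(* Defs.v *)
From HB Require Import structures.
From mathcomp Require Import all_boot all_order all_algebra.
From mathcomp Require Import ring.
From mathcomp Require Import all_classical all_reals all_analysis.

Set Implicit Arguments.
Unset Strict Implicit.
Unset Printing Implicit Defensive.

Import Order.TTheory GRing.Theory Num.Theory numFieldNormedType.Exports.

Local Open Scope ring_scope.
Local Open Scope classical_set_scope.

(* Manifolds are closed embedded submanifolds M of a finite-dimensional normed
   space V (always built from R and 'rV[R]_n by products).  Tensors and vector
   fields are total functions on V which are smooth on a neighbourhood of M;
   only their values at points and tangent vectors of M are meaningful. *)

Section Calculus.
Context {R : realType}.

Fixpoint Ck (V W : normedModType R) (k : nat) (U : set V) (f : V -> W) : Prop :=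
  match k with
  | 0 => forall x, U x -> {for x, continuous f}
  | k'.+1 => (forall x, U x -> differentiable f x) /\
             (forall v, Ck k' U ('D_v f))
  end.

Definition smooth_near (V W : normedModType R) (M : set V) (f : V -> W) : Prop :=
  exists U : set V, [/\ open U, M `<=` U & forall k, Ck k U f].

Definition C1_curve (V : normedModType R) (c : R -> V) : Prop :=
  (forall t, derivable c t 1) /\ continuous (derive1 c).

Definition tangent (V : normedModType R) (M : set V) (p : V) : set V :=
  [set u | exists c : R -> V, [/\ C1_curve c, c 0 = p,
     (\forall s \near (0 : R), M (c s)) & derive1 c 0 = u]].

Definition tangent_bundle (V : normedModType R) (M : set V) : set (V * V)%type :=
  [set x | M x.1 /\ tangent M x.1 x.2].

Definition vector_field (V : normedModType R) (M : set V) (X : V -> V) : Prop :=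
  smooth_near M X /\ forall p, M p -> tangent M p (X p).

End Calculus.

Section RiemannianMetrics.
Context {R : realType}.

Record riemannian_metric (V : normedModType R) (M : set V)
    (g : V -> V -> V -> R) : Prop := RiemannianMetric {
  rm_linear : forall p a u u' v, g p (a *: u + u') v = a * g p u v + g p u' v;
  rm_sym : forall p u v, g p u v = g p v u;
  rm_pos : forall p u, M p -> tangent M p u -> u != 0 -> 0 < g p u u;
  rm_smooth : forall u v, smooth_near M (fun p => g p u v : R^o)
}.

Definition arc_length (V : normedModType R) (g : V -> V -> V -> R)
    (c : R -> V) : R :=
  Rintegral (@lebesgue_measure R) `[0, 1]
    (fun t => Num.sqrt (g (c t) (derive1 c t) (derive1 c t))).

(* A piecewise C^1 path is a finite chain of C^1 arcs.  A C^1 arc on [0, 1] is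
   the restriction of a C^1 curve of the ambient space. *)
Inductive path_length (V : normedModType R) (M : set V) (g : V -> V -> V -> R) :
    V -> V -> R -> Prop :=
| path_arc c of C1_curve c & (forall t, t \in `[0, 1] -> M (c t)) :
    path_length M g (c 0) (c 1) (arc_length g c)
| path_cat x y z l l' of path_length M g x y l & path_length M g y z l' :
    path_length M g x z (l + l').

(* Meaningful on connected M only, since [inf set0 = 0]. *)
Definition riem_dist (V : normedModType R) (M : set V) (g : V -> V -> V -> R)
    (x y : V) : R :=
  inf [set l | path_length M g x y l].

Definition prod_metric (V W : normedModType R) (g : V -> V -> V -> R)
    (h : W -> W -> W -> R) (p u v : (V * W)%type) : R :=
  g p.1 u.1 v.1 + h p.2 u.2 v.2.

End RiemannianMetrics.

Section LeviCivita.
Context {R : realType}.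

(* [D p u Y] is the covariant derivative of Y at p in the direction u; being
   linear in the vector u at each p is the C^oo(M)-linearity in X of nabla_X Y. *)
Record affine_connection (V : normedModType R) (M : set V)
    (D : V -> V -> (V -> V) -> V) : Prop := AffineConnection {
  ac_local : forall p u X Y, M p -> tangent M p u ->
    vector_field M X -> vector_field M Y ->
    (forall q, M q -> X q = Y q) -> D p u X = D p u Y;
  ac_smooth : forall X Y, vector_field M X -> vector_field M Y ->
    exists2 Z, vector_field M Z & forall p, M p -> D p (X p) Y = Z p;
  ac_tangent : forall p u Y, M p -> tangent M p u -> vector_field M Y ->
    tangent M p (D p u Y);
  ac_linear_dir : forall p a u v Y, M p -> tangent M p u -> tangent M p v ->
    vector_field M Y -> D p (a *: u + v) Y = a *: D p u Y + D p v Y;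
  ac_additive : forall p u X Y, M p -> tangent M p u ->
    vector_field M X -> vector_field M Y ->
    D p u (fun q => X q + Y q) = D p u X + D p u Y;
  ac_leibniz : forall p u (f : V -> R^o) Y, M p -> tangent M p u ->
    smooth_near M f -> vector_field M Y ->
    D p u (fun q => f q *: Y q) = 'D_u f p *: Y p + f p *: D p u Y
}.

Record levi_civita (V : normedModType R) (M : set V) (g : V -> V -> V -> R)
    (D : V -> V -> (V -> V) -> V) : Prop := LeviCivita {
  lc_connection : affine_connection M D;
  lc_metric : forall p u X Y, M p -> tangent M p u ->
    vector_field M X -> vector_field M Y ->
    'D_u (fun q => g q (X q) (Y q) : R^o) p =
      g p (D p u X) (Y p) + g p (X p) (D p u Y);
  lc_torsion_free : forall p X Y, M p ->
    vector_field M X -> vector_field M Y ->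
    D p (X p) Y - D p (Y p) X = 'D_(X p) Y p - 'D_(Y p) X p
}.

(* The operator D/dt along a curve c is determined by
   D/dt (\sum_j a_j (Y_j \o c)) =
     \sum_j (a_j' (Y_j \o c) + a_j nabla_{c'} Y_j);
   every C^1 field along c has this form near t.  The vector [w] is the value
   at t of D/dt of the field W along c. *)
Definition covariant_derivative (V : normedModType R) (M : set V)
    (D : V -> V -> (V -> V) -> V) (c W : R -> V) (t : R) (w : V) : Prop :=
  exists (m : nat) (a : 'I_m -> R -> R) (Y : 'I_m -> V -> V),
    [/\ forall j, derivable (a j) t 1,
        forall j, vector_field M (Y j),
        \forall s \near t, W s = \sum_j a j s *: Y j (c s)
      & w = \sum_j ((derive1 (a j) t) *: Y j (c t) +
                    a j t *: D (c t) (derive1 c t) (Y j))].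

Definition sasaki_metric (V : normedModType R) (M : set V)
    (g : V -> V -> V -> R) (gS : V * V -> V * V -> V * V -> R) : Prop :=
  riemannian_metric (tangent_bundle M) gS /\
  exists2 D, levi_civita M g D &
    forall (gamma : R -> (V * V)%type) t w,
      C1_curve gamma -> (\forall s \near t, tangent_bundle M (gamma s)) ->
      let delta := fst \o gamma in
      covariant_derivative M D delta (snd \o gamma) t w ->
      gS (gamma t) (derive1 gamma t) (derive1 gamma t) =
        g (delta t) (derive1 delta t) (derive1 delta t) + g (delta t) w w.

End LeviCivita.

Section PointedGromovHausdorff.
Context {R : realType} {T T' : Type}.

Definition oball (S : Type) (A : set S) (d : S -> S -> R) (x : S) (r : R) :
    set S :=
  [set a | A a /\ d x a < r].

Definition pointed_GH_cvg (X : nat -> set T) (d : nat -> T -> T -> R)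
    (x : nat -> T) (Y : set T') (dY : T' -> T' -> R) (y : T') : Prop :=
  forall r e : R, 0 < r -> 0 < e -> exists N : nat, forall i, (N < i)%N ->
    exists f : T -> T',
      [/\ forall a, oball (X i) (d i) (x i) r a -> oball Y dY y r (f a),
          f (x i) = y,
          forall a b, oball (X i) (d i) (x i) r a ->
            oball (X i) (d i) (x i) r b ->
            `|dY (f a) (f b) - d i a b| < e
        & forall b, oball Y dY y r b ->
            exists2 a, oball (X i) (d i) (x i) r a & dY (f a) b < e].

End PointedGromovHausdorff.

Section BergerSpheres.
Context {R : realType}.

Definition dot (n : nat) (u v : 'rV[R]_n) : R := \sum_i u 0 i * v 0 i.

Definition sphere (n : nat) (r : R) : set 'rV[R]_n := [set p | dot p p = r ^+ 2].

Definition euclidean_metric (n : nat) (p u v : 'rV[R]_n) : R := dot u v.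

Definition S3 : set 'rV[R]_4 := sphere 1.

(* The unit S^3 submerses onto the round sphere of radius 1/2; see
   [hopf_submersion]. *)
Definition S2 : set 'rV[R]_3 := sphere 2^-1.

(* With z = p_0 + i p_1 and w = p_2 + i p_3, this is
   (Re (z w^* ), Im (z w^* ), (|z|^2 - |w|^2) / 2). *)
Definition hopf (p : 'rV[R]_4) : 'rV[R]_3 :=
  \row_k [:: p 0 0 * p 0 2 + p 0 1 * p 0 3;
             p 0 1 * p 0 2 - p 0 0 * p 0 3;
             (p 0 0 ^+ 2 + p 0 1 ^+ 2 - p 0 2 ^+ 2 - p 0 3 ^+ 2) / 2]`_k.

(* Velocity of the fibre t |-> e^{it} (z, w) *)
Definition hopf_field (p : 'rV[R]_4) : 'rV[R]_4 :=
  \row_k [:: - p 0 1; p 0 0; - p 0 3; p 0 2]`_k.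

Definition vertical (p u : 'rV[R]_4) : 'rV[R]_4 :=
  dot u (hopf_field p) *: hopf_field p.

Definition horizontal (p u : 'rV[R]_4) : 'rV[R]_4 := u - vertical p u.

Definition berger_metric (e : R) (p u v : 'rV[R]_4) : R :=
  dot (horizontal p u) (horizontal p v) +
  e ^+ 2 * dot (vertical p u) (vertical p v).

Definition line_metric (p u v : R^o) : R := u * v.

End BergerSpheres.

Section HopfFibration.
Context {R : realType}.
Implicit Types p u v : 'rV[R]_4.

Lemma dot4E u v :
  dot u v = u 0 0 * v 0 0 + u 0 1 * v 0 1 + u 0 2 * v 0 2 + u 0 3 * v 0 3.
Proof.
rewrite /dot !big_ord_recl big_ord0 addr0 !addrA.
by congr (_ * _ + _ * _ + _ * _ + _ * _); congr (_ _ _); apply/val_inj.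
Qed.

Lemma dot3E (u v : 'rV[R]_3) :
  dot u v = u 0 0 * v 0 0 + u 0 1 * v 0 1 + u 0 2 * v 0 2.
Proof.
rewrite /dot !big_ord_recl big_ord0 addr0 !addrA.
by congr (_ * _ + _ * _ + _ * _); congr (_ _ _); apply/val_inj.
Qed.

Definition dhopf p u : 'rV[R]_3 :=
  \row_k [:: p 0 0 * u 0 2 + u 0 0 * p 0 2 + p 0 1 * u 0 3 + u 0 1 * p 0 3;
             p 0 1 * u 0 2 + u 0 1 * p 0 2 - p 0 0 * u 0 3 - u 0 0 * p 0 3;
             p 0 0 * u 0 0 + p 0 1 * u 0 1 - p 0 2 * u 0 2 - p 0 3 * u 0 3]`_k.

Lemma hopfD p u (h : R) :
  hopf (h *: u + p) = hopf p + h *: dhopf p u + h ^+ 2 *: hopf u.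
Proof.
apply/rowP => -[[|[|[|//]]] i] /=; rewrite !mxE /=; by field.
Qed.

Lemma derive_hopf p u : 'D_u hopf p = dhopf p u.
Proof.
apply/cvg_lim => //.
have -> : dhopf p u = dhopf p u + 0 *: hopf u by rewrite scale0r addr0.
apply: (@cvg_trans _ ((fun h : R => dhopf p u + h *: hopf u) @ 0^')).
  apply: near_eq_cvg; near=> h.
  have h0 : h != 0 by near: h; exact: nbhs_dnbhs_neq.
  rewrite /= hopfD -[X in X - _]addrA addrAC subrr add0r.
  by rewrite scalerDr !scalerA mulVf // scale1r expr2 mulKf.
apply: cvgD; first exact: cvg_cst.
by apply: cvgZl; exact: nbhs_dnbhs.
Unshelve. all: by end_near. Qed.

Lemma hopf_S2 p : S3 p -> S2 (hopf p).
Proof.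
rewrite /S3 /S2 /sphere /= dot4E dot3E !mxE /= => h.
have {}h : (p 0 0 * p 0 0 + p 0 1 * p 0 1 + p 0 2 * p 0 2 + p 0 3 * p 0 3) ^+ 2
  = 1 by rewrite h expr1n expr1n.
transitivity (2^-1 ^+ 2 *
  (p 0 0 * p 0 0 + p 0 1 * p 0 1 + p 0 2 * p 0 2 + p 0 3 * p 0 3) ^+ 2).
  by field.
by rewrite h mulr1.
Qed.

Lemma dot_eq0 n (u : 'rV[R]_n) : dot u u = 0 <-> u = 0.
Proof.
split=> [/eqP|->]; last by rewrite /dot big1 // => i _; rewrite mxE mulr0.
rewrite /dot psumr_eq0 => [/allP h|i _]; last exact: sqr_ge0.
apply/rowP => i; apply/eqP; rewrite mxE -sqrf_eq0 expr2.
by rewrite (eqP (h i (mem_index_enum i))).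
Qed.

Lemma hopf_field_tangent p : dot p (hopf_field p) = 0.
Proof. by rewrite dot4E !mxE /=; ring. Qed.

Lemma hopf_field_unit p : S3 p -> dot (hopf_field p) (hopf_field p) = 1.
Proof. by rewrite /S3 /sphere /= expr1n !dot4E !mxE /= => <-; ring. Qed.

Lemma hopf_submersion p u v : S3 p ->
  dot ('D_u hopf p) ('D_v hopf p) = dot (horizontal p u) (horizontal p v).
Proof.
move=> pS; have f1 := hopf_field_unit pS.
have -> : dot (horizontal p u) (horizontal p v) = dot u v +
    (dot (hopf_field p) (hopf_field p) - 2) *
      (dot u (hopf_field p) * dot v (hopf_field p)).
  by rewrite /horizontal /vertical !(dot4E, mxE) /=; ring.
rewrite f1 !derive_hopf.
transitivity (dot p p * dot u v - dot u (hopf_field p) * dot v (hopf_field p)).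
  by rewrite dot3E !dot4E !mxE /=; ring.
by move: pS; rewrite /S3 /sphere /= expr1n => ->; ring.
Qed.

Lemma hopf_verticalP p u : S3 p -> 'D_u hopf p = 0 <-> u = vertical p u.
Proof.
move=> pS; rewrite -dot_eq0 hopf_submersion // dot_eq0 /horizontal.
by split=> [/subr0_eq | /eqP]; rewrite // -subr_eq0 => /eqP.
Qed.

End HopfFibration.

(* Main.v *)
From HB Require Import structures.
Require Import Defs.
From mathcomp Require Import all_boot all_order all_algebra.
From mathcomp Require Import ring lra.
From mathcomp Require Import all_classical all_reals all_analysis.
From mathcomp Require Import measurable_realfun.
Import Order.TTheory GRing.Theory Num.Theory numFieldNormedType.Exports.
Local Open Scope ring_scope.
Local Open Scope classical_set_scope.

Set Implicit Arguments.
Unset Strict Implicit.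
Unset Printing Implicit Defensive.

(** Split a vector v tangent to S^3 at p into a times the unit vertical vector
    and a horizontal part, and project the latter to a vector W tangent to S^2 at
    hopf p.  The map [collapse e] sends (p, v) to (a, (hopf p, W)) in R x TS^2.
    For the Berger metric of parameter e, covariant derivatives of vertical unit
    vectors and of basic horizontal fields are those of R x TS^2 up to terms of
    order e, so that the squared Sasaki norm of a vector tangent to TS^3 and the
    squared norm of its image, to which the square of the vertical velocity e m1
    of the base point is added, differ by a factor 1 + O(e), uniformly for v
    bounded.  This is [form_compare]; the two norms are computed in
    [berger_sasakiE], [round_sasakiE] and [collapse_sqnorm].

    The Levi-Civita connections are only known by their axioms.  On a family of
    fields spanning the tangent spaces they are pinned down by
    [levi_civita_unique], the Koszul formula in disguise.  On S^3 the family is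
    the quaternionic frame (i p, j p, k p); on S^2, which has no frame, it
    consists of the rotation fields.

    Three facts make [collapse e] an almost isometry on balls.
    - Paths project with almost no stretching ([collapse_path]).
    - Paths lift with almost no stretching ([lift_path]).  The lifts are not
      horizontal: as the vertical velocity enters the Sasaki norm with a factor
      e, it suffices that it be bounded by the velocity in S^2.  So a path is
      cut into short pieces, and each one is lifted by an explicit section of
      the Hopf fibration ([lift_curve]).
    - The fibres of [collapse e] are the orbits of the Hopf circle action, and
      have length O(e) ([fibre_path]).

    The estimates need a bound on |v| along the paths under consideration; it
    comes from the function sqrt (1 + |v|^2), which is 1-Lipschitz upstairs and
    downstairs ([berger_height_lipschitz], [height_lipschitz]).

    As the base points p n are arbitrary, [collapse e] is followed by a
    reflection of R^3 taking hopf (p n) to q.  Some points of the open ball of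
    radius r may still land slightly outside the open ball of radius r; they are
    pushed back along almost minimizing paths ([ball_approximation]). *)

(** * Calculus of C^1 curves *)

Section C1Calculus.
Context {R : realType}.

(** A C^1 curve together with its derivative, so that the calculus rules yield
    the derivative along with its existence. *)
Definition C1d (V : normedModType R) (c c' : R -> V) : Prop :=
  (forall t, is_derive t (1 : R) c (c' t)) /\ continuous c'.

Lemma C1_curveP (V : normedModType R) (c : R -> V) :
  C1_curve c <-> C1d c (derive1 c).
Proof.
split=> -[h1 h2]; split=> // t; first by rewrite derive1E; apply: derivableP.
Qed.

Lemma C1dE (V : normedModType R) (c c' : R -> V) : C1d c c' -> derive1 c = c'.
Proof. by move=> [h _]; apply/funext => t; rewrite derive1E; case: (h t). Qed.

Lemma C1d_curve (V : normedModType R) (c c' : R -> V) : C1d c c' -> C1_curve c.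
Proof. by move=> h; apply/C1_curveP; rewrite (C1dE h). Qed.

Lemma C1d_continuous (V : normedModType R) (c c' : R -> V) :
  C1d c c' -> continuous c.
Proof.
by move=> [h _] t; apply: differentiable_continuous; apply/derivable1_diffP.
Qed.

Lemma continuous_row n (T : topologicalType) (c : T -> 'rV[R]_n) :
  (forall i, continuous (fun t => c t 0 i)) -> continuous c.
Proof.
move=> h t; apply/cvgrPdist_le => /= e e0.
have : \forall s \near t, forall j, `|c t 0 j - c s 0 j| <= e.
  apply: (@filter_forall _ _ (fun j s => `|c t 0 j - c s 0 j| <= e)) => j.
  by have /cvgrPdist_le /(_ e e0) := h j t.
apply: filterS => s hs.
rewrite /Num.Def.normr/= mx_normrE (bigmax_le _ (ltW e0))//= => -[i j] _.
by rewrite !mxE/= (ord1 i).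
Qed.

Lemma continuous_coord n (T : topologicalType) (c : T -> 'rV[R]_n) i :
  continuous c -> continuous (fun t => c t 0 i).
Proof.
move=> h t.
by apply: (@continuous_comp _ _ _ c (fun M : 'rV[R]_n => M 0 i) t (h t));
   exact: coord_continuous.
Qed.

Lemma is_derive_row n (V : normedModType R) (c : V -> 'rV[R]_n) c' t v :
  is_derive t v c c' <-> forall i, is_derive t v (fun s => c s 0 i : R) (c' 0 i).
Proof.
split=> [[dc <-] i|h].
  split; first by move/derivable_mxP : dc.
  by rewrite derive_mx // mxE.
have dc : derivable c t v.
  by apply/derivable_mxP => i j; rewrite (ord1 i); case: (h j).
split=> //; rewrite derive_mx //; apply/rowP => i; rewrite mxE.
by case: (h i).
Qed.

Lemma C1d_row n (c c' : R -> 'rV[R]_n) :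
  C1d c c' <-> forall i, C1d (fun t => c t 0 i : R) (fun t => c' t 0 i).
Proof.
split=> [[dc cc] i|h].
  split; last exact: continuous_coord.
  by move=> t; have /is_derive_row := dc t; apply.
split; last by apply: continuous_row => i; case: (h i).
by move=> t; apply/is_derive_row => i; case: (h i).
Qed.

Lemma is_derive_fst (V U W : normedModType R) (c : U -> V * W) c' t v :
  is_derive t v c c' -> is_derive t v (fst \o c) c'.1.
Proof.
move=> [dc <-]; suff : (fun h => h^-1 *: ((fst \o c \o shift t) (h *: v) -
    (fst \o c) t)) @ 0^' --> ('D_v c t).1.
  by move=> h; split; [apply/cvg_ex; exists ('D_v c t).1|apply/cvg_lim].
by apply: (@cvg_comp _ _ _ _ fst _ _ _ dc); exact: cvg_fst.
Qed.

Lemma is_derive_snd (V U W : normedModType R) (c : U -> V * W) c' t v :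
  is_derive t v c c' -> is_derive t v (snd \o c) c'.2.
Proof.
move=> [dc <-]; suff : (fun h => h^-1 *: ((snd \o c \o shift t) (h *: v) -
    (snd \o c) t)) @ 0^' --> ('D_v c t).2.
  by move=> h; split; [apply/cvg_ex; exists ('D_v c t).2|apply/cvg_lim].
by apply: (@cvg_comp _ _ _ _ snd _ _ _ dc); exact: cvg_snd.
Qed.

Lemma is_derive_pair (V U W : normedModType R) (c : U -> V) (e : U -> W)
    c' e' t v :
  is_derive t v c c' -> is_derive t v e e' ->
  is_derive t v (fun s => (c s, e s)) (c', e').
Proof.
move=> [dc <-] [de <-].
suff : (fun h => h^-1 *: (((fun s => (c s, e s)) \o shift t) (h *: v) -
    (c t, e t))) @ 0^' --> ('D_v c t, 'D_v e t).
  by move=> h; split; [apply/cvg_ex; eexists; exact: h|apply/cvg_lim].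
by apply: (cvg_pair dc de).
Qed.

Lemma C1d_fst (V W : normedModType R) (c c' : R -> V * W) :
  C1d c c' -> C1d (fst \o c) (fst \o c').
Proof.
move=> [dc cc]; split=> [t|t]; first by have /is_derive_fst := dc t.
by apply: (@continuous_comp _ _ _ c' fst t (cc t)); exact: cvg_fst.
Qed.

Lemma C1d_snd (V W : normedModType R) (c c' : R -> V * W) :
  C1d c c' -> C1d (snd \o c) (snd \o c').
Proof.
move=> [dc cc]; split=> [t|t]; first by have /is_derive_snd := dc t.
by apply: (@continuous_comp _ _ _ c' snd t (cc t)); exact: cvg_snd.
Qed.

Lemma C1d_pair (V W : normedModType R) (c c' : R -> V) (e e' : R -> W) :
  C1d c c' -> C1d e e' -> C1d (fun t => (c t, e t)) (fun t => (c' t, e' t)).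
Proof.
move=> [dc cc] [de ce]; split=> t; first exact: is_derive_pair.
by apply: (cvg_pair (cc t) (ce t)).
Qed.

Lemma C1d_cst (V : normedModType R) (k : V) : C1d (fun=> k) (fun=> 0).
Proof. by split=> t; [exact: is_derive_cst|exact: cst_continuous]. Qed.

Lemma C1d_id : C1d (id : R -> R) (fun=> 1).
Proof. by split=> t; [exact: is_derive_id|exact: cst_continuous]. Qed.

Lemma C1dD (V : normedModType R) (c c' e e' : R -> V) :
  C1d c c' -> C1d e e' -> C1d (fun t => c t + e t) (fun t => c' t + e' t).
Proof.
move=> [dc cc] [de ce]; split=> t; first exact: is_deriveD.
by apply: cvgD; [exact: cc|exact: ce].
Qed.

Lemma C1dN (V : normedModType R) (c c' : R -> V) :
  C1d c c' -> C1d (fun t => - c t) (fun t => - c' t).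
Proof.
move=> [dc cc]; split=> t; first exact: is_deriveN.
by apply: cvgN; exact: cc.
Qed.

Lemma C1dB (V : normedModType R) (c c' e e' : R -> V) :
  C1d c c' -> C1d e e' -> C1d (fun t => c t - e t) (fun t => c' t - e' t).
Proof. by move=> hc he; apply: C1dD => //; exact: C1dN. Qed.

Lemma C1dM (c c' e e' : R -> R) :
  C1d c c' -> C1d e e' ->
  C1d (fun t => c t * e t) (fun t => c' t * e t + c t * e' t).
Proof.
move=> hc he; have := C1d_continuous hc; have := C1d_continuous he.
move: hc he => [dc cc] [de ce] ce0 cc0; split=> t.
  apply: (is_derive_eq (is_deriveM (dc t) (de t))).
  by rewrite addrC /GRing.scale/= mulrC.
by apply: cvgD; apply: cvgM; [exact: cc|exact: ce0|exact: cc0|exact: ce].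
Qed.

Lemma continuous_sum (T : topologicalType) (V : normedModType R) m
    (f : 'I_m -> T -> V) :
  (forall i, continuous (f i)) -> continuous (fun x => \sum_i f i x).
Proof.
move=> fc; apply: continuous_big => [|i _]; [exact: add_continuous|exact: fc].
Qed.

Lemma continuous_scale (T : topologicalType) (V : normedModType R)
    (a : T -> R) (c : T -> V) :
  continuous a -> continuous c -> continuous (fun t => a t *: c t).
Proof. by move=> ha hc t; apply: cvgZ; [exact: ha|exact: hc]. Qed.

Lemma C1d_sum (V : normedModType R) m (c c' : 'I_m -> R -> V) :
  (forall i, C1d (c i) (c' i)) ->
  C1d (fun t => \sum_i c i t) (fun t => \sum_i c' i t).
Proof.
move=> h; split=> [t|].
  have := is_derive_sum (fun i => (h i).1 t).
  rewrite (_ : \sum_i c i = fun t => \sum_i c i t) //.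
  by apply/funext => s; rewrite fct_sumE.
by apply: continuous_sum => i; case: (h i).
Qed.

Lemma C1d_comp (V : normedModType R) (c c' : R -> V) (f f' : R -> R) :
  C1d c c' -> C1d f f' -> C1d (c \o f) (fun t => f' t *: c' (f t)).
Proof.
move=> hc hf; have cf := C1d_continuous hf.
split=> t; last first.
  apply: cvgZ; first exact: hf.2.
  by apply: (@continuous_comp _ _ _ f c' t (cf t)); exact: hc.2.
have dc : differentiable c (f t).
  by apply/derivable1_diffP; exact: (@ex_derive _ _ _ _ _ _ _ (hc.1 (f t))).
have df : differentiable f t.
  by apply/derivable1_diffP; exact: (@ex_derive _ _ _ _ _ _ _ (hf.1 t)).
split; first by apply/derivable1_diffP/differentiable_comp.
rewrite deriveE; last exact: differentiable_comp.
rewrite diff_comp //= -(deriveE _ df).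
have -> : 'D_1 f t = f' t by case: (hf.1 t).
rewrite -[X in 'd c _ X]mulr1 -[f' t * 1]/(f' t *: 1) linearZ -deriveE //.
by congr (_ *: _); case: (hc.1 (f t)).
Qed.

Lemma C1dZ n (a a' : R -> R) (c c' : R -> 'rV[R]_n) :
  C1d a a' -> C1d c c' ->
  C1d (fun t => a t *: c t) (fun t => a' t *: c t + a t *: c' t).
Proof.
move=> ha /C1d_row hc; apply/C1d_row => i.
have := C1dM ha (hc i).
rewrite (_ : (fun t => a t * c t 0 i) = fun t => (a t *: c t) 0 i); last first.
  by apply/funext => t; rewrite mxE.
rewrite (_ : (fun t => a' t * c t 0 i + _) =
  fun t => (a' t *: c t + a t *: c' t) 0 i) //.
by apply/funext => t; rewrite !mxE.
Qed.

Lemma C1d_rsqrt (g g' : R -> R) : C1d g g' -> (forall t, 0 < g t) ->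
  exists d, C1d (fun t => (Num.sqrt (g t))^-1) d.
Proof.
move=> hg g0; have cg := C1d_continuous hg.
have s0 t : Num.sqrt (g t) != 0 by rewrite gt_eqF // sqrtr_gt0.
have cs : continuous (fun t => Num.sqrt (g t)).
  by move=> t; apply: (@continuous_comp _ _ _ g Num.sqrt t (cg t));
     exact: sqrt_continuous.
exists (fun t => - Num.sqrt (g t) ^- 2 * ((2 * Num.sqrt (g t))^-1 * g' t)).
split=> t.
  apply: is_deriveV => //.
  by apply: (@is_derive1_comp _ Num.sqrt g _ _ _ (is_derive1_sqrt (g0 t))
    (hg.1 t)).
apply: cvgM; last apply: cvgM; last exact: hg.2.
  apply: cvgN; apply: cvgV; first by rewrite expf_neq0.
  by rewrite expr2; apply: cvgM; exact: cs.
apply: cvgV; first by rewrite mulf_neq0.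
by apply: cvgM; [exact: cvg_cst|exact: cs].
Qed.

Lemma C1dV (g g' : R -> R) : C1d g g' -> (forall t, g t != 0) ->
  C1d (fun t => (g t)^-1) (fun t => - g t ^- 2 * g' t).
Proof.
move=> hg g0; have cg := C1d_continuous hg.
split=> t; first by apply: is_deriveV => //; exact: hg.1.
apply: cvgM; last exact: hg.2.
apply: cvgN; apply: cvgV; first by rewrite expf_neq0.
by rewrite expr2; apply: cvgM; exact: cg.
Qed.

Lemma linear_mulmx m n (f : 'rV[R]_m -> 'rV[R]_n) : linear f ->
  exists M : 'M[R]_(m, n), forall x, f x = (x *m M)%R.
Proof.
move=> fL.
pose g : {linear 'rV[R]_m -> 'rV[R]_n} :=
  HB.pack f (GRing.isLinear.Build R _ _ _ f fL).
by exists (lin1_mx g) => x; rewrite mul_rV_lin1.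
Qed.

Lemma linear_sumE m n (f : 'rV[R]_m -> 'rV[R]_n) : linear f ->
  forall x, f x = \sum_i x 0 i *: f (delta_mx 0 i).
Proof.
move=> /linear_mulmx[M fM] x; rewrite {1}(row_sum_delta x) fM mulmx_suml.
by apply: eq_bigr => i _; rewrite fM scalemxAl.
Qed.

Lemma linear_cont m n (f : 'rV[R]_m -> 'rV[R]_n) : linear f -> continuous f.
Proof.
move=> fL; rewrite (funext (linear_sumE fL)).
apply: continuous_sum => i; apply: continuous_scale.
  exact: coord_continuous.
exact: cst_continuous.
Qed.

Lemma C1d_linear m n (f : 'rV[R]_m -> 'rV[R]_n) c c' : linear f ->
  C1d c c' -> C1d (fun t => f (c t)) (fun t => f (c' t)).
Proof.
move=> fL /C1d_row hc.
rewrite (_ : (fun t => f (c t)) =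
  fun t => \sum_i c t 0 i *: f (delta_mx 0 i)); last first.
  by apply/funext => t; exact: linear_sumE.
rewrite (_ : (fun t => f (c' t)) = fun t => \sum_i (c' t 0 i *:
    f (delta_mx 0 i) + c t 0 i *: 0)); last first.
  apply/funext => t; rewrite (linear_sumE fL).
  by apply: eq_bigr => i _; rewrite scaler0 addr0.
by apply: C1d_sum => i; apply: C1dZ => //; exact: C1d_cst.
Qed.

(** Bilinearity reduces to scalar multiplication by coordinates: this covers the
    polar form of the Hopf map and its transpose at once. *)
Lemma C1d_bilinear m n k (B : 'rV[R]_m -> 'rV[R]_n -> 'rV[R]_k) c c' e e' :
  (forall x, linear (B x)) -> (forall y, linear (B^~ y)) ->
  C1d c c' -> C1d e e' ->
  C1d (fun t => B (c t) (e t)) (fun t => B (c' t) (e t) + B (c t) (e' t)).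
Proof.
move=> lB rB /C1d_row hc he.
rewrite (_ : (fun t => B (c t) (e t)) =
  fun t => \sum_i c t 0 i *: B (delta_mx 0 i) (e t)); last first.
  by apply/funext => t; rewrite -(linear_sumE (rB (e t))).
rewrite (_ : (fun t => B (c' t) (e t) + _) = fun t => \sum_i
    (c' t 0 i *: B (delta_mx 0 i) (e t) + c t 0 i *: B (delta_mx 0 i) (e' t))).
  by apply: C1d_sum => i; apply: C1dZ => //; exact: C1d_linear.
apply/funext => t.
by rewrite big_split -(linear_sumE (rB (e t))) -(linear_sumE (rB (e' t))).
Qed.

Lemma C1d_dot n (c c' e e' : R -> 'rV[R]_n) : C1d c c' -> C1d e e' ->
  C1d (fun t => dot (c t) (e t)) (fun t => dot (c' t) (e t) + dot (c t) (e' t)).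
Proof.
move=> /C1d_row hc /C1d_row he.
rewrite (_ : (fun t => dot (c' t) (e t) + _) = fun t => \sum_i
    (c' t 0 i * e t 0 i + c t 0 i * e' t 0 i)).
  by apply: C1d_sum => i; exact: C1dM.
by apply/funext => t; rewrite big_split.
Qed.

Lemma continuous_dot (T : topologicalType) n (c e : T -> 'rV[R]_n) :
  continuous c -> continuous e -> continuous (fun t => dot (c t) (e t)).
Proof.
move=> hc he; apply: continuous_sum => i t.
by apply: cvgM; [exact: continuous_coord|exact: continuous_coord].
Qed.

(** The integral starts at -1 so that 0 is interior and the derivative there is
    two-sided. *)
Lemma antiderivative (s : R -> R) : continuous s ->
  exists l : R -> R, forall t : R, 0 <= t <= 1 -> is_derive t 1 l (s t).
Proof.
move=> cs; exists (fun x => \int[@lebesgue_measure R]_(t in `[-1, x]) s t)%R.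
move=> t /andP[t0 t1].
have si : (@lebesgue_measure R).-integrable `[-1, 2] (EFin \o s).
  apply: continuous_compact_integrable; first exact: segment_compact.
  exact: continuous_subspaceT.
have t2 : t < 2 by apply: (le_lt_trans t1); rewrite ltr1n.
have t_1 : -1 < t by apply: lt_le_trans t0; rewrite ltrN10.
have [dl l's] := continuous_FTC1_closed t2 si t_1 (cs t).
by apply: DeriveDef; [exact: dl|rewrite -derive1E].
Qed.

Lemma Rintegral_FTC2 (s l : R -> R) : continuous s ->
  (forall t : R, 0 <= t <= 1 -> is_derive t 1 l (s t)) ->
  Rintegral (@lebesgue_measure R) `[0, 1] s = l 1 - l 0.
Proof.
move=> cs ls.
have cl (t : R) : 0 <= t <= 1 -> {for t, continuous l}.
  move=> /ls[dl _]; apply: differentiable_continuous.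
  exact/derivable1_diffP.
have oo01 (t : R) : t \in `]0, 1[%R -> 0 <= t <= 1.
  by rewrite in_itv/= => /andP[/ltW -> /ltW ->].
rewrite /Rintegral (@continuous_FTC2 _ s l) //.
- exact: continuous_subspaceT.
- split=> [t t01||].
  + by have [|] := ls t; first exact: oo01.
  + by apply: cvg_at_right_filter; apply: cl; rewrite lexx ler01.
  + by apply: cvg_at_left_filter; apply: cl; rewrite lexx ler01.
- move=> t t01; rewrite derive1E.
  by have [|] := ls t; first exact: oo01.
Qed.

(** The velocity of an arc is only known to be tangent at interior times, so
    integrands are identified on the open interval. *)
Lemma eq_Rintegral_oo (f s : R -> R) : continuous s ->
  (forall t : R, 0 < t < 1 -> f t = s t) ->
  Rintegral (@lebesgue_measure R) `[0, 1] f =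
  Rintegral (@lebesgue_measure R) `[0, 1] s.
Proof.
move=> cs fs.
have ms : measurable_fun (`]0, 1[ : set R) s.
  by apply: measurable_funTS; exact: continuous_measurable_fun.
have fs' : {in `]0, 1[ : set R, s =1 f}.
  by move=> t; rewrite inE/= in_itv/= => /fs.
have mf : measurable_fun (`]0, 1[ : set R) f by apply: eq_measurable_fun ms.
have endpts h : measurable_fun (`]0, 1[ : set R) h ->
    Rintegral (@lebesgue_measure R) `]0, 1[ h =
    Rintegral (@lebesgue_measure R) `[0, 1] h.
  move=> mh; rewrite /Rintegral; congr fine.
  rewrite integral_itv_obnd_cbnd; last exact/measurable_EFinP.
  rewrite integral_itv_bndo_bndc //.
  by apply/measurable_EFinP; apply/measurable_fun_itv_obnd_cbndP.
rewrite -endpts // -endpts //; apply: eq_Rintegral => t t01.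
by rewrite fs'.
Qed.

(** The mean value inequality; all length comparisons go through it, so that no
    integral has to be manipulated once an arc length function is chosen. *)
Lemma increment_le (f h f' h' : R -> R) (a b : R) : a <= b ->
  (forall t, a <= t <= b -> is_derive t 1 f (f' t)) ->
  (forall t, a <= t <= b -> is_derive t 1 h (h' t)) ->
  (forall t, a < t < b -> f' t <= h' t) -> f b - f a <= h b - h a.
Proof.
move=> ab df dh f'h'.
have [->|ab'] := eqVneq a b; first by rewrite !subrr.
have {ab ab'} ab : a < b by rewrite lt_neqAle ab'.
have oo t : t \in `]a, b[%R -> a <= t <= b.
  by rewrite in_itv/= => /andP[/ltW -> /ltW ->].
have d t : a <= t <= b -> is_derive t 1 (fun t => h t - f t) (h' t - f' t).
  by move=> tab; apply: is_deriveB; [exact: dh|exact: df].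
have [c cab] := MVT ab (fun t tab => d t (oo t tab)) (continuous_in_subspaceT
  (fun t tab => differentiable_continuous
    ((derivable1_diffP _ _).1 (@ex_derive _ _ _ _ _ _ _ (d t (set_mem tab)))))).
move=> e; suff : 0 <= h b - f b - (h a - f a) by lra.
rewrite e mulr_ge0 //; last by rewrite subr_ge0 ltW.
by rewrite subr_ge0 f'h' //; move: cab; rewrite in_itv.
Qed.

End C1Calculus.

(** * Lengths of paths and comparison of lengths *)

Section Lengths.
Context {R : realType}.

Definition arc_in (V : normedModType R) (M : set V) (c : R -> V) : Prop :=
  C1_curve c /\ forall t : R, 0 <= t <= 1 -> M (c t).

Definition arclength_of (V : normedModType R) (F : V -> V -> R) (c : R -> V)
    (l : R -> R) : Prop :=
  forall t : R, 0 <= t <= 1 -> is_derive t 1 l (F (c t) (derive1 c t)).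

(** A speed function F computes the norm of velocities of curves in M by a
    formula that is total and continuous, whereas g itself is only controlled at
    tangent vectors. *)
Record speed_of (V : normedModType R) (M : set V) (g : V -> V -> V -> R)
    (F : V -> V -> R) : Prop := SpeedOf {
  speed_hom : forall x k u, F x (k *: u) = `|k| * F x u;
  speed_ge0 : forall x u, 0 <= F x u;
  speed_cont : forall c u : R -> V, continuous c -> continuous u ->
    continuous (fun t => F (c t) (u t));
  speedE : forall c t, C1_curve c -> (\forall s \near t, M (c s)) ->
    Num.sqrt (g (c t) (derive1 c t) (derive1 c t)) = F (c t) (derive1 c t)
}.

(** Infinitesimal form, along arcs. *)
Definition one_lipschitz (V : normedModType R) (M : set V) (F : V -> V -> R)
    (f : V -> R) : Prop :=
  forall c, arc_in M c -> exists h', forall t : R, 0 <= t <= 1 ->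
    is_derive t 1 (f \o c) (h' t) /\
    (0 < t < 1 -> h' t <= F (c t) (derive1 c t)).

Lemma in_itv01 (t : R) : (t \in `[0, 1]) = (0 <= t <= 1).
Proof.
by apply/idP/idP => [/set_mem/=|h]; [|apply: mem_set => /=]; rewrite in_itv.
Qed.

Lemma near_in_itv01 (P : R -> Prop) (t : R) : 0 < t < 1 ->
  (forall s, 0 <= s <= 1 -> P s) -> \forall s \near t, P s.
Proof.
move=> /andP[t0 t1] h; near=> s; apply: h; apply/andP; split; near: s.
  by apply: filterS (lt_nbhsr t0) => s /ltW.
by apply: filterS (lt_nbhsl t1) => s /ltW.
Unshelve. all: by end_near. Qed.

Section OneMetric.
Variables (V : normedModType R) (M : set V) (g : V -> V -> V -> R).
Variable F : V -> V -> R.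
Hypothesis Fg : speed_of M g F.

Lemma continuous_speed c : C1_curve c ->
  continuous (fun t => F (c t) (derive1 c t)).
Proof.
move=> hc; have /C1d_continuous cc := (C1_curveP c).1 hc.
by apply: (speed_cont Fg) => //; case: hc.
Qed.

Lemma arclength_exists c : C1_curve c -> exists l, arclength_of F c l.
Proof. by move=> /continuous_speed /antiderivative. Qed.

Lemma arc_lengthE c l : arc_in M c -> arclength_of F c l ->
  arc_length g c = l 1 - l 0.
Proof.
move=> [hc cM] hl.
rewrite -(Rintegral_FTC2 (continuous_speed hc) hl).
apply: eq_Rintegral_oo; first exact: continuous_speed.
by move=> t t01; apply: (speedE Fg) => //; exact: near_in_itv01.
Qed.

Lemma arc_path_length c l : arc_in M c -> arclength_of F c l ->
  path_length M g (c 0) (c 1) (l 1 - l 0).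
Proof.
move=> cM hl; rewrite -(arc_lengthE cM hl); apply: path_arc; first by case: cM.
by move=> t; rewrite in_itv01; case: cM => _; apply.
Qed.

(** Induction over paths in which arc lengths appear as increments of an arc
    length function. *)
Lemma path_length_arc_ind (P : V -> V -> R -> Prop) :
  (forall c l, arc_in M c -> arclength_of F c l -> P (c 0) (c 1) (l 1 - l 0)) ->
  (forall x y z l l', path_length M g x y l -> P x y l ->
     path_length M g y z l' -> P y z l' -> P x z (l + l')) ->
  forall x y l, path_length M g x y l -> P x y l.
Proof.
move=> Parc Pcat x y l.
elim=> [c hc cM|x0 y0 z0 l0 l0' h ih h' ih']; last exact: (Pcat _ y0).
have cM' : arc_in M c by split=> // t; rewrite -in_itv01; exact: cM.
have [l' hl'] := arclength_exists hc.
by rewrite (arc_lengthE cM' hl'); exact: Parc.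
Qed.

Lemma arclength_mono c l a b : 0 <= a -> a <= b -> b <= 1 ->
  arclength_of F c l -> l a <= l b.
Proof.
move=> a0 ab b1 hl; rewrite -subr_ge0 -[leLHS](subrr 0).
apply: (@increment_le _ (fun=> 0) l (fun=> 0)
  (fun t => F (c t) (derive1 c t)) a b) => //.
- by move=> t /andP[ta tb]; apply: hl; rewrite (le_trans a0) ?(le_trans tb).
- by move=> *; exact: (speed_ge0 Fg).
Qed.

Lemma path_length_ge0 x y l : path_length M g x y l -> 0 <= l.
Proof.
elim/path_length_arc_ind => {x y l} [c l cM hl|x y z l l' _ l0 _ l'0].
  by rewrite subr_ge0; apply: (arclength_mono _ _ _ hl).
exact: addr_ge0.
Qed.

(** The factor k is 1 or -1 according to the direction of the change of
    parameter; the latter case reverses arcs. *)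
Lemma arclength_reparam c l (tau tau' : R -> R) k :
  C1_curve c -> arclength_of F c l -> C1d tau tau' ->
  (forall t : R, 0 <= t <= 1 -> 0 <= tau t <= 1) ->
  (forall t : R, 0 <= t <= 1 -> `|tau' t| = k * tau' t) ->
  arclength_of F (c \o tau) (fun t => k * l (tau t)).
Proof.
move=> hc hl ht t01 kt t tt.
rewrite (C1dE (C1d_comp ((C1_curveP c).1 hc) ht)) (speed_hom Fg) kt // -mulrA.
apply: (@is_deriveZ _ _ _ (l \o tau) k); rewrite mulrC.
by apply: is_derive1_comp; [exact: hl (t01 _ tt)|exact: ht.1].
Qed.

Lemma arc_reparam c l (tau tau' : R -> R) k : arc_in M c -> arclength_of F c l ->
  C1d tau tau' -> (forall t : R, 0 <= t <= 1 -> 0 <= tau t <= 1) ->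
  (forall t : R, 0 <= t <= 1 -> `|tau' t| = k * tau' t) ->
  path_length M g (c (tau 0)) (c (tau 1)) (k * l (tau 1) - k * l (tau 0)).
Proof.
move=> [hc cM] hl ht t01 kt.
apply: (@arc_path_length (c \o tau) (fun t => k * l (tau t))).
  split; first exact: C1d_curve (C1d_comp ((C1_curveP c).1 hc) ht).
  by move=> t /t01; exact: cM.
exact: arclength_reparam hc hl ht t01 kt.
Qed.

Lemma path_length_sym x y l : path_length M g x y l -> path_length M g y x l.
Proof.
elim/path_length_arc_ind => {x y l} [c l cM hl|x y z l l' _ h _ h'].
  have h : C1d (fun t : R => 1 - t) (fun=> 0 - 1).
    by apply: C1dB; [exact: C1d_cst|exact: C1d_id].
  have := @arc_reparam c l _ _ (-1) cM hl h.
  rewrite subr0 subrr !mulN1r opprK [_ + l 1]addrC; apply.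
    by move=> t; lra.
  by move=> t _; rewrite sub0r normrN1 opprK.
by rewrite addrC; exact: path_cat h' h.
Qed.

Lemma subarc c l a b : 0 <= a -> a <= b -> b <= 1 ->
  arc_in M c -> arclength_of F c l ->
  path_length M g (c a) (c b) (l b - l a).
Proof.
move=> a0 ab b1 cM hl.
have h : C1d (fun t : R => a + (b - a) * t) (fun t => 0 + (0 * t + (b - a) * 1)).
  by apply: C1dD; [exact: C1d_cst|apply: C1dM; [exact: C1d_cst|exact: C1d_id]].
have := @arc_reparam c l _ _ 1 cM hl h.
rewrite !mulr0 !mulr1 !mul1r addr0 addrCA subrr addr0; apply.
  move=> t /andP[t0 t1]; apply/andP; split.
    by rewrite addr_ge0 // mulr_ge0 // subr_ge0.
  rewrite (le_trans _ b1) // -lerBrDl ler_piMr // subr_ge0//.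
by move=> t _; rewrite mul1r mul0r !add0r ger0_norm // subr_ge0.
Qed.

(** Arc length being continuous, the intermediate value theorem applies. *)
Lemma path_length_split x y l s : path_length M g x y l -> 0 <= s <= l ->
  exists z l1 l2, [/\ path_length M g x z l1, path_length M g z y l2,
    l1 <= s & l2 <= l - s].
Proof.
move=> pxy; elim/path_length_arc_ind: pxy s => {x y l}
    [c l cM hl s|x y z l l' pxy ih pyz ih' s] /andP[s0 sl].
  have cl (t : R) : 0 <= t <= 1 -> {for t, continuous l}.
    move=> /hl[dl _]; apply: differentiable_continuous.
    exact/derivable1_diffP.
  have lc : {within `[0, 1], continuous l}.
    by apply: continuous_in_subspaceT => t; rewrite in_itv01; exact: cl.
  have [||t] := @IVT _ l 0 1 (l 0 + s) _ lc; rewrite ?ler01 //.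
    have l01 : l 0 <= l 1 by rewrite -subr_ge0 (le_trans s0).
    by rewrite minElt maxElt; case: ltP => ?; lra.
  rewrite in_itv/= => /andP[t0 t1] lt.
  exists (c t), (l t - l 0), (l 1 - l t); split.
  - exact: subarc.
  - exact: subarc.
  - by rewrite lt; lra.
  - by rewrite lt; lra.
have [ls|ls] := leP s l.
  have [|w [l1 [l2 [h1 h2 l1s l2s]]]] := ih s; first by rewrite s0.
  exists w, l1, (l2 + l'); split=> //; first exact: path_cat h2 pyz.
  by lra.
have [|w [l1 [l2 [h1 h2 l1s l2s]]]] := ih' (s - l); first by lra.
exists w, (l + l1), l2; split=> //; [exact: path_cat pxy h1|lra|lra].
Qed.

Lemma lipschitz_arc f c l t : one_lipschitz M F f -> arc_in M c ->
  arclength_of F c l -> 0 <= t <= 1 -> f (c t) - f (c 0) <= l t - l 0.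
Proof.
move=> hf cM hl /andP[t0 t1]; have [h' hh'] := hf _ cM.
have sub s : 0 <= s <= t -> 0 <= s <= 1.
  by move=> /andP[-> /le_trans ->].
apply: (@increment_le _ (f \o c) l h'
  (fun t => F (c t) (derive1 c t)) 0 t) => //.
- by move=> s /sub/hh'[].
- by move=> s /sub; exact: hl.
- move=> s /andP[s0 st]; apply: (hh' s _).2; last first.
    by rewrite s0 (lt_le_trans st).
  by apply: sub; rewrite !ltW.
Qed.

Lemma lipschitz_path f x y l : one_lipschitz M F f ->
  path_length M g x y l -> f y <= f x + l.
Proof.
move=> hf; elim/path_length_arc_ind => {x y l} [c l cM hl|x y z l l' _ h _ h'].
  by have := lipschitz_arc hf cM hl (t := 1); rewrite ler01 lexx => /(_ isT); lra.
by lra.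
Qed.

Definition path_connected : Prop :=
  forall x y, M x -> M y -> exists l, path_length M g x y l.

Local Notation d := (riem_dist M g).

Lemma path_length_lbound x y : has_lbound [set l | path_length M g x y l].
Proof. by exists 0 => l /path_length_ge0. Qed.

Lemma riem_dist_le x y l : path_length M g x y l -> d x y <= l.
Proof. by move=> h; apply: ge_inf => //; exact: path_length_lbound. Qed.

Lemma riem_dist_lt x y r : path_connected -> M x -> M y -> d x y < r ->
  exists2 l, path_length M g x y l & l < r.
Proof.
move=> conn Mx My; have [l0 h0] := conn x y Mx My; rewrite -subr_gt0 => r0.
have [|l hl] := inf_adherent r0 (E := [set l | path_length M g x y l]).
  by split; [exists l0|exact: path_length_lbound].
by rewrite addrC subrK => lr; exists l.
Qed.

Lemma riem_dist_triangle x y z : path_connected -> M x -> M y -> M z ->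
  d x z <= d x y + d y z.
Proof.
move=> conn Mx My Mz; apply/ler_addgt0Pr => e e0.
have e20 : 0 < e / 2 by rewrite divr_gt0.
have [|l hl l1] := @riem_dist_lt x y (d x y + e / 2) conn Mx My.
  by rewrite ltrDl.
have [|l' hl' l1'] := @riem_dist_lt y z (d y z + e / 2) conn My Mz.
  by rewrite ltrDl.
have := riem_dist_le (path_cat hl hl'); lra.
Qed.

Lemma riem_dist_sym x y : d x y = d y x.
Proof.
by congr inf; apply/seteqP; split=> l /=; exact: path_length_sym.
Qed.

Lemma path_length_refl x : M x -> path_length M g x x 0.
Proof.
move=> Mx; have hc : C1d (fun=> x) (fun=> 0 : V) by exact: C1d_cst.
have := @arc_path_length (fun=> x) (fun=> 0); rewrite subrr; apply.
  by split; [exact: C1d_curve hc|].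
move=> t _; rewrite (C1dE hc) -(scale0r (0 : V)) (speed_hom Fg) normr0 mul0r.
exact: is_derive_cst.
Qed.

End OneMetric.

(** The comparison of speeds is only needed where the control function f stays
    below K, which f being 1-Lipschitz ensures for all paths of length at most
    K - f x. *)
Lemma path_length_map (V V' : normedModType R) (M : set V) (M' : set V')
    (g : V -> V -> V -> R) (g' : V' -> V' -> V' -> R)
    (F : V -> V -> R) (F' : V' -> V' -> R) (Phi : V -> V') f (k K : R) :
  speed_of M g F -> speed_of M' g' F' -> one_lipschitz M F f ->
  (forall c, arc_in M c -> arc_in M' (Phi \o c)) ->
  (forall c t, arc_in M c -> 0 < t < 1 -> f (c t) <= K ->
     F' (Phi (c t)) (derive1 (Phi \o c) t) <= k * F (c t) (derive1 c t)) ->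
  forall x y l, path_length M g x y l -> f x + l <= K ->
  exists2 l', path_length M' g' (Phi x) (Phi y) l' & l' <= k * l.
Proof.
move=> Fg Fg' flip PhiM PhiF x y l h.
elim/(path_length_arc_ind Fg): h => {x y l}
    [c l cM hl fK|x y z l l' pxy ih pyz ih' fK].
  have [l' hl'] := arclength_exists Fg' (PhiM _ cM).1.
  exists (l' 1 - l' 0).
    exact: (arc_path_length Fg' (PhiM _ cM) hl').
  rewrite mulrBr; apply: (@increment_le _ l' (fun t => k * l t)
    (fun t => F' (Phi (c t)) (derive1 (Phi \o c) t))
    (fun t => k * F (c t) (derive1 c t))) => //.
    by move=> t /hl dl; exact: (@is_deriveZ _ _ _ l k).
  move=> t t01; have t01' : 0 <= t <= 1 by case/andP: t01 => /ltW -> /ltW ->.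
  apply: PhiF => //.
  have h1 := lipschitz_arc flip cM hl t01'.
  suff : l t <= l 1 by lra.
  by apply: (arclength_mono Fg _ _ _ hl) => //; case/andP: t01'.
have l'0 := path_length_ge0 Fg pyz.
have [|m hm ml] := ih; first by lra.
have [|m' hm' ml'] := ih'; first by have := lipschitz_path Fg flip pxy; lra.
by exists (m + m'); [exact: path_cat hm hm'|lra].
Qed.

End Lengths.

(** * Tangent spaces of spheres, and linear vector fields *)

Section SphereTangent.
Context {R : realType}.

Lemma dotC n (u v : 'rV[R]_n) : dot u v = dot v u.
Proof. by apply: eq_bigr => i _; rewrite mulrC. Qed.

Lemma dotDl n (u v w : 'rV[R]_n) : dot (u + v) w = dot u w + dot v w.
Proof. by rewrite -big_split; apply: eq_bigr => i _; rewrite mxE mulrDl. Qed.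

Lemma dotZl n a (u v : 'rV[R]_n) : dot (a *: u) v = a * dot u v.
Proof. by rewrite /dot big_distrr; apply: eq_bigr => i _; rewrite /= mxE mulrA. Qed.

Lemma dotDr n (u v w : 'rV[R]_n) : dot w (u + v) = dot w u + dot w v.
Proof. by rewrite ![dot w _]dotC dotDl. Qed.

Lemma dotZr n a (u v : 'rV[R]_n) : dot u (a *: v) = a * dot u v.
Proof. by rewrite ![dot u _]dotC dotZl. Qed.

Lemma dotNl n (u v : 'rV[R]_n) : dot (- u) v = - dot u v.
Proof. by rewrite -scaleN1r dotZl mulN1r. Qed.

Lemma dotNr n (u v : 'rV[R]_n) : dot u (- v) = - dot u v.
Proof. by rewrite ![dot u _]dotC dotNl. Qed.

Lemma dot0l n (u : 'rV[R]_n) : dot 0 u = 0.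
Proof. by rewrite -(scale0r u) dotZl mul0r. Qed.

Lemma dot0r n (u : 'rV[R]_n) : dot u 0 = 0.
Proof. by rewrite dotC dot0l. Qed.

Lemma dot_ge0 n (u : 'rV[R]_n) : 0 <= dot u u.
Proof. by apply: sumr_ge0 => i _; exact: sqr_ge0. Qed.

Definition dotE := (dotDl, dotDr, dotZl, dotZr, dotNl, dotNr, dot0l, dot0r).

Lemma dot_cauchy n (u v : 'rV[R]_n) : dot u v ^+ 2 <= dot u u * dot v v.
Proof.
have [/dot_eq0 -> |v0] := eqVneq (dot v v) 0.
  by rewrite !dot0r expr0n/= mulr0.
have {}v0 : 0 < dot v v by rewrite lt_neqAle eq_sym v0 dot_ge0.
rewrite -subr_ge0 -(pmulr_rge0 _ v0).
have := dot_ge0 (dot v v *: u - dot u v *: v).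
by rewrite !dotE (dotC v u) => /le_trans; apply; rewrite le_eqVlt; apply/orP;
  left; apply/eqP; ring.
Qed.

Lemma C1d_near_cst (f f' : R -> R) (t k : R) : C1d f f' ->
  (\forall s \near t, f s = k) -> f' t = 0.
Proof.
move=> hf fk; have [_ <-] := hf.1 t.
by rewrite (@near_eq_derive _ _ _ f (cst k)) ?derive_cst.
Qed.

Lemma C1d_near_eq n (c c' e e' : R -> 'rV[R]_n) (t : R) : C1d c c' -> C1d e e' ->
  (\forall s \near t, c s = e s) -> c' t = e' t.
Proof.
move=> hc he ce; have [_ <-] := hc.1 t; have [_ <-] := he.1 t.
exact: near_eq_derive.
Qed.

(** A curve with velocity u at 0 is found by inverse stereographic projection,
    which is rational in t. *)
Lemma tangent_sphereP n (r : R) (p u : 'rV[R]_n) : 0 < r -> sphere r p ->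
  tangent (sphere r) p u <-> dot p u = 0.
Proof.
move=> r0 pr; split=> [[c [hc c0 cS c'0]]|pu].
  move/C1_curveP : hc => hc.
  have := C1d_near_cst (C1d_dot hc hc) cS.
  by rewrite c0 c'0 dotC => /eqP; rewrite -mulr2n mulrn_eq0 /= => /eqP.
pose k := dot u u / (4 * r ^+ 2).
have k0 : 0 <= k by rewrite divr_ge0 ?dot_ge0 // mulr_ge0 ?sqr_ge0.
have den t : 0 < 1 + k * (t * t).
  by apply: ltr_wpDr; rewrite // mulr_ge0 // -expr2 sqr_ge0.
have ht := @C1d_id R.
have hk := C1dM (C1d_cst k) (C1dM ht ht).
have hden := C1dV (C1dD (C1d_cst (1 : R)) hk) (fun t => lt0r_neq0 (den t)).
have hnum := C1dD (C1dZ (C1dB (C1d_cst (1 : R)) hk) (C1d_cst p)) (C1dZ ht (C1d_cst u)).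
have hc := C1dZ hden hnum.
eexists; split; first exact: C1d_curve hc.
- by rewrite /= !mul0r !mulr0 addr0 subr0 invr1 !scale1r scale0r addr0.
- apply: (@nearW _ (nbhs (0 : R))) => t /=; rewrite /sphere/= !dotE (dotC u p) pu.
  have pr' : dot p p = r ^+ 2 := pr.
  have uk : dot u u = 4 * k * r ^+ 2.
    by rewrite /k; field; rewrite gt_eqF.
  rewrite pr' uk; have := lt0r_neq0 (den t).
  by move=> ?; field.
- rewrite (C1dE hc) /= !(mul0r, mulr0, addr0, subr0, add0r, scaler0, scale0r).
  by rewrite !(expr1n, invr1, oppr0, scale1r, scale0r, addr0, add0r).
Qed.

End SphereTangent.

Section SmoothLinear.
Context {R : realType}.

Lemma is_derive_linear m n (f : 'rV[R]_m -> 'rV[R]_n) p v : linear f ->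
  is_derive p v f (f v) /\ differentiable f p.
Proof.
move=> fL; have fc := linear_cont fL.
pose g : {linear 'rV[R]_m -> 'rV[R]_n} :=
  HB.pack f (GRing.isLinear.Build R _ _ _ f fL).
have dg : differentiable g p by apply: linear_differentiable; exact: fc.
split=> //; split; first exact: diff_derivable.
by rewrite (deriveE _ dg) diff_lin //; exact: fc.
Qed.

Lemma smooth_linear m n (M : set 'rV[R]_m) (f : 'rV[R]_m -> 'rV[R]_n) :
  linear f -> smooth_near M f.
Proof.
move=> fL; exists setT; split=> //; first exact: openT.
have Ccst k (y : 'rV[R]_n) : Ck k setT (cst y : 'rV[R]_m -> _).
  elim: k y => [|k ih] y /=; first by move=> x _; exact: cst_continuous.
  split=> [x _|v]; first exact: differentiable_cst.
  by rewrite (_ : 'D_v _ = cst 0) //; apply/funext => x; rewrite derive_cst.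
case=> [|k] /=; first by move=> x _; exact: linear_cont.
split=> [x _|v]; first by have [] := is_derive_linear x 0 fL.
rewrite (_ : 'D_v f = cst (f v)) //; apply/funext => x.
by have [[]] := is_derive_linear x v fL.
Qed.

End SmoothLinear.

(** * Uniqueness of the Levi-Civita connection *)

Section Koszul.
Context {R : realType}.

(** The difference of two metric, torsion-free connections is symmetric in its
    first two arguments and skew in its last two, hence zero; only its values on
    the given fields are used. *)
Lemma levi_civita_unique (V : normedModType R) (M : set V)
    (g : V -> V -> V -> R) D (I : Type) (X : I -> V -> V) (D0 : I -> I -> V) p :
  levi_civita M g D -> (forall i, vector_field M (X i)) -> M p ->
  (forall u v w, g p (u - v) w = g p u w - g p v w) ->
  (forall u v, g p u v = g p v u) ->
  (forall i j, D0 i j - D0 j i = 'D_(X i p) (X j) p - 'D_(X j p) (X i) p) ->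
  (forall i j k, 'D_(X i p) (fun q => g q (X j q) (X k q) : R^o) p =
     g p (D0 i j) (X k p) + g p (X j p) (D0 i k)) ->
  forall i j k, g p (D p (X i p) (X j)) (X k p) = g p (D0 i j) (X k p).
Proof.
move=> lcD hX Mp gB gC tor met i j k; have tX l : tangent M p (X l p).
  by case: (hX l) => _; apply.
pose B a b c := g p (D p (X a p) (X b)) (X c p) - g p (D0 a b) (X c p).
have skew a b c : B a b c = - B a c b.
  have := lc_metric lcD Mp (tX a) (hX b) (hX c).
  by rewrite met /B ![g p (X b p) _]gC; lra.
have sym a b c : B a b c = B b a c.
  have /(congr1 (fun u => g p u (X c p))) :=
    etrans (lc_torsion_free lcD Mp (hX a) (hX b)) (esym (tor a b)).
  by rewrite !gB /B; lra.
apply/eqP; rewrite -subr_eq0 -/(B i j k); apply/eqP.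
have := skew i j k; rewrite (sym i k j) (skew k i j) (sym k j i) (skew j k i).
by rewrite (sym j i k) opprK => ?; lra.
Qed.

End Koszul.

(** * The Sasaki metric of a Berger sphere *)

Section SasakiBerger.
Context {R : realType}.
Implicit Types p u v : 'rV[R]_4.

Lemma row4P u v : u 0 0 = v 0 0 -> u 0 1 = v 0 1 -> u 0 2 = v 0 2 ->
  u 0 3 = v 0 3 -> u = v.
Proof.
move=> h0 h1 h2 h3; apply/rowP => -[[|[|[|[|//]]]] i].
- by rewrite (_ : Ordinal i = 0) //; exact: val_inj.
- by rewrite (_ : Ordinal i = 1) //; exact: val_inj.
- by rewrite (_ : Ordinal i = 2) //; exact: val_inj.
- by rewrite (_ : Ordinal i = 3) //; exact: val_inj.
Qed.

Lemma sum3E (V : nmodType) (f : 'I_3 -> V) : \sum_i f i = f 0 + f 1 + f 2.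
Proof.
rewrite !big_ord_recl big_ord0 addr0 addrA.
by congr (f _ + f _ + f _); exact: val_inj.
Qed.

(** [hopf_field], [jfield] and [kfield] are the left multiplications by the
    quaternion units i, j and k. *)
Definition jfield p : 'rV[R]_4 := \row_k [:: - p 0 2; p 0 3; p 0 0; - p 0 1]`_k.

Definition kfield p : 'rV[R]_4 := \row_k [:: - p 0 3; - p 0 2; p 0 1; p 0 0]`_k.

Definition frame (i : 'I_3) p : 'rV[R]_4 :=
  nth (fun=> 0) [:: hopf_field; jfield; kfield] i p.

Lemma linear_frame i : linear (frame i).
Proof.
move=> a u v; case: i => -[|[|[|//]]] i /=; rewrite /frame /=.
all: by apply: row4P; rewrite !mxE /=; ring.
Qed.

Lemma frame_tangent i p : dot p (frame i p) = 0.
Proof.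
by case: i => -[|[|[|//]]] i; rewrite /frame /= dot4E !mxE /=; ring.
Qed.

Lemma vector_field_frame i : vector_field S3 (frame i).
Proof.
split; first by apply: smooth_linear; exact: linear_frame.
by move=> p pS; apply/(tangent_sphereP _ ltr01) => //; exact: frame_tangent.
Qed.

Definition comb p (a b c : R) : 'rV[R]_4 :=
  a *: hopf_field p + b *: jfield p + c *: kfield p.

Lemma frame_comb (i : 'I_3) p :
  frame i p = comb p (i == 0 :> nat)%:R (i == 1 :> nat)%:R (i == 2 :> nat)%:R.
Proof.
case: i => -[|[|[|//]]] i; rewrite /frame /comb /= !scale1r !scale0r.
- by rewrite !addr0.
- by rewrite addr0 add0r.
- by rewrite !add0r.
Qed.

Lemma combD p a b c a' b' c' :
  comb p a b c + comb p a' b' c' = comb p (a + a') (b + b') (c + c').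
Proof. by apply: row4P; rewrite !mxE /=; ring. Qed.

Lemma combZ p k a b c : k *: comb p a b c = comb p (k * a) (k * b) (k * c).
Proof. by apply: row4P; rewrite !mxE /=; ring. Qed.

Lemma combB p a b c a' b' c' :
  comb p a b c - comb p a' b' c' = comb p (a - a') (b - b') (c - c').
Proof. by apply: row4P; rewrite !mxE /=; ring. Qed.

Lemma dot_S3 p : S3 p -> dot p p = 1.
Proof. by move=> pS; rewrite [LHS]pS expr1n. Qed.

Lemma frame_decomp p u : S3 p -> dot p u = 0 ->
  u = comb p (dot u (hopf_field p)) (dot u (jfield p)) (dot u (kfield p)).
Proof.
move=> /dot_S3 pS pu.
transitivity (dot p p *: u - dot p u *: p).
  by rewrite pS pu scale1r scale0r subr0.
by apply: row4P; rewrite !(dot4E, mxE) /=; ring.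
Qed.

Lemma dot_comb p a b c a' b' c' : S3 p ->
  dot (comb p a b c) (comb p a' b' c') = a * a' + b * b' + c * c'.
Proof.
move=> /dot_S3 pS.
transitivity ((a * a' + b * b' + c * c') * dot p p); last by rewrite pS mulr1.
by rewrite !(dot4E, mxE) /=; ring.
Qed.

Lemma comb_tangent p a b c : dot p (comb p a b c) = 0.
Proof. by rewrite !(dot4E, mxE) /=; ring. Qed.

Lemma berger_comb e p a b c a' b' c' : S3 p ->
  berger_metric e p (comb p a b c) (comb p a' b' c') =
  e ^+ 2 * (a * a') + b * b' + c * c'.
Proof.
move=> pS; have vE x y z : vertical p (comb p x y z) = comb p x 0 0.
  rewrite /vertical; have := dot_comb x y z 1 0 0 pS.
  by rewrite /comb !scale1r !scale0r !addr0 !mulr0 !addr0 mulr1 => ->.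
have hE x y z : horizontal p (comb p x y z) = comb p 0 y z.
  by rewrite /horizontal vE combB subrr !subr0.
by rewrite /berger_metric !hE !vE !dot_comb //; ring.
Qed.

Lemma berger_metricC e p u v : berger_metric e p u v = berger_metric e p v u.
Proof. by rewrite /berger_metric dotC [dot (vertical _ _) _]dotC. Qed.

Lemma berger_metricB e p u v w :
  berger_metric e p (u - v) w = berger_metric e p u w - berger_metric e p v w.
Proof. by rewrite /berger_metric /horizontal /vertical !dotE; ring. Qed.

(** Away from S^3 the metric coefficients of the frame are still polynomials in
    |q|^2; hence they have no derivative in the directions tangent to S^3. *)
Lemma berger_frame_poly e (i j : 'I_3) : exists a b c, forall q,
  berger_metric e q (frame i q) (frame j q) =
  a * dot q q + b * dot q q ^+ 2 + c * dot q q ^+ 3.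
Proof.
have [h1 h2 h3] : [/\ forall q : 'rV[R]_4, dot (hopf_field q) (hopf_field q) = dot q q,
    forall q : 'rV[R]_4, dot (jfield q) (jfield q) = dot q q &
    forall q : 'rV[R]_4, dot (kfield q) (kfield q) = dot q q].
  by split=> q; rewrite !dot4E !mxE /=; ring.
have [h4 h5 h6] : [/\ forall q : 'rV[R]_4, dot (jfield q) (hopf_field q) = 0,
    forall q : 'rV[R]_4, dot (kfield q) (hopf_field q) = 0 &
    forall q : 'rV[R]_4, dot (jfield q) (kfield q) = 0].
  by split=> q; rewrite !dot4E !mxE /=; ring.
pose z : nat -> nat -> R * R * R := fun i j =>
  if i == j then if i == 0%N then (1, - 2, 1 + e ^+ 2) else (1, 0, 0)
  else (0, 0, 0).
exists (z i j).1.1, (z i j).1.2, (z i j).2 => q.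
case: i => -[|[|[|//]]] i; case: j => -[|[|[|//]]] j;
rewrite /frame /z /berger_metric /horizontal /vertical /= !dotE;
rewrite ?[dot (hopf_field q) (jfield q)]dotC ?[dot (hopf_field q) (kfield q)]dotC;
rewrite ?[dot (kfield q) (jfield q)]dotC !(h1, h2, h3, h4, h5, h6); ring.
Qed.

Lemma is_derive_sqnorm n (p u : 'rV[R]_n) :
  is_derive p u (fun q => dot q q : R) (2 * dot p u).
Proof.
have h i : is_derive p u (fun q : 'rV[R]_n => q 0 i : R) (u 0 i).
  by have /is_derive_row := is_derive_id p u; apply.
have := is_derive_sum (fun i => is_deriveM (h i) (h i)).
rewrite (_ : \sum_i _ = (fun q => dot q q)); last first.
  by apply/funext => q; rewrite fct_sumE.
move=> /is_derive_eq; apply; rewrite /dot big_distrr /=.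
by apply: eq_bigr => i _; rewrite /GRing.scale/=; ring.
Qed.

Lemma derive_berger_frame e (p u : 'rV[R]_4) i j : dot p u = 0 ->
  'D_u (fun q => berger_metric e q (frame i q) (frame j q) : R^o) p = 0.
Proof.
move=> pu; have [a [b [c habc]]] := berger_frame_poly e i j.
rewrite (funext habc).
have hN := is_derive_sqnorm p u; rewrite pu mulr0 in hN.
set N := (fun q => dot q q) in hN.
have h := is_deriveD (is_deriveD (is_deriveZ a hN)
  (is_deriveZ b (is_deriveX 2 hN))) (is_deriveZ c (is_deriveX 3 hN)).
rewrite (_ : (fun q => _) = a \*: N + b \*: (N ^+ 2) + c \*: (N ^+ 3)) //.
by case: h => _ ->; rewrite !scaler0 !addr0.
Qed.

(** Frame coordinates of the derivative of the j-th field along the i-th one.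
    They follow from the brackets [i, j] = -2 k (and cyclic permutations) of the
    frame fields and the Koszul formula. *)
Definition christoffel (e : R) (i j : nat) : R * R * R :=
  nth (0, 0, 0) (nth [::] [::
    [:: (0, 0, 0); (0, 0, e ^+ 2 - 2); (0, 2 - e ^+ 2, 0)];
    [:: (0, 0, e ^+ 2); (0, 0, 0); (- 1, 0, 0)];
    [:: (0, - e ^+ 2, 0); (1, 0, 0); (0, 0, 0)]] i) j.

Definition berger_connection (e : R) p (i j : nat) : 'rV[R]_4 :=
  comb p (christoffel e i j).1.1 (christoffel e i j).1.2 (christoffel e i j).2.

(** Both sides have the same products with the frame, and both are tangent. *)
Lemma berger_levi_civita e D p (i j : 'I_3) : 0 < e -> S3 p ->
  levi_civita S3 (berger_metric e) D ->
  D p (frame i p) (frame j) = berger_connection e p i j.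
Proof.
move=> e0 pS lcD.
have Dt : dot p (D p (frame i p) (frame j)) = 0.
  apply/(tangent_sphereP _ ltr01) => //.
  apply: (ac_tangent (lc_connection lcD)) => //.
    by case: (vector_field_frame i) => _; apply.
  exact: vector_field_frame.
have uniq k : berger_metric e p (D p (frame i p) (frame j)) (frame k p) =
    berger_metric e p (berger_connection e p i j) (frame k p).
  apply: (@levi_civita_unique _ _ S3 (berger_metric e) D _ frame
    (fun a b => berger_connection e p a b) p lcD vector_field_frame pS).
  - by move=> *; exact: berger_metricB.
  - by move=> *; exact: berger_metricC.
  - move=> a b; have [[_ ->] _] := is_derive_linear p (frame a p) (linear_frame b).
    have [[_ ->] _] := is_derive_linear p (frame b p) (linear_frame a).
    case: a => -[|[|[|//]]] ?; case: b => -[|[|[|//]]] ?;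
    rewrite /berger_connection combB /frame /=; apply: row4P;
    by rewrite !mxE /=; ring.
  - move=> a b c; rewrite derive_berger_frame ?frame_tangent //.
    rewrite !frame_comb !berger_comb //.
    case: a => -[|[|[|//]]] ?; case: b => -[|[|[|//]]] ?;
    case: c => -[|[|[|//]]] ?; rewrite /=; ring.
move: uniq; rewrite (frame_decomp pS Dt); move: (dot _ _) (dot _ _) (dot _ _).
move=> c b a uniq; rewrite /berger_connection.
have h k : berger_metric e p (comb p (a - (christoffel e i j).1.1)
    (b - (christoffel e i j).1.2) (c - (christoffel e i j).2)) (frame k p) = 0.
  by rewrite -combB berger_metricB uniq subrr.
have e20 : e ^+ 2 != 0 by rewrite expf_neq0 // gt_eqF.
congr comb; apply/eqP; rewrite -subr_eq0.
- have := h 0; rewrite frame_comb berger_comb //= !mulr0 !addr0 mulr1.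
  by move=> /eqP; rewrite mulf_eq0 (negPf e20).
- have := h 1; rewrite frame_comb berger_comb //= !mulr0 !addr0 mulr1 add0r.
  by move=> ->.
- have := h 2; rewrite frame_comb berger_comb //= !mulr0 !add0r mulr1.
  by move=> ->.
Qed.

(** The squared Sasaki norm of a vector tangent to TS^3, for a base velocity
    with frame coordinates [m], a fibre point with coordinates [n] and a rate of
    change [d] of these; the arguments of the last three squares are the frame
    coordinates of the covariant derivative. *)
Definition berger_sasaki_form (e m1 m2 m3 n1 n2 n3 d1 d2 d3 : R) : R :=
  e ^+ 2 * m1 ^+ 2 + m2 ^+ 2 + m3 ^+ 2 +
  (e ^+ 2 * (d1 + m3 * n2 - m2 * n3) ^+ 2 +
   (d2 + (2 - e ^+ 2) * m1 * n3 - e ^+ 2 * m3 * n1) ^+ 2 +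
   (d3 - (2 - e ^+ 2) * m1 * n2 + e ^+ 2 * m2 * n1) ^+ 2).

Definition berger_sasaki_sqnorm (e : R) (x y : 'rV[R]_4 * 'rV[R]_4) : R :=
  berger_sasaki_form e
    (dot y.1 (hopf_field x.1)) (dot y.1 (jfield x.1)) (dot y.1 (kfield x.1))
    (dot x.2 (hopf_field x.1)) (dot x.2 (jfield x.1)) (dot x.2 (kfield x.1))
    (dot y.2 (hopf_field x.1) + dot x.2 (hopf_field y.1))
    (dot y.2 (jfield x.1) + dot x.2 (jfield y.1))
    (dot y.2 (kfield x.1) + dot x.2 (kfield y.1)).

Lemma tangent_bundle_S3P (x : 'rV[R]_4 * 'rV[R]_4) :
  tangent_bundle S3 x <-> dot x.1 x.1 = 1 /\ dot x.1 x.2 = 0.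
Proof.
split=> [[pS /(tangent_sphereP _ ltr01 pS) h]|[pp h]].
  by rewrite (dot_S3 pS).
have pS : S3 x.1 by rewrite /S3 /sphere /= expr1n.
by split=> //; apply/(tangent_sphereP _ ltr01).
Qed.

(** Only linearity in the direction is at hand for tangent vectors, whence the
    nested form of the combination in the proof. *)
Lemma affine_connection_comb D (p : 'rV[R]_4) a b c (Y : 'rV[R]_4 -> 'rV[R]_4) :
  affine_connection S3 D -> S3 p -> vector_field S3 Y ->
  D p (comb p a b c) Y = a *: D p (hopf_field p) Y + b *: D p (jfield p) Y +
    c *: D p (kfield p) Y.
Proof.
move=> aD pS vY.
have tanP u : dot p u = 0 -> tangent S3 p u by move/(tangent_sphereP _ ltr01 pS).
have t a' b' c' : tangent S3 p (comb p a' b' c').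
  by apply: tanP; exact: comb_tangent.
have [ti tj tk] : [/\ tangent S3 p (hopf_field p), tangent S3 p (jfield p) &
    tangent S3 p (kfield p)].
  by split; apply: tanP; rewrite dot4E !mxE /=; ring.
have D0 : D p 0 Y = 0.
  have t0 : tangent S3 p 0 by apply: tanP; rewrite dot0r.
  have := ac_linear_dir aD 1 pS t0 t0 vY; rewrite scaler0 addr0 scale1r.
  by move=> /eqP; rewrite -[X in X == _]addr0 (inj_eq (addrI _)) eq_sym => /eqP.
have -> : comb p a b c = a *: hopf_field p + (b *: jfield p + (c *: kfield p + 0)).
  by rewrite addr0 addrA.
have tc : tangent S3 p (c *: kfield p + 0).
  by have := t 0 0 c; rewrite /comb !scale0r !add0r addr0.
have tb : tangent S3 p (b *: jfield p + (c *: kfield p + 0)).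
  by have := t 0 b c; rewrite /comb scale0r add0r addr0.
rewrite (ac_linear_dir aD _ pS ti tb vY) (ac_linear_dir aD _ pS tj tc vY).
rewrite (ac_linear_dir aD _ pS tk _ vY) ?D0 ?addr0 ?addrA //.
by apply: tanP; rewrite dot0r.
Qed.

(** A field along a curve is a combination of the frame fields with coefficients
    its products with them, which exhibits its covariant derivative. *)
Lemma berger_sasakiE e gS (gamma : R -> 'rV[R]_4 * 'rV[R]_4) t : 0 < e ->
  sasaki_metric S3 (berger_metric e) gS -> C1_curve gamma ->
  (\forall s \near t, tangent_bundle S3 (gamma s)) ->
  gS (gamma t) (derive1 gamma t) (derive1 gamma t) =
  berger_sasaki_sqnorm e (gamma t) (derive1 gamma t).
Proof.
move=> e0 [_ [D lcD hgS]] hg gT.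
have hg' := (C1_curveP gamma).1 hg.
pose p := fst \o gamma; pose v := snd \o gamma.
pose p' := fst \o derive1 gamma; pose v' := snd \o derive1 gamma.
have hp : C1d p p' by exact: C1d_fst.
have hv : C1d v v' by exact: C1d_snd.
have hX j : C1d (fun s => frame j (p s)) (fun s => frame j (p' s)).
  exact: C1d_linear (linear_frame j) hp.
pose a j s := dot (v s) (frame j (p s)).
pose a' j s := dot (v' s) (frame j (p s)) + dot (v s) (frame j (p' s)).
have ha j : C1d (a j) (a' j) by exact: C1d_dot.
have [pS pv] : S3 (p t) /\ dot (p t) (v t) = 0.
  have /tangent_bundle_S3P[h1 h2] := nbhs_singleton gT.
  by split=> //; rewrite /S3 /sphere /= expr1n.
have pp' : dot (p t) (p' t) = 0.
  have : \forall s \near t, dot (p s) (p s) = 1.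
    by apply: filterS gT => s /tangent_bundle_S3P[].
  move/(C1d_near_cst (C1d_dot hp hp)); rewrite dotC -mulr2n => /eqP.
  by rewrite mulrn_eq0 /= => /eqP.
pose m1 := dot (p' t) (hopf_field (p t)).
pose m2 := dot (p' t) (jfield (p t)).
pose m3 := dot (p' t) (kfield (p t)).
have p'E : p' t = comb (p t) m1 m2 m3 by exact: frame_decomp.
pose w := \sum_j (derive1 (a j) t *: frame j (p t) +
  a j t *: D (p t) (p' t) (frame j)).
have wcov : covariant_derivative S3 D p v t w.
  exists 3, a, frame; split.
  - by move=> j; exact: (@ex_derive _ _ _ _ _ _ _ ((ha j).1 t)).
  - exact: vector_field_frame.
  - apply: filterS gT => s /tangent_bundle_S3P[h1 h2].
    have sS : S3 (p s) by rewrite /S3 /sphere /= expr1n.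
    by rewrite sum3E /a /frame /=; exact: frame_decomp.
  - by rewrite (C1dE hp).
have := hgS gamma t w hg gT wcov; rewrite (C1dE hp) -/p => ->.
have wE : w = comb (p t)
  (a' 0 t + m3 * a 1 t - m2 * a 2 t)
  (a' 1 t + (2 - e ^+ 2) * m1 * a 2 t - e ^+ 2 * m3 * a 0 t)
  (a' 2 t - (2 - e ^+ 2) * m1 * a 1 t + e ^+ 2 * m2 * a 0 t).
  have DE (j : 'I_3) : D (p t) (p' t) (frame j) =
      m1 *: berger_connection e (p t) 0 j + m2 *: berger_connection e (p t) 1 j +
      m3 *: berger_connection e (p t) 2 j.
    rewrite p'E (affine_connection_comb _ _ _ (lc_connection lcD) pS
      (vector_field_frame j)).
    have L i := @berger_levi_civita e D (p t) i j e0 pS lcD.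
    by congr (_ *: _ + _ *: _ + _ *: _); [exact: (L 0)|exact: (L 1)|exact: (L 2)].
  rewrite /w sum3E !DE !(C1dE (ha _)) !frame_comb.
  rewrite /berger_connection /christoffel /= !(combZ, combD).
  by congr comb; ring.
by rewrite wE p'E !berger_comb.
Qed.

End SasakiBerger.

(** * The Sasaki metric of the round sphere *)

Section SasakiRound.
Context {R : realType}.
Implicit Types q u v : 'rV[R]_3.

Lemma row3P u v : u 0 0 = v 0 0 -> u 0 1 = v 0 1 -> u 0 2 = v 0 2 -> u = v.
Proof.
move=> h0 h1 h2; apply/rowP => -[[|[|[|//]]] i].
- by rewrite (_ : Ordinal i = 0) //; exact: val_inj.
- by rewrite (_ : Ordinal i = 1) //; exact: val_inj.
- by rewrite (_ : Ordinal i = 2) //; exact: val_inj.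
Qed.

(** The cross product of the [i]-th basis vector with [q]: these fields are
    tangent to S^2 and span its tangent planes, while no tangent frame exists. *)
Definition rotation (i : 'I_3) q : 'rV[R]_3 :=
  \row_k nth 0 (nth [::] [:: [:: 0; - q 0 2; q 0 1]; [:: q 0 2; 0; - q 0 0];
    [:: - q 0 1; q 0 0; 0]] i) k.

Lemma linear_rotation i : linear (rotation i).
Proof.
by move=> a u v; case: i => -[|[|[|//]]] i; apply: row3P; rewrite !mxE /=; ring.
Qed.

Lemma rotation_tangent i q : dot q (rotation i q) = 0.
Proof. by case: i => -[|[|[|//]]] i; rewrite dot3E !mxE /=; ring. Qed.

Lemma half_gt0 : 0 < 2^-1 :> R.
Proof. by rewrite invr_gt0. Qed.

Lemma dot_S2 q : S2 q <-> dot q q = 4^-1.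
Proof.
by rewrite /S2 /sphere /= (_ : 4^-1 = 2^-1 ^+ 2 :> R) //; field.
Qed.

Lemma tangent_S2P q u : S2 q -> tangent S2 q u <-> dot q u = 0.
Proof. by move=> qS; exact: tangent_sphereP half_gt0 qS. Qed.

Lemma vector_field_rotation i : vector_field S2 (rotation i).
Proof.
split; first by apply: smooth_linear; exact: linear_rotation.
by move=> q qS; apply/(tangent_S2P _ qS); exact: rotation_tangent.
Qed.

Lemma tangent_bundle_S2P (x : 'rV[R]_3 * 'rV[R]_3) :
  tangent_bundle S2 x <-> dot x.1 x.1 = 4^-1 /\ dot x.1 x.2 = 0.
Proof.
split=> [[qS /(tangent_S2P _ qS) h]|[/dot_S2 qS h]].
  by split=> //; apply/dot_S2.
by split=> //; apply/(tangent_S2P _ qS).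
Qed.

Lemma rotation_decomp q u : S2 q ->
  u = 4 *: (dot q u *: q + \sum_i dot u (rotation i q) *: rotation i q).
Proof.
move=> /dot_S2 qS; transitivity ((4 * dot q q) *: u).
  by rewrite qS mulfV // scale1r.
by rewrite sum3E; apply: row3P; rewrite !(dot3E, mxE) /=; ring.
Qed.

(** On TS^2 the covariant derivative is the tangential part of the derivative. *)
Definition round_sasaki_sqnorm (x y : 'rV[R]_3 * 'rV[R]_3) : R :=
  dot y.1 y.1 + (dot y.2 y.2 - 4 * dot y.2 x.1 ^+ 2).

Lemma affine_connection_sum D q (a : 'I_3 -> R) (X : 'I_3 -> 'rV[R]_3) Y :
  affine_connection S2 D -> S2 q -> vector_field S2 Y ->
  (forall i, dot q (X i) = 0) ->
  D q (\sum_i a i *: X i) Y = \sum_i a i *: D q (X i) Y.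
Proof.
move=> aD qS vY hX.
have tanP u : dot q u = 0 -> tangent S2 q u by move/(tangent_S2P _ qS).
have D0 : D q 0 Y = 0.
  have t0 : tangent S2 q 0 by apply: tanP; rewrite dot0r.
  have := ac_linear_dir aD 1 qS t0 t0 vY; rewrite scaler0 addr0 scale1r.
  by move=> /eqP; rewrite -[X in X == _]addr0 (inj_eq (addrI _)) eq_sym => /eqP.
have lin b u v : dot q u = 0 -> dot q v = 0 ->
    D q (b *: u + v) Y = b *: D q u Y + D q v Y.
  by move=> /tanP hu /tanP hv; exact: (ac_linear_dir aD b qS hu hv vY).
rewrite !sum3E -!addrA -[a 2 *: X 2]addr0 !lin ?D0 ?addr0 ?dot0r //.
all: by rewrite ?(dotE, hX, mulr0, addr0).
Qed.

Lemma derive_dot_linear n (f h : 'rV[R]_n -> 'rV[R]_n) (p u : 'rV[R]_n) :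
  linear f -> linear h ->
  'D_u (fun y => dot (f y) (h y) : R^o) p = dot (f u) (h p) + dot (f p) (h u).
Proof.
move=> fL hL.
have df i : is_derive p u (fun y => f y 0 i : R) (f u 0 i).
  by have [/is_derive_row d _] := is_derive_linear p u fL; exact: d.
have dh i : is_derive p u (fun y => h y 0 i : R) (h u 0 i).
  by have [/is_derive_row d _] := is_derive_linear p u hL; exact: d.
have := is_derive_sum (fun i => is_deriveM (df i) (dh i)).
rewrite (_ : \sum_i _ = (fun y => dot (f y) (h y))); last first.
  by apply/funext => y; rewrite fct_sumE.
move=> [_ ->]; rewrite /dot -big_split /=.
by apply: eq_bigr => i _; rewrite /GRing.scale/=; ring.
Qed.

(** The flat derivative of R^3 meets the metric and torsion conditions without
    being tangent; hence only its tangential part is the connection. *)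
Lemma round_levi_civita D q (i j k : 'I_3) : S2 q ->
  levi_civita S2 (@euclidean_metric R 3) D ->
  dot (D q (rotation i q) (rotation j)) (rotation k q) =
  dot (rotation j (rotation i q)) (rotation k q).
Proof.
move=> qS lcD.
apply: (@levi_civita_unique _ _ S2 (@euclidean_metric R 3) D _ rotation
    (fun i j => rotation j (rotation i q)) q lcD vector_field_rotation qS).
- by move=> u v w; rewrite /euclidean_metric !dotE.
- by move=> u v; exact: dotC.
- move=> a b; have [[_ ->] _] := is_derive_linear q (rotation a q) (linear_rotation b).
  by have [[_ ->] _] := is_derive_linear q (rotation b q) (linear_rotation a).
- move=> a b c; rewrite /euclidean_metric derive_dot_linear //.
  all: exact: linear_rotation.
Qed.

(** The covariant derivative and the derivative of w have the same products with
    the rotation fields, so that they differ by a normal vector. *)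
Lemma round_sasakiE hS (gamma : R -> 'rV[R]_3 * 'rV[R]_3) t :
  sasaki_metric S2 (@euclidean_metric R 3) hS -> C1_curve gamma ->
  (\forall s \near t, tangent_bundle S2 (gamma s)) ->
  hS (gamma t) (derive1 gamma t) (derive1 gamma t) =
  round_sasaki_sqnorm (gamma t) (derive1 gamma t).
Proof.
move=> [_ [D lcD hgS]] hg gT.
have hg' := (C1_curveP gamma).1 hg.
pose x := fst \o gamma; pose w := snd \o gamma.
pose x' := fst \o derive1 gamma; pose w' := snd \o derive1 gamma.
have hx : C1d x x' by exact: C1d_fst.
have hw : C1d w w' by exact: C1d_snd.
have hX j : C1d (fun s => rotation j (x s)) (fun s => rotation j (x' s)).
  exact: C1d_linear (linear_rotation j) hx.
pose a j s := 4 * dot (w s) (rotation j (x s)).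
have ha j : C1d (a j) (fun s => 0 * dot (w s) (rotation j (x s)) +
    4 * (dot (w' s) (rotation j (x s)) + dot (w s) (rotation j (x' s)))).
  exact: C1dM (C1d_cst (4 : R)) (C1d_dot hw (hX j)).
have [xx xw] : dot (x t) (x t) = 4^-1 /\ dot (x t) (w t) = 0.
  by have /tangent_bundle_S2P := nbhs_singleton gT.
have xS : S2 (x t) by apply/dot_S2.
have xx' : dot (x t) (x' t) = 0.
  have : \forall s \near t, dot (x s) (x s) = 4^-1.
    by apply: filterS gT => s /tangent_bundle_S2P[].
  move/(C1d_near_cst (C1d_dot hx hx)); rewrite dotC -mulr2n => /eqP.
  by rewrite mulrn_eq0 /= => /eqP.
have wE : \forall s \near t, w s = \sum_j a j s *: rotation j (x s).
  apply: filterS gT => s /tangent_bundle_S2P[/dot_S2 h1 h2].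
  rewrite {1}(rotation_decomp (w s) h1) h2 scale0r add0r scaler_sumr.
  by apply: eq_bigr => j _; rewrite scalerA.
have w'E := C1d_near_eq hw (C1d_sum (fun j => C1dZ (ha j) (hX j))) wE.
pose z := \sum_j (derive1 (a j) t *: rotation j (x t) +
  a j t *: D (x t) (x' t) (rotation j)).
have zcov : covariant_derivative S2 D x w t z.
  exists 3, a, rotation; split; [|exact: vector_field_rotation|exact: wE|].
  - by move=> j; exact: (@ex_derive _ _ _ _ _ _ _ ((ha j).1 t)).
  - by rewrite (C1dE hx).
have := hgS gamma t z hg gT zcov; rewrite (C1dE hx) -/x => ->.
have x'E : x' t = \sum_i (4 * dot (x' t) (rotation i (x t))) *: rotation i (x t).
  rewrite {1}(rotation_decomp (x' t) xS) xx' scale0r add0r scaler_sumr.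
  by apply: eq_bigr => j _; rewrite scalerA.
have DE j k : dot (D (x t) (x' t) (rotation j)) (rotation k (x t)) =
    dot (rotation j (x' t)) (rotation k (x t)).
  rewrite {2}x'E {1}x'E.
  rewrite (affine_connection_sum _ (lc_connection lcD) xS (vector_field_rotation j))
    => [|i]; last exact: rotation_tangent.
  move: (fun i => 4 * dot (x' t) (rotation i (x t))) => b.
  have [N rN] := linear_mulmx (linear_rotation j).
  by rewrite !sum3E [rotation j (_ + _)]rN !mulmxDl -!scalemxAl -!rN !dotE
    !round_levi_civita.
have zt : dot (x t) z = 0.
  have Dt j : dot (x t) (D (x t) (x' t) (rotation j)) = 0.
    apply/(tangent_S2P _ xS)/(ac_tangent (lc_connection lcD)) => //.
      exact/(tangent_S2P _ xS).
    exact: vector_field_rotation.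
  by rewrite /z sum3E !dotE !rotation_tangent !Dt !(mulr0, addr0).
have zw k : dot (z - w' t) (rotation k (x t)) = 0.
  rewrite w'E /z !sum3E !dotE !DE !(C1dE (ha _)); ring.
have zE : z = w' t - (4 * dot (x t) (w' t)) *: x t.
  have := rotation_decomp (z - w' t) xS.
  rewrite sum3E !zw !dotE zt !scale0r !addr0 sub0r scalerA mulrN scaleNr => <-.
  by rewrite addrC subrK.
rewrite /euclidean_metric /round_sasaki_sqnorm -/(x' t); congr (_ + _).
rewrite zE -/(w' t) -/(x t) !dotE xx (dotC (w' t)).
by field.
Qed.

End SasakiRound.

(** * The collapsing map *)

Section CollapseMap.
Context {R : realType}.
Local Notation V4 := 'rV[R]_4.
Local Notation V3 := 'rV[R]_3.
Implicit Types (p u v w : V4).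

Lemma linear_dhopf p : linear (dhopf p).
Proof. by move=> a u v; apply: row3P; rewrite !mxE /=; ring. Qed.

Lemma dhopfC p u : dhopf p u = dhopf u p.
Proof. by apply: row3P; rewrite !mxE /=; ring. Qed.

Lemma dhopf_field p : dhopf p (hopf_field p) = 0.
Proof. by apply: row3P; rewrite !mxE /=; ring. Qed.

Lemma linear_dhopfl u : linear (fun p => dhopf p u).
Proof. by move=> a p p'; rewrite !(dhopfC _ u) linear_dhopf. Qed.

Lemma dhopf_self p : dhopf p p = 2 *: hopf p.
Proof. by apply: row3P; rewrite !mxE /=; field. Qed.

Lemma C1d_hopf (c c' : R -> V4) : C1d c c' ->
  C1d (fun t => hopf (c t)) (fun t => dhopf (c t) (c' t)).
Proof.
move=> hc; have := C1dZ (C1d_cst (2^-1 : R))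
  (C1d_bilinear linear_dhopf linear_dhopfl hc hc).
rewrite (_ : (fun t => _ *: dhopf (c t) (c t)) = fun t => hopf (c t)); last first.
  apply/funext => t.
  by rewrite dhopf_self scalerA mulVf ?scale1r // pnatr_eq0.
rewrite (_ : (fun t => 0 *: _ + _) = fun t => dhopf (c t) (c' t)) //.
apply/funext => t; rewrite scale0r add0r (dhopfC (c' t)) scalerDr -scalerDl.
by rewrite [_ + _](_ : _ = 1) ?scale1r //; field.
Qed.

Lemma frameZ i a p : frame i (a *: p) = a *: frame i p.
Proof.
by have [M fM] := linear_mulmx (@linear_frame R i); rewrite !fM scalemxAl.
Qed.

Lemma hopf_fieldZ a p : hopf_field (a *: p) = a *: hopf_field p.
Proof. exact: (frameZ 0). Qed.

Lemma jfieldZ a p : jfield (a *: p) = a *: jfield p.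
Proof. exact: (frameZ 1). Qed.

Lemma kfieldZ a p : kfield (a *: p) = a *: kfield p.
Proof. exact: (frameZ 2). Qed.

Lemma C1d_frame i (c c' : R -> V4) : C1d c c' ->
  C1d (fun t => frame i (c t)) (fun t => frame i (c' t)).
Proof. exact: C1d_linear (linear_frame i). Qed.

Definition berger_speed (e : R) (x y : V4 * V4) : R :=
  Num.sqrt (berger_sasaki_sqnorm e x y).

Definition limit_sqnorm (x y : R^o * (V3 * V3)) : R :=
  y.1 ^+ 2 + round_sasaki_sqnorm x.2 y.2.

Definition limit_speed (x y : R^o * (V3 * V3)) : R := Num.sqrt (limit_sqnorm x y).

Definition limit_space : set (R^o * (V3 * V3))%type := setT `*` tangent_bundle S2.

Lemma continuous_compose (T U W : topologicalType) (f : T -> U) (g : U -> W) :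
  continuous f -> continuous g -> continuous (g \o f).
Proof.
by move=> hf hg t; apply: (@continuous_comp _ _ _ f g t (hf t)); exact: hg.
Qed.

Lemma continuous_add (f g : R -> R) : continuous f -> continuous g ->
  continuous (fun t => f t + g t).
Proof. by move=> hf hg t; apply: cvgD; [exact: hf|exact: hg]. Qed.

Lemma continuous_opp (f : R -> R) : continuous f -> continuous (fun t => - f t).
Proof. by move=> hf t; apply: cvgN; exact: hf. Qed.

Lemma continuous_mul (f g : R -> R) : continuous f -> continuous g ->
  continuous (fun t => f t * g t).
Proof. by move=> hf hg t; apply: cvgM; [exact: hf|exact: hg]. Qed.

Lemma continuous_sqr (f : R -> R) : continuous f ->
  continuous (fun t => f t ^+ 2).
Proof. exact: (fun hf => continuous_mul hf hf). Qed.

Lemma continuous_berger_form e (m1 m2 m3 n1 n2 n3 d1 d2 d3 : R -> R) :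
  continuous m1 -> continuous m2 -> continuous m3 ->
  continuous n1 -> continuous n2 -> continuous n3 ->
  continuous d1 -> continuous d2 -> continuous d3 ->
  continuous (fun t => berger_sasaki_form e (m1 t) (m2 t) (m3 t) (n1 t) (n2 t)
    (n3 t) (d1 t) (d2 t) (d3 t)).
Proof.
move=> *; rewrite /berger_sasaki_form.
have K (k : R) : continuous (fun _ : R => k) by exact: cst_continuous.
by repeat first [assumption | simple apply K | simple apply continuous_sqr |
  simple apply continuous_mul | simple apply continuous_opp |
  simple apply continuous_add].
Qed.

Lemma berger_speedE e gS : 0 < e -> sasaki_metric S3 (berger_metric e) gS ->
  speed_of (tangent_bundle S3) gS (berger_speed e).
Proof.
move=> e0 hgS; split.
- move=> x k u; rewrite /berger_speed -sqrtr_sqr -sqrtrM ?sqr_ge0 //; congr Num.sqrt.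
  rewrite /berger_sasaki_sqnorm /= hopf_fieldZ jfieldZ kfieldZ.
  by rewrite !dotE /berger_sasaki_form; ring.
- by move=> x u; exact: sqrtr_ge0.
- move=> c u cc cu.
  have c1 : continuous (fst \o c) by apply: continuous_compose => // x; exact: cvg_fst.
  have c2 : continuous (snd \o c) by apply: continuous_compose => // x; exact: cvg_snd.
  have u1 : continuous (fst \o u) by apply: continuous_compose => // x; exact: cvg_fst.
  have u2 : continuous (snd \o u) by apply: continuous_compose => // x; exact: cvg_snd.
  have fr (i : 'I_3) (b : R -> V4) :
      continuous b -> continuous (fun t => frame i (b t)).
    by move=> hb; apply: continuous_compose (hb) _; exact: linear_cont (linear_frame i).
  have d (b b' : R -> V4) (i : 'I_3) : continuous b -> continuous b' ->
      continuous (fun t => dot (b t) (frame i (b' t))).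
    by move=> hb hb'; apply: continuous_dot => //; exact: fr.
  have s0 := d _ _ 0 u1 c1; have s1 := d _ _ 1 u1 c1; have s2 := d _ _ 2 u1 c1.
  have n0 := d _ _ 0 c2 c1; have n1 := d _ _ 1 c2 c1; have n2 := d _ _ 2 c2 c1.
  have v0 := d _ _ 0 u2 c1; have v1 := d _ _ 1 u2 c1; have v2 := d _ _ 2 u2 c1.
  have w0 := d _ _ 0 c2 u1; have w1 := d _ _ 1 c2 u1; have w2 := d _ _ 2 c2 u1.
  rewrite /frame /= in s0 s1 s2 n0 n1 n2 v0 v1 v2 w0 w1 w2.
  apply: continuous_compose; last exact: sqrt_continuous.
  by apply: continuous_berger_form => //; exact: continuous_add.
- by move=> c t hc cM; rewrite (berger_sasakiE e0 hgS hc cM).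
Qed.

Lemma limit_speedE hS : sasaki_metric S2 (@euclidean_metric R 3) hS ->
  speed_of limit_space (prod_metric (@line_metric R) hS) limit_speed.
Proof.
move=> hhS; split.
- move=> x k u; rewrite /limit_speed -sqrtr_sqr -sqrtrM ?sqr_ge0 //; congr Num.sqrt.
  by rewrite /limit_sqnorm /round_sasaki_sqnorm /= !dotE /GRing.scale/=; ring.
- by move=> x u; exact: sqrtr_ge0.
- move=> c u cc cu.
  have c2 : continuous (snd \o c) by apply: continuous_compose => // x; exact: cvg_snd.
  have u2 : continuous (snd \o u) by apply: continuous_compose => // x; exact: cvg_snd.
  have c21 : continuous (fst \o (snd \o c)).
    by apply: continuous_compose => // x; exact: cvg_fst.
  have u1 : continuous (fst \o u) by apply: continuous_compose => // x; exact: cvg_fst.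
  have u21 : continuous (fst \o (snd \o u)).
    by apply: continuous_compose => // x; exact: cvg_fst.
  have u22 : continuous (snd \o (snd \o u)).
    by apply: continuous_compose => // x; exact: cvg_snd.
  have s1 := continuous_dot u21 u21; have s2 := continuous_dot u22 u22.
  have s3 := continuous_dot u22 c21.
  rewrite /= in s1 s2 s3.
  apply: continuous_compose; last exact: sqrt_continuous.
  apply: continuous_add; first exact: continuous_sqr.
  apply: continuous_add => //; apply: continuous_add => //.
  apply: continuous_opp; apply: continuous_mul; first exact: cst_continuous.
  exact: continuous_sqr.
- move=> c t hc cM; rewrite /limit_speed; congr Num.sqrt.
  have hc' := (C1_curveP c).1 hc.
  have h2 := C1d_snd hc'.
  rewrite /prod_metric /limit_sqnorm /line_metric -expr2; congr (_ + _).
  have -> : (derive1 c t).2 = derive1 (snd \o c) t by rewrite (C1dE h2).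
  apply: (round_sasakiE hhS); first exact: C1d_curve h2.
  by apply: filterS cM => s [].
Qed.

(** The map TS^3 -> R x TS^2: a vector is split into its coordinate along the
    unit vertical field and the projection of its horizontal part. *)
Definition collapse (e : R) (x : V4 * V4) : R^o * (V3 * V3) :=
  (e * dot x.2 (hopf_field x.1), (hopf x.1, dhopf x.1 x.2)).

Definition dcollapse (e : R) (x y : V4 * V4) : R^o * (V3 * V3) :=
  (e * (dot y.2 (hopf_field x.1) + dot x.2 (hopf_field y.1)),
   (dhopf x.1 y.1, dhopf y.1 x.2 + dhopf x.1 y.2)).

Lemma C1d_collapse e (c c' : R -> V4 * V4) : C1d c c' ->
  C1d (collapse e \o c) (fun t => dcollapse e (c t) (c' t)).
Proof.
move=> hc; have hp := C1d_fst hc; have hv := C1d_snd hc.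
apply: C1d_pair; last apply: C1d_pair.
- have := C1dM (C1d_cst e) (C1d_dot hv (C1d_frame 0 hp)).
  rewrite (_ : (fun t => 0 * _ + _) = fun t => e * (dot (c' t).2
    (hopf_field (c t).1) + dot (c t).2 (hopf_field (c' t).1))) //.
  by apply/funext => t; rewrite mul0r add0r.
- exact: C1d_hopf.
- exact: (C1d_bilinear linear_dhopf linear_dhopfl hp hv).
Qed.

(** The product of hopf p and dhopf p v is half of |p|^2 <p, v>. *)
Lemma collapse_limit_space e x : tangent_bundle S3 x -> limit_space (collapse e x).
Proof.
move=> /tangent_bundle_S3P[pp pv]; split=> //; apply/tangent_bundle_S2P; split.
  by apply/dot_S2/hopf_S2; rewrite /S3 /sphere /= expr1n.
transitivity (2^-1 * (dot x.1 x.1 * dot x.1 x.2)); last by rewrite pv !mulr0.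
by rewrite !(dot3E, dot4E, mxE) /=; field.
Qed.

Lemma arc_collapse e c :
  arc_in (tangent_bundle S3) c -> arc_in limit_space (collapse e \o c).
Proof.
move=> [/C1_curveP hc cM]; split; first exact: C1d_curve (C1d_collapse e hc).
by move=> t /cM; exact: collapse_limit_space.
Qed.

End CollapseMap.

(** * Comparison of speeds *)

Section SpeedComparison.
Context {R : realType}.
Local Notation V4 := 'rV[R]_4.
Local Notation V3 := 'rV[R]_3.
Implicit Types (p u v w : V4).

(** The squared speed of the image curve, in frame coordinates upstairs. *)
Definition limit_form (e m1 m2 m3 n1 n2 n3 d1 d2 d3 : R) : R :=
  m2 ^+ 2 + m3 ^+ 2 + ((e * d1) ^+ 2 +
  ((d2 + 2 * m1 * n3) ^+ 2 + (d3 - 2 * m1 * n2) ^+ 2)).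

Lemma sqr_perturb (e X Y : R) : 0 <= e ->
  (X + e * Y) ^+ 2 <= (1 + e) * X ^+ 2 + (e + e ^+ 2) * Y ^+ 2.
Proof.
move=> e0; rewrite -subr_ge0.
rewrite [leRHS](_ : _ = e * (X - Y) ^+ 2); last by ring.
by rewrite mulr_ge0 // sqr_ge0.
Qed.

(** The factor by which [collapse e] distorts speeds, at vectors of squared norm
    at most r. *)
Definition distortion (e r : R) : R := 1 + e + 2 * (e + e ^+ 2) * r.

Lemma sqr_sum_le (x y z w : R) :
  (x * y + z * w) ^+ 2 <= (x ^+ 2 + z ^+ 2) * (y ^+ 2 + w ^+ 2).
Proof.
rewrite -subr_ge0 [leRHS](_ : _ = (x * w - z * y) ^+ 2); last by ring.
exact: sqr_ge0.
Qed.

Lemma sqr_add_le (x y : R) : (x + y) ^+ 2 <= 2 * (x ^+ 2 + y ^+ 2).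
Proof.
rewrite -subr_ge0 [leRHS](_ : _ = (x - y) ^+ 2); last by ring.
exact: sqr_ge0.
Qed.

(** Both forms are a common term plus three squares, and corresponding roots
    differ by e times a quantity bounded by the velocity of the base point times
    the norm of the vector. *)
Lemma form_compare e m1 m2 m3 n1 n2 n3 d1 d2 d3 r : 0 < e ->
  (e * n1) ^+ 2 + n2 ^+ 2 + n3 ^+ 2 <= r ->
  berger_sasaki_form e m1 m2 m3 n1 n2 n3 d1 d2 d3 <=
    distortion e r * (limit_form e m1 m2 m3 n1 n2 n3 d1 d2 d3 + (e * m1) ^+ 2) /\
  limit_form e m1 m2 m3 n1 n2 n3 d1 d2 d3 + (e * m1) ^+ 2 <=
    distortion e r * berger_sasaki_form e m1 m2 m3 n1 n2 n3 d1 d2 d3.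
Proof.
move=> e0 hr.
pose s := e * m1; pose a := e * n1.
pose X1 := e * d1; pose X2 := d2 + 2 * m1 * n3; pose X3 := d3 - 2 * m1 * n2.
pose Y1 := m3 * n2 - m2 * n3; pose Y2 := - (s * n3 + m3 * a).
pose Y3 := s * n2 + m2 * a.
pose k := m2 ^+ 2 + m3 ^+ 2 + s ^+ 2.
have k0 : 0 <= k by rewrite !addr_ge0 // sqr_ge0.
have Yle : Y1 ^+ 2 + Y2 ^+ 2 + Y3 ^+ 2 <= 2 * k * r.
  apply: (@le_trans _ _ (2 * k * (a ^+ 2 + n2 ^+ 2 + n3 ^+ 2))); last first.
    by rewrite ler_wpM2l // mulr_ge0.
  have h1 : Y1 ^+ 2 <= (m3 ^+ 2 + m2 ^+ 2) * (n2 ^+ 2 + n3 ^+ 2).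
    have := sqr_sum_le m3 n2 m2 (- n3).
    by rewrite sqrrN mulrN.
  have h2 := sqr_add_le (s * n3) (m3 * a).
  have h3 := sqr_add_le (s * n2) (m2 * a).
  have h4 : 0 <= (m3 ^+ 2 + m2 ^+ 2) * (n2 ^+ 2 + n3 ^+ 2).
    by rewrite mulr_ge0 // addr_ge0 // sqr_ge0.
  have h5 : 0 <= s ^+ 2 * a ^+ 2 by rewrite mulr_ge0 // sqr_ge0.
  rewrite /Y2 sqrrN /Y3; apply: le_trans (lerD (lerD h1 h2) h3) _.
  rewrite -subr_ge0 [leRHS](_ : _ = (m3 ^+ 2 + m2 ^+ 2) * (n2 ^+ 2 + n3 ^+ 2) +
    2 * (s ^+ 2 * a ^+ 2)); last by rewrite /k; ring.
  by rewrite addr_ge0 // mulr_ge0.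
have bE : berger_sasaki_form e m1 m2 m3 n1 n2 n3 d1 d2 d3 =
    k + ((X1 + e * Y1) ^+ 2 + (X2 + e * Y2) ^+ 2 + (X3 + e * Y3) ^+ 2).
  by rewrite /berger_sasaki_form /k /X1 /X2 /X3 /Y1 /Y2 /Y3 /s /a; ring.
have lE : limit_form e m1 m2 m3 n1 n2 n3 d1 d2 d3 + (e * m1) ^+ 2 =
    k + (X1 ^+ 2 + X2 ^+ 2 + X3 ^+ 2).
  by rewrite /limit_form /k /X1 /X2 /X3 /s; ring.
have e2 : 0 <= e + e ^+ 2 by rewrite addr_ge0 ?sqr_ge0 // ltW.
have main Z1 Z2 Z3 W1 W2 W3 :
    W1 ^+ 2 + W2 ^+ 2 + W3 ^+ 2 <= 2 * k * r ->
    k + ((Z1 + e * W1) ^+ 2 + (Z2 + e * W2) ^+ 2 + (Z3 + e * W3) ^+ 2) <=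
    distortion e r * (k + (Z1 ^+ 2 + Z2 ^+ 2 + Z3 ^+ 2)).
  move=> hW; have r0 : 0 <= r.
    by apply: le_trans hr; rewrite !addr_ge0 // sqr_ge0.
  pose Z := Z1 ^+ 2 + Z2 ^+ 2 + Z3 ^+ 2.
  have Z0 : 0 <= Z by rewrite !addr_ge0 // sqr_ge0.
  have h1 := sqr_perturb Z1 W1 (ltW e0); have h2 := sqr_perturb Z2 W2 (ltW e0).
  have h3 := sqr_perturb Z3 W3 (ltW e0).
  have h4 := ler_wpM2l e2 hW.
  have h5 : 0 <= e * k by rewrite mulr_ge0 // ltW.
  have h6 : 0 <= (e + e ^+ 2) * r * Z by rewrite !mulr_ge0.
  rewrite -/Z /distortion.
  have -> : (1 + e + 2 * (e + e ^+ 2) * r) * (k + Z) =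
    k + e * k + (1 + e) * Z + (e + e ^+ 2) * (2 * k * r) +
    2 * ((e + e ^+ 2) * r * Z) by ring.
  rewrite /Z in h6 *; lra.
split; first by rewrite bE lE; exact: main.
rewrite bE lE.
have := main (X1 + e * Y1) (X2 + e * Y2) (X3 + e * Y3) (- Y1) (- Y2) (- Y3).
rewrite !sqrrN !mulrN !addrK; apply.
by move: Yle; rewrite /Y2 sqrrN.
Qed.

(** The component of v' along p is not free: it is fixed by <p, v> = 0. *)
Lemma tangent_TS3_coords p v p' v' : dot p p = 1 -> dot p v = 0 ->
  dot p p' = 0 -> dot p' v + dot p v' = 0 ->
  exists m1 m2 m3 n1 n2 n3 k1 k2 k3, [/\ p' = comb p m1 m2 m3,
    v = comb p n1 n2 n3 &
    v' = comb p k1 k2 k3 - (m1 * n1 + m2 * n2 + m3 * n3) *: p].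
Proof.
move=> pp pv pp' pv'.
have pS : S3 p by rewrite /S3 /sphere /= expr1n.
have hp' := frame_decomp pS pp'; have hv := frame_decomp pS pv.
have h : dot p (v' + dot p' v *: p) = 0.
  by rewrite !dotE pp mulr1 addrC.
have hv' := frame_decomp pS h.
exists (dot p' (hopf_field p)), (dot p' (jfield p)), (dot p' (kfield p)),
  (dot v (hopf_field p)), (dot v (jfield p)), (dot v (kfield p)).
do 3 eexists; split=> //; rewrite -(dot_comb _ _ _ _ _ _ pS) -hp' -hv.
by apply/eqP; rewrite eq_sym subr_eq eq_sym; apply/eqP; exact: hv'.
Qed.

(** The images of the horizontal frame and twice the point hopf p form an
    orthonormal basis of R^3, in which the derivatives of image curves are
    expanded. *)
Lemma hopf_basis p : dot p p = 1 -> [/\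
  [/\ dot (dhopf p (jfield p)) (dhopf p (jfield p)) = 1,
  dot (dhopf p (kfield p)) (dhopf p (kfield p)) = 1 &
  dot (hopf p) (hopf p) = 4^-1],
  dot (dhopf p (jfield p)) (dhopf p (kfield p)) = 0,
  dot (dhopf p (jfield p)) (hopf p) = 0 &
  dot (dhopf p (kfield p)) (hopf p) = 0].
Proof.
move=> pp; split; [split|..].
- transitivity (dot p p ^+ 2); last by rewrite pp expr1n.
  by rewrite !(dot3E, dot4E, mxE) /=; field.
- transitivity (dot p p ^+ 2); last by rewrite pp expr1n.
  by rewrite !(dot3E, dot4E, mxE) /=; field.
- transitivity (dot p p ^+ 2 / 4); last by rewrite pp expr1n div1r.
  by rewrite !(dot3E, dot4E, mxE) /=; field.
all: by rewrite !(dot3E, mxE) /=; field.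
Qed.

Lemma dhopf_comb p b k1 k2 k3 : dhopf p (comb p k1 k2 k3 + b *: p) =
  k2 *: dhopf p (jfield p) + k3 *: dhopf p (kfield p) + (2 * b) *: hopf p.
Proof. by apply: row3P; rewrite !mxE /=; field. Qed.

(** The terms in [hopf p] are normal to the sphere and drop out of covariant
    derivatives. *)
Lemma dhopf_comb2 p m1 m2 m3 n1 n2 n3 :
  dhopf (comb p m1 m2 m3) (comb p n1 n2 n3) =
  (m1 * n3 + m3 * n1) *: dhopf p (jfield p) -
  (m1 * n2 + m2 * n1) *: dhopf p (kfield p) +
  (2 * (m1 * n1 - m2 * n2 - m3 * n3)) *: hopf p.
Proof. by apply: row3P; rewrite !mxE /=; field. Qed.

Lemma dot_comb_frame p b k1 k2 k3 : dot p p = 1 -> [/\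
  dot (comb p k1 k2 k3 + b *: p) (hopf_field p) = k1,
  dot (comb p k1 k2 k3 + b *: p) (jfield p) = k2 &
  dot (comb p k1 k2 k3 + b *: p) (kfield p) = k3].
Proof.
move=> pp; split; rewrite -[RHS]mulr1 -pp;
by rewrite !(dot4E, mxE) /=; ring.
Qed.

Lemma dot_comb_comb_frame p n1 n2 n3 m1 m2 m3 : dot p p = 1 -> [/\
  dot (comb p n1 n2 n3) (hopf_field (comb p m1 m2 m3)) = m2 * n3 - m3 * n2,
  dot (comb p n1 n2 n3) (jfield (comb p m1 m2 m3)) = m3 * n1 - m1 * n3 &
  dot (comb p n1 n2 n3) (kfield (comb p m1 m2 m3)) = m1 * n2 - m2 * n1].
Proof.
move=> pp; have pS : S3 p by rewrite /S3 /sphere /= expr1n.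
have h a b c k : dot (comb p n1 n2 n3) (comb p a b c + k *: p) =
    n1 * a + n2 * b + n3 * c.
  by rewrite dotDr dotZr dot_comb // (dotC _ p) comb_tangent mulr0 addr0.
split.
- have -> : hopf_field (comb p m1 m2 m3) = comb p 0 (- m3) m2 + (- m1) *: p.
    by apply: row4P; rewrite !mxE /=; ring.
  by rewrite h; ring.
- have -> : jfield (comb p m1 m2 m3) = comb p m3 0 (- m1) + (- m2) *: p.
    by apply: row4P; rewrite !mxE /=; ring.
  by rewrite h; ring.
- have -> : kfield (comb p m1 m2 m3) = comb p (- m2) m1 0 + (- m3) *: p.
    by apply: row4P; rewrite !mxE /=; ring.
  by rewrite h; ring.
Qed.

(** In the basis of [hopf_basis] the tangential components of the derivative of
    the image vector are d2 + 2 m1 n3 and d3 - 2 m1 n2: the horizontal frame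
    turns at rate 2 m1 relative to basic fields. *)
Lemma collapse_sqnorm e (x y : V4 * V4) : tangent_bundle S3 x ->
  dot x.1 y.1 = 0 -> dot y.1 x.2 + dot x.1 y.2 = 0 ->
  limit_sqnorm (collapse e x) (dcollapse e x y) = limit_form e
    (dot y.1 (hopf_field x.1)) (dot y.1 (jfield x.1)) (dot y.1 (kfield x.1))
    (dot x.2 (hopf_field x.1)) (dot x.2 (jfield x.1)) (dot x.2 (kfield x.1))
    (dot y.2 (hopf_field x.1) + dot x.2 (hopf_field y.1))
    (dot y.2 (jfield x.1) + dot x.2 (jfield y.1))
    (dot y.2 (kfield x.1) + dot x.2 (kfield y.1)).
Proof.
case: x => p v; case: y => p' v' /tangent_bundle_S3P[/= pp pv] pp' pv'.
have [m1 [m2 [m3 [n1 [n2 [n3 [k1 [k2 [k3 [-> -> ->]]]]]]]]]] :=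
  tangent_TS3_coords pp pv pp' pv'.
set b := - (m1 * n1 + m2 * n2 + m3 * n3); rewrite -scaleNr -/b.
have noP a1 a2 a3 : comb p a1 a2 a3 = comb p a1 a2 a3 + 0 *: p.
  by rewrite scale0r addr0.
rewrite /limit_sqnorm /round_sasaki_sqnorm /collapse /dcollapse /= dhopf_comb2.
have -> : dhopf p (comb p m1 m2 m3) =
    m2 *: dhopf p (jfield p) + m3 *: dhopf p (kfield p).
  by rewrite noP dhopf_comb mulr0 scale0r addr0.
rewrite dhopf_comb.
have [-> -> ->] := dot_comb_frame b k1 k2 k3 pp.
have [-> -> ->] := dot_comb_comb_frame n1 n2 n3 m1 m2 m3 pp.
have := dot_comb_frame 0 m1 m2 m3 pp; rewrite -noP => -[-> -> ->].
have := dot_comb_frame 0 n1 n2 n3 pp; rewrite -noP => -[-> -> ->].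
have [[h1 h2 h3] h4 h5 h6] := hopf_basis pp.
move: (dhopf p (jfield p)) (dhopf p (kfield p)) (hopf p) h1 h2 h3 h4 h5 h6.
move=> F2 F3 x h1 h2 h3 h4 h5 h6.
rewrite !dotE (dotC F3 F2) (dotC x F2) (dotC x F3) h1 h2 h3 h4 h5 h6.
by rewrite /limit_form; field.
Qed.

End SpeedComparison.

(** * A Lipschitz function controlling the size of vectors *)

Section Height.
Context {R : realType}.
Local Notation V4 := 'rV[R]_4.
Local Notation V3 := 'rV[R]_3.
Implicit Types (p u v w : V4).

(** [sqrt (1 + |v|^2)], which unlike the norm is differentiable at zero vectors. *)
Definition height (y : R^o * (V3 * V3)) : R :=
  Num.sqrt (1 + (y.1 ^+ 2 + dot y.2.2 y.2.2)).

Definition berger_vec_sqnorm (e : R) (x : V4 * V4) : R :=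
  (e * dot x.2 (hopf_field x.1)) ^+ 2 + dot x.2 (jfield x.1) ^+ 2 +
  dot x.2 (kfield x.1) ^+ 2.

Definition berger_height (e : R) (x : V4 * V4) : R :=
  Num.sqrt (1 + berger_vec_sqnorm e x).

Lemma berger_vec_sqnorm_ge0 e x : 0 <= berger_vec_sqnorm e x.
Proof. by rewrite /berger_vec_sqnorm !addr_ge0 // sqr_ge0. Qed.

Lemma berger_heightE e x : tangent_bundle S3 x ->
  berger_height e x = height (collapse e x).
Proof.
move=> /tangent_bundle_S3P[pp pv]; congr (Num.sqrt (1 + _)).
have pS : S3 x.1 by rewrite /S3 /sphere /= expr1n.
rewrite /berger_vec_sqnorm /collapse /= -addrA; congr (_ + _).
have [[h1 h2 h3] h4 h5 h6] := hopf_basis pp.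
rewrite [in RHS](frame_decomp pS pv).
have := dhopf_comb x.1 0 (dot x.2 (hopf_field x.1)) (dot x.2 (jfield x.1))
  (dot x.2 (kfield x.1)); rewrite mulr0 !scale0r !addr0 => ->.
rewrite !dotE (dotC (dhopf _ (kfield _)) (dhopf _ (jfield _))) h1 h2 h4; ring.
Qed.

Lemma mulrr_ge0 (z : R) : 0 <= z * z.
Proof. by rewrite -expr2 sqr_ge0. Qed.

Lemma le_sqr (z w : R) : 0 <= w -> z ^+ 2 <= w ^+ 2 -> z <= w.
Proof.
move=> w0 zw; have [z0|/ltW z0] := leP 0 z; last exact: le_trans w0.
by rewrite -(@ler_pXn2r _ 2) // nnegrE.
Qed.

(** For f = sqrt (1 + r) the derivative is (r' / 2) / f, and r <= f^2. *)
Lemma lipschitz_sqrt (V : normedModType R) (M : set V) (Q : V -> V -> R)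
    (f : V -> R) :
  (forall c, arc_in M c -> exists r r' : R -> R,
    [/\ C1d r r', forall t, 0 <= r t, forall t, f (c t) = Num.sqrt (1 + r t) &
     forall t, 0 < t < 1 -> 0 <= Q (c t) (derive1 c t) /\
       (r' t / 2) ^+ 2 <= r t * Q (c t) (derive1 c t)]) ->
  one_lipschitz M (fun x y => Num.sqrt (Q x y)) f.
Proof.
move=> h c cM; have [r [r' [hr r0 fr rQ]]] := h c cM.
exists (fun t => (2 * Num.sqrt (1 + r t))^-1 * r' t) => t t01.
have r1 s : 0 < 1 + r s by rewrite (lt_le_trans ltr01) // lerDl.
split.
  have -> : f \o c = Num.sqrt \o (fun t => 1 + r t) by apply/funext => s /=.
  apply: is_derive1_comp; first exact: is_derive1_sqrt.
  by have [h1 _] := C1dD (C1d_cst (1 : R)) hr; have := h1 t; rewrite add0r.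
move=> t01'; have [Q0 hQ] := rQ t t01'.
have s0 : 0 < Num.sqrt (1 + r t) by rewrite sqrtr_gt0.
have -> : (2 * Num.sqrt (1 + r t))^-1 * r' t = r' t / 2 / Num.sqrt (1 + r t).
  by field; rewrite gt_eqF.
rewrite ler_pdivrMr // [leRHS]mulrC -sqrtrM; last exact: ltW.
apply: le_sqr; first exact: sqrtr_ge0.
rewrite sqr_sqrtr; last by rewrite mulr_ge0 // ltW.
by apply: (le_trans hQ); rewrite ler_wpM2r // lerDr.
Qed.

Lemma arc_in_near (V : normedModType R) (M : set V) c (t : R) :
  arc_in M c -> 0 < t < 1 -> \forall s \near t, M (c s).
Proof. by move=> [_ cM] t01; exact: near_in_itv01. Qed.

(** Derivatives of |p|^2 = 1 and <p, v> = 0. *)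
Lemma TS3_curve (c c' : R -> V4 * V4) (t : R) : C1d c c' ->
  (\forall s \near t, tangent_bundle S3 (c s)) ->
  dot (c t).1 (c' t).1 = 0 /\ dot (c' t).1 (c t).2 + dot (c t).1 (c' t).2 = 0.
Proof.
move=> hc cM; have hp := C1d_fst hc; have hv := C1d_snd hc; split.
  have : \forall s \near t, dot (c s).1 (c s).1 = 1.
    by apply: filterS cM => s /tangent_bundle_S3P[].
  move/(C1d_near_cst (C1d_dot hp hp)) => /=; rewrite dotC -mulr2n => /eqP.
  by rewrite mulrn_eq0 /= => /eqP.
have : \forall s \near t, dot (c s).1 (c s).2 = 0.
  by apply: filterS cM => s /tangent_bundle_S3P[].
exact: C1d_near_cst (C1d_dot hp hv).
Qed.

Lemma sqr_sum3_le (x1 x2 x3 y1 y2 y3 : R) :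
  (x1 * y1 + x2 * y2 + x3 * y3) ^+ 2 <=
  (x1 ^+ 2 + x2 ^+ 2 + x3 ^+ 2) * (y1 ^+ 2 + y2 ^+ 2 + y3 ^+ 2).
Proof.
rewrite -subr_ge0 [leRHS](_ : _ = (x1 * y2 - x2 * y1) ^+ 2 +
  (x1 * y3 - x3 * y1) ^+ 2 + (x2 * y3 - x3 * y2) ^+ 2); last by ring.
by rewrite !addr_ge0 // sqr_ge0.
Qed.

(** The connection is metric: half the derivative of |v|^2 is the product of v
    with its covariant derivative, to which Cauchy-Schwarz applies. *)
Lemma berger_height_lipschitz e : 0 < e ->
  one_lipschitz (tangent_bundle S3) (berger_speed e) (berger_height e).
Proof.
move=> e0; apply: lipschitz_sqrt => c cM.
have hc := (C1_curveP c).1 cM.1; have hp := C1d_fst hc; have hv := C1d_snd hc.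
have n1 := C1dM (C1d_cst e) (C1d_dot hv (C1d_frame 0 hp)).
have n2 := C1d_dot hv (C1d_frame 1 hp); have n3 := C1d_dot hv (C1d_frame 2 hp).
have hr := C1dD (C1dD (C1dM n1 n1) (C1dM n2 n2)) (C1dM n3 n3).
eexists; eexists; split; first exact: hr.
- by move=> t; rewrite !addr_ge0 // mulrr_ge0.
- by [].
move=> t t01; split.
  rewrite /berger_sasaki_sqnorm /berger_sasaki_form.
  by rewrite !addr_ge0 ?sqr_ge0 // mulr_ge0 ?addr_ge0 ?sqr_ge0.
rewrite /frame /= /berger_sasaki_sqnorm /berger_sasaki_form.
set m1 := dot (derive1 c t).1 (hopf_field (c t).1).
set m2 := dot (derive1 c t).1 (jfield (c t).1).
set m3 := dot (derive1 c t).1 (kfield (c t).1).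
set a1 := dot (c t).2 (hopf_field (c t).1).
set a2 := dot (c t).2 (jfield (c t).1).
set a3 := dot (c t).2 (kfield (c t).1).
set d1 := _ + dot (c t).2 (hopf_field (derive1 c t).1).
set d2 := _ + dot (c t).2 (jfield (derive1 c t).1).
set d3 := _ + dot (c t).2 (kfield (derive1 c t).1).
have := sqr_sum3_le (e * a1) a2 a3 (e * (d1 + m3 * a2 - m2 * a3))
  (d2 + (2 - e ^+ 2) * m1 * a3 - e ^+ 2 * m3 * a1)
  (d3 - (2 - e ^+ 2) * m1 * a2 + e ^+ 2 * m2 * a1).
set r := _ + _ + a3 ^+ 2; set q := _ + _ + _ ^+ 2 => h.
have r0 : 0 <= r by rewrite !addr_ge0 // sqr_ge0.
have k0 : 0 <= r * (e ^+ 2 * m1 ^+ 2 + m2 ^+ 2 + m3 ^+ 2).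
  by rewrite mulr_ge0 // !addr_ge0 ?sqr_ge0 // mulr_ge0 ?sqr_ge0.
rewrite [in leRHS]mulrDr.
have -> : r * (e ^+ 2 * (d1 + m3 * a2 - m2 * a3) ^+ 2 +
   (d2 + (2 - e ^+ 2) * m1 * a3 - e ^+ 2 * m3 * a1) ^+ 2 +
   (d3 - (2 - e ^+ 2) * m1 * a2 + e ^+ 2 * m2 * a1) ^+ 2) = r * q.
  by rewrite /q; ring.
apply: le_trans (_ : r * q <= _); last by rewrite lerDr.
apply: le_trans h; rewrite le_eqVlt; apply/orP; left; apply/eqP; congr (_ ^+ 2).
by field.
Qed.

Lemma limit_curve (c c' : R -> R^o * (V3 * V3)) (t : R) : C1d c c' ->
  (\forall s \near t, limit_space (c s)) ->
  [/\ dot (c t).2.1 (c t).2.1 = 4^-1, dot (c t).2.1 (c t).2.2 = 0,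
   dot (c t).2.1 (c' t).2.1 = 0 &
   dot (c' t).2.1 (c t).2.2 + dot (c t).2.1 (c' t).2.2 = 0].
Proof.
move=> hc cM; have hy := C1d_snd hc; have hx := C1d_fst hy.
have hw := C1d_snd hy.
have [_ /tangent_bundle_S2P[xx xw]] := nbhs_singleton cM.
split=> //.
  have : \forall s \near t, dot (c s).2.1 (c s).2.1 = 4^-1.
    by apply: filterS cM => s [_ /tangent_bundle_S2P[]].
  move/(C1d_near_cst (C1d_dot hx hx)) => /=; rewrite dotC -mulr2n => /eqP.
  by rewrite mulrn_eq0 /= => /eqP.
have : \forall s \near t, dot (c s).2.1 (c s).2.2 = 0.
  by apply: filterS cM => s [_ /tangent_bundle_S2P[]].
exact: C1d_near_cst (C1d_dot hx hw).
Qed.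

Lemma round_sasaki_sqnormE (x y : V3 * V3) : dot x.1 x.1 = 4^-1 ->
  let z := y.2 - (4 * dot y.2 x.1) *: x.1 in
  round_sasaki_sqnorm x y = dot y.1 y.1 + dot z z.
Proof.
move=> xx z; rewrite /round_sasaki_sqnorm; congr (_ + _).
by rewrite /z !dotE xx (dotC x.1); field.
Qed.

Lemma sqr_dot_le n (a b : R) (u v : 'rV[R]_n) :
  (a * b + dot u v) ^+ 2 <= (a ^+ 2 + dot u u) * (b ^+ 2 + dot v v).
Proof.
have hu := dot_ge0 u; have hv := dot_ge0 v; have huv := dot_cauchy u v.
have : 2 * (a * b * dot u v) <= a ^+ 2 * dot v v + b ^+ 2 * dot u u.
  apply: le_sqr; first by rewrite addr_ge0 // mulr_ge0 // sqr_ge0.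
  apply: (@le_trans _ _ (4 * (a ^+ 2 * b ^+ 2) * (dot u u * dot v v))).
    rewrite [leLHS](_ : _ = 4 * (a ^+ 2 * b ^+ 2) * dot u v ^+ 2); last by ring.
    by rewrite ler_wpM2l // mulr_ge0 // mulr_ge0 // sqr_ge0.
  rewrite -subr_ge0 [leRHS](_ : _ = (a ^+ 2 * dot v v - b ^+ 2 * dot u u) ^+ 2).
    exact: sqr_ge0.
  by ring.
rewrite -subr_ge0 => h.
rewrite -subr_ge0 [leRHS](_ : _ = (a ^+ 2 * dot v v + b ^+ 2 * dot u u -
  2 * (a * b * dot u v)) + (dot u u * dot v v - dot u v ^+ 2)); last by ring.
by rewrite addr_ge0 // subr_ge0.
Qed.

Lemma height_lipschitz : one_lipschitz limit_space (@limit_speed R) height.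
Proof.
apply: lipschitz_sqrt => c cM.
have hc := (C1_curveP c).1 cM.1; have ha := C1d_fst hc; have hy := C1d_snd hc.
have hw := C1d_snd hy.
have hr := C1dD (C1dM ha ha) (C1d_dot hw hw).
eexists; eexists; split; first exact: hr.
- by move=> t; rewrite addr_ge0 ?dot_ge0 // mulrr_ge0.
- by [].
move=> t t01; have [xx xw _ _] := limit_curve hc (arc_in_near cM t01).
rewrite /limit_sqnorm round_sasaki_sqnormE //=.
set z := _ - _; split; first by rewrite !addr_ge0 ?sqr_ge0 ?dot_ge0.
have := sqr_dot_le (c t).1 (derive1 c t).1 (c t).2.2 z.
have -> : dot (c t).2.2 z = dot (c t).2.2 (derive1 c t).2.2.
  by rewrite /z !dotE (dotC (c t).2.2 (c t).2.1) xw mulr0 subr0.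
set b := dot (derive1 c t).2.1 _; set k := (_ + dot z z).
move=> h; rewrite [(_ / 2)](_ : _ = (c t).1 * (derive1 c t).1 +
    dot (c t).2.2 (derive1 c t).2.2); last first.
  by rewrite (dotC (derive1 c t).2.2); field.
apply: le_trans h _; rewrite ler_wpM2l //.
  by rewrite addr_ge0 ?dot_ge0 // sqr_ge0.
by rewrite /k addrA lerD2r lerDl dot_ge0.
Qed.

End Height.

(** * Lifting curves through sections of the Hopf fibration *)

Section Lifting.
Context {R : realType}.
Local Notation V4 := 'rV[R]_4.
Local Notation V3 := 'rV[R]_3.
Implicit Types (p u v w : V4).

(** The function t^2 / (t^2 + (1 - t)^2).  Composing with it turns a curve that is
    controlled on an interval only into one that is controlled at all times, as
    C^1 curves on the whole line must be produced. *)
Lemma smooth_step_exists : exists s s' : R -> R, [/\ C1d s s', s 0 = 0, s 1 = 1,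
  forall t, 0 <= s t <= 1 & forall t, 0 <= t <= 1 -> 0 <= s' t].
Proof.
have ht := @C1d_id R; have h2 := C1dM ht ht.
have h1 := C1dB (C1d_cst (1 : R)) ht; have h3 := C1dM h1 h1.
have hD := C1dD h2 h3.
have D0 (t : R) : 0 < t * t + (1 - t) * (1 - t).
  have := mulrr_ge0 (t - 2^-1) => h.
  rewrite (_ : _ + _ = 2 * ((t - 2^-1) * (t - 2^-1)) + 2^-1); last by field.
  by apply: ltr_wpDl; [exact: mulr_ge0|rewrite invr_gt0].
have hs := C1dM h2 (C1dV hD (fun t => lt0r_neq0 (D0 t))).
eexists; eexists; split; first exact: hs.
- by rewrite /= !mul0r.
- by rewrite /= subrr !mul1r mul0r addr0 invr1.
- move=> t /=; rewrite divr_ge0 ?mulrr_ge0 ?(ltW (D0 t)) //=.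
  by rewrite ler_pdivrMr ?D0 // mul1r lerDl mulrr_ge0.
- move=> t /andP[t0 t1] /=.
  have Dt := D0 t; have Dt0 := lt0r_neq0 Dt.
  rewrite [leRHS](_ : _ = 2 * t * (1 - t) / (t * t + (1 - t) * (1 - t)) ^+ 2).
    by rewrite divr_ge0 ?sqr_ge0 // mulr_ge0 ?mulr_ge0 // subr_ge0.
  by field.
Qed.

(** The transpose of [dhopf p]; for |p| = 1 and W tangent to S^2 at hopf p it is
    the horizontal lift of W. *)
Definition hopf_lift p (W : V3) : V4 :=
  \row_k [:: W 0 0 * p 0 2 - W 0 1 * p 0 3 + W 0 2 * p 0 0;
             W 0 0 * p 0 3 + W 0 1 * p 0 2 + W 0 2 * p 0 1;
             W 0 0 * p 0 0 + W 0 1 * p 0 1 - W 0 2 * p 0 2;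
             W 0 0 * p 0 1 - W 0 1 * p 0 0 - W 0 2 * p 0 3]`_k.

Lemma linear_hopf_lift p : linear (hopf_lift p).
Proof. by move=> a u v; apply: row4P; rewrite !mxE /=; ring. Qed.

Lemma linear_hopf_liftl W : linear (hopf_lift^~ W).
Proof. by move=> a u v; apply: row4P; rewrite !mxE /=; ring. Qed.

Lemma dhopf_hopf_lift p W : dhopf p (hopf_lift p W) = dot p p *: W.
Proof. by apply: row3P; rewrite !(dot4E, mxE) /=; ring. Qed.

Lemma dot_hopf_lift_field p W : dot (hopf_lift p W) (hopf_field p) = 0.
Proof. by rewrite !(dot4E, mxE) /=; ring. Qed.

Lemma dot_hopf_lift p W : dot p (hopf_lift p W) = 2 * dot W (hopf p).
Proof. by rewrite !(dot3E, dot4E, mxE) /=; field. Qed.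

Lemma hopf_lift_norm p W : dot (hopf_lift p W) (hopf_lift p W) = dot p p * dot W W.
Proof. by rewrite !(dot3E, dot4E, mxE) /=; ring. Qed.

Lemma hopf_lift_hopf p : hopf_lift p (hopf p) = (dot p p / 2) *: p.
Proof. by apply: row4P; rewrite !(dot4E, mxE) /=; field. Qed.

Lemma hopf_hopf_lift p W :
  hopf (hopf_lift p W) = (2 * dot W (hopf p)) *: W - dot W W *: hopf p.
Proof. by apply: row3P; rewrite !(dot3E, mxE) /=; field. Qed.

Lemma hopfZ a p : hopf (a *: p) = a ^+ 2 *: hopf p.
Proof. by apply: row3P; rewrite !mxE /=; field. Qed.

(** The projection of [p0] to the complex line over a point [x] of S^2;
    normalized, it is a section of the Hopf fibration away from the antipode of
    [hopf p0]. *)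
Definition line_proj p0 (x : V3) : V4 := 2^-1 *: p0 + hopf_lift p0 x.

Lemma line_proj_base p0 : dot p0 p0 = 1 -> line_proj p0 (hopf p0) = p0.
Proof.
move=> pp; rewrite /line_proj hopf_lift_hopf pp div1r -scalerDl.
by rewrite [_ + _](_ : _ = 1) ?scale1r //; field.
Qed.

Lemma line_proj_norm p0 x : dot p0 p0 = 1 -> dot x x = 4^-1 ->
  dot (line_proj p0 x) (line_proj p0 x) = 2^-1 + 2 * dot x (hopf p0).
Proof.
move=> pp xx; rewrite /line_proj !dotE hopf_lift_norm (dotC (hopf_lift p0 x) p0).
by rewrite dot_hopf_lift pp xx; field.
Qed.

Lemma hopfDZ a p u : hopf (a *: p + u) = a ^+ 2 *: hopf p + a *: dhopf p u + hopf u.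
Proof. by apply: row3P; rewrite !mxE /=; field. Qed.

Lemma hopf_line_proj p0 x : dot p0 p0 = 1 -> dot x x = 4^-1 ->
  hopf (line_proj p0 x) = (2^-1 + 2 * dot x (hopf p0)) *: x.
Proof.
move=> pp xx; rewrite /line_proj hopfDZ dhopf_hopf_lift hopf_hopf_lift pp xx scale1r.
move: (dot x (hopf p0)) (hopf p0) => d q0.
by apply: row3P; rewrite !mxE; field.
Qed.

(** The vertical component of the derivative of the section comes from its linear
    part alone, because horizontal lifts at p0 are orthogonal to i p0. *)
Lemma line_proj_vertical p0 (x x' : V3) : dot p0 p0 = 1 -> dot x x = 4^-1 ->
  dot (hopf_lift p0 x') (hopf_field (line_proj p0 x)) ^+ 2 <= dot x' x' / 4.
Proof.
move=> pp xx.
have -> : hopf_field (line_proj p0 x) =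
    2^-1 *: hopf_field p0 + hopf_field (hopf_lift p0 x).
  by apply: row4P; rewrite !mxE /=; ring.
rewrite dotDr dotZr dot_hopf_lift_field mulr0 add0r.
apply: le_trans (dot_cauchy _ _) _.
have -> : dot (hopf_field (hopf_lift p0 x)) (hopf_field (hopf_lift p0 x)) =
    dot (hopf_lift p0 x) (hopf_lift p0 x).
  by rewrite !dot4E !mxE /=; ring.
by rewrite !hopf_lift_norm pp xx !mul1r.
Qed.

(** Two vectors at p with the same image differ by a horizontal vector killed by
    the projection, which is isometric on horizontal vectors. *)
Lemma collapse_inj e p v v' : 0 < e -> tangent_bundle S3 (p, v) ->
  tangent_bundle S3 (p, v') -> collapse e (p, v) = collapse e (p, v') -> v = v'.
Proof.
move=> e0 /tangent_bundle_S3P[/= pp pv] /tangent_bundle_S3P[/= _ pv'].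
rewrite /collapse /= => -[].
move=> /(mulfI (lt0r_neq0 e0)) h1 h2; apply/eqP; rewrite -subr_eq0; apply/eqP.
have pS : S3 p by rewrite /S3 /sphere /= expr1n.
have hw : dot p (v - v') = 0 by rewrite !dotE pv pv' subrr.
have w1 : dot (v - v') (hopf_field p) = 0 by rewrite !dotE h1 subrr.
have [M dM] := linear_mulmx (linear_dhopf p).
have : dhopf p (v - v') = 0 by rewrite dM mulmxBl -!dM h2 subrr.
rewrite (frame_decomp pS hw) w1.
move: (dot _ (jfield p)) (dot _ (kfield p)) => b c.
have := dhopf_comb p 0 0 b c; rewrite mulr0 !scale0r !addr0 => -> h.
have [[j1 k1 _] jk _ _] := hopf_basis pp.
have b0 : b = 0.
  have := congr1 (dot (dhopf p (jfield p))) h.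
  by rewrite !dotE j1 jk mulr1 mulr0 addr0.
have c0 : c = 0.
  have := congr1 (dot (dhopf p (kfield p))) h.
  by rewrite !dotE k1 (dotC (dhopf p (kfield p))) jk mulr1 mulr0 add0r.
by rewrite b0 c0 /comb !scale0r !addr0.
Qed.

(** The normalized [line_proj] based at the starting point lifts the base curve;
    the hypothesis on products keeps the curve in the hemisphere around its
    starting point, away from the pole of this section. *)
Lemma lift_curve e (y y' : R -> R^o * (V3 * V3)) (A : V4 * V4) : 0 < e ->
  C1d y y' -> (forall t, limit_space (y t)) ->
  (forall t, 0 <= dot (y t).2.1 (y 0).2.1) ->
  tangent_bundle S3 A -> collapse e A = y 0 ->
  exists c c' : R -> V4 * V4, [/\ C1d c c', c 0 = A,
    forall t, tangent_bundle S3 (c t), forall t, collapse e (c t) = y t &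
    forall t, dot (c' t).1 (hopf_field (c t).1) ^+ 2 <=
      dot (y' t).2.1 (y' t).2.1].
Proof.
move=> e0 hy yM xx0 AM Ay.
have ha := C1d_fst hy; have hx := C1d_fst (C1d_snd hy).
have hw := C1d_snd (C1d_snd hy).
pose p0 := A.1; pose x t := (y t).2.1; pose w t := (y t).2.2.
have [pp pA] := (tangent_bundle_S3P A).1 AM.
have x0 : x 0 = hopf p0 by rewrite /x -Ay.
have xx t : dot (x t) (x t) = 4^-1.
  by have [_ /tangent_bundle_S2P[]] := yM t.
have xw t : dot (x t) (w t) = 0.
  by have [_ /tangent_bundle_S2P[]] := yM t.
pose P t := 2^-1 + 2 * dot (x t) (hopf p0).
have Phalf t : 2^-1 <= P t by rewrite /P lerDl mulr_ge0 // -x0 xx0.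
have P0 t : 0 < P t by apply: lt_le_trans (Phalf t); rewrite invr_gt0.
have hP := C1dD (C1d_cst (2^-1 : R)) (C1dM (C1d_cst (2 : R))
  (C1d_dot hx (C1d_cst (hopf p0)))).
have [r' hr] := C1d_rsqrt hP P0.
have hs := C1dD (C1d_cst (2^-1 *: p0)) (C1d_linear (linear_hopf_lift p0) hx).
have hp := C1dZ hr hs.
pose r t := (Num.sqrt (P t))^-1.
pose p t := r t *: line_proj p0 (x t).
have hp' := C1dZ (C1dM ha (C1d_cst e^-1)) (C1d_linear (linear_frame 0) hp).
have hv := C1dD hp' (C1d_bilinear linear_hopf_lift linear_hopf_liftl hp hw).
have hc := C1d_pair hp hv.
have r2 t : r t ^+ 2 = (P t)^-1.
  by rewrite /r exprVn sqr_sqrtr // ltW.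
have pp1 t : dot (p t) (p t) = 1.
  by rewrite /p dotZl dotZr line_proj_norm // mulrA -expr2 r2 mulVf // gt_eqF.
have hopfp t : hopf (p t) = x t.
  by rewrite /p hopfZ r2 hopf_line_proj // scalerA mulVf ?scale1r // gt_eqF.
pose v t := ((y t).1 / e) *: hopf_field (p t) + hopf_lift (p t) (w t).
have f1 t : dot (hopf_field (p t)) (hopf_field (p t)) = 1.
  by apply: hopf_field_unit; rewrite /S3 /sphere /= expr1n.
have cM t : tangent_bundle S3 (p t, v t).
  apply/tangent_bundle_S3P; split=> //=.
  by rewrite /v dotDr dotZr hopf_field_tangent mulr0 add0r dot_hopf_lift hopfp
    (dotC (w t)) xw mulr0.
have cy t : collapse e (p t, v t) = y t.
  rewrite /collapse /= hopfp; have [M dM] := linear_mulmx (linear_dhopf (p t)).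
  have -> : dhopf (p t) (v t) = w t.
    rewrite /v dM mulmxDl -scalemxAl -!dM dhopf_hopf_lift pp1 scale1r.
    by rewrite dhopf_field scaler0 add0r.
  rewrite /v dotDl dotZl f1 dot_hopf_lift_field mulr1 addr0 mulrCA mulfV ?gt_eqF //.
  by rewrite mulr1 /x /w; case: (y t) => ? [].
have p00 : p 0 = p0.
  have qq : dot (hopf p0) (hopf p0) = 4^-1.
    by apply/dot_S2/hopf_S2; rewrite /S3 /sphere /= expr1n.
  rewrite /p x0 line_proj_base // /r /P x0 qq (_ : _ + _ = 1); last by field.
  by rewrite sqrtr1 invr1 scale1r.
eexists; eexists; split; first exact: hc.
- have vA : v 0 = A.2.
    apply: (collapse_inj e0 (p := p0)).
    + by have := cM 0; rewrite p00.
    + by rewrite /p0 -surjective_pairing.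
    + by have := cy 0; rewrite p00 -Ay => ->; rewrite /p0 -surjective_pairing.
  transitivity (p 0, v 0); first by [].
  by rewrite p00 vA /p0 -surjective_pairing.
- exact: cM.
- exact: cy.
move=> t /=; rewrite -/(P t) -/(r t) -/(line_proj p0 (x t)) add0r.
have -> : hopf_field (p t) = r t *: hopf_field (line_proj p0 (x t)).
  exact: hopf_fieldZ.
rewrite dotZr dotDl !dotZl hopf_field_tangent mulr0 add0r mulrA -expr2 exprMn r2.
have h := line_proj_vertical (y' t).2.1 pp (xx t).
have P2 : (P t)^-1 ^+ 2 <= 4.
  rewrite (_ : 4 = 2 ^+ 2 :> R); last by ring.
  rewrite lerXn2r ?nnegrE ?invr_ge0 ?(ltW (P0 t)) //.
  by rewrite -[leRHS]invrK lef_pV2 ?posrE ?invr_gt0 ?P0.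
apply: (@le_trans _ _ (4 * (dot (y' t).2.1 (y' t).2.1 / 4))); last first.
  by rewrite mulrCA mulfV ?mulr1 // pnatr_eq0.
by apply: ler_pM => //; exact: sqr_ge0.
Qed.

End Lifting.

(** * Projecting and lifting paths *)

Section PathTransfer.
Context {R : realType}.
Local Notation V4 := 'rV[R]_4.
Local Notation V3 := 'rV[R]_3.
Variables (e : R) (gS : V4 * V4 -> V4 * V4 -> V4 * V4 -> R).
Variable hS : V3 * V3 -> V3 * V3 -> V3 * V3 -> R.
Hypothesis e0 : 0 < e.
Hypothesis gSP : sasaki_metric S3 (berger_metric e) gS.
Hypothesis hSP : sasaki_metric S2 (@euclidean_metric R 3) hS.
Local Notation up := (path_length (tangent_bundle S3) gS).
Local Notation down :=
  (path_length limit_space (prod_metric (@line_metric R) hS)).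
Let Fup := berger_speedE e0 gSP.
Let Fdown := limit_speedE hSP.

Lemma distortion_ge1 K : 1 <= distortion e (K ^+ 2).
Proof.
rewrite /distortion -addrA lerDl addr_ge0 ?(ltW e0) //.
by rewrite mulr_ge0 ?sqr_ge0 // mulr_ge0 // addr_ge0 ?sqr_ge0 // ltW.
Qed.

Lemma distortion_ge0 K : 0 <= distortion e (K ^+ 2).
Proof. exact: le_trans ler01 (distortion_ge1 K). Qed.

Lemma sqrt_le_scale (k A B : R) : 1 <= k -> 0 <= B -> A <= k * B ->
  Num.sqrt A <= k * Num.sqrt B.
Proof.
move=> k1 B0 AB; have k0 : 0 <= k by apply: le_trans k1.
apply: le_sqr; first by rewrite mulr_ge0 // sqrtr_ge0.
have [A0|A0] := leP 0 A; last first.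
  by rewrite ltr0_sqrtr // expr0n /= sqr_ge0.
rewrite sqr_sqrtr // exprMn sqr_sqrtr //; apply: le_trans AB _.
by rewrite ler_wpM2r // expr2 ler_peMl.
Qed.

Lemma berger_sasaki_sqnorm_ge0 (x y : V4 * V4) : 0 <= berger_sasaki_sqnorm e x y.
Proof.
rewrite /berger_sasaki_sqnorm /berger_sasaki_form.
by rewrite !addr_ge0 ?sqr_ge0 // mulr_ge0 ?addr_ge0 ?sqr_ge0.
Qed.

Lemma berger_height_le K (x : V4 * V4) : berger_height e x <= K ->
  berger_vec_sqnorm e x <= K ^+ 2.
Proof.
rewrite /berger_height => h.
have h1 : 0 <= 1 + berger_vec_sqnorm e x by rewrite addr_ge0 // berger_vec_sqnorm_ge0.
have K0 : 0 <= K by apply: le_trans h; exact: sqrtr_ge0.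
apply: (@le_trans _ _ (1 + berger_vec_sqnorm e x)); first by rewrite lerDr.
by rewrite -(sqr_sqrtr h1) lerXn2r ?nnegrE ?sqrtr_ge0.
Qed.

(** The vertical velocity of the base point only helps here. *)
Lemma collapse_path x y l K : up x y l -> berger_height e x + l <= K ->
  exists2 l', down (collapse e x) (collapse e y) l' &
    l' <= distortion e (K ^+ 2) * l.
Proof.
apply: (path_length_map Fup Fdown (berger_height_lipschitz e0)).
  exact: arc_collapse.
move=> c t cM t01 ft; have hc := (C1_curveP c).1 cM.1.
have cT := arc_in_near cM t01; have [pp' pv'] := TS3_curve hc cT.
rewrite (C1dE (C1d_collapse e hc)) /limit_speed /berger_speed.
apply: sqrt_le_scale; [exact: distortion_ge1|exact: berger_sasaki_sqnorm_ge0|].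
rewrite collapse_sqnorm //; last exact: nbhs_singleton cT.
have [_] := form_compare (dot (derive1 c t).1 (hopf_field (c t).1))
  (dot (derive1 c t).1 (jfield (c t).1)) (dot (derive1 c t).1 (kfield (c t).1))
  (dot (derive1 c t).2 (hopf_field (c t).1) + dot (c t).2 (hopf_field (derive1 c t).1))
  (dot (derive1 c t).2 (jfield (c t).1) + dot (c t).2 (jfield (derive1 c t).1))
  (dot (derive1 c t).2 (kfield (c t).1) + dot (c t).2 (kfield (derive1 c t).1))
  e0 (berger_height_le ft).
by move=> h; apply: le_trans _ h; rewrite lerDl sqr_ge0.
Qed.

(** The factor 1 + e^2 accounts for the vertical velocity of lifts. *)
Definition lift_distortion (K : R) : R := distortion e (K ^+ 2) * (1 + e ^+ 2).

Lemma lift_distortion_ge0 K : 0 <= lift_distortion K.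
Proof. by rewrite mulr_ge0 ?distortion_ge0 // addr_ge0 ?sqr_ge0. Qed.

Lemma lift_full_arc (y : R -> R^o * (V3 * V3)) l (A : V4 * V4) K :
  C1_curve y -> (forall t, limit_space (y t)) ->
  arclength_of (@limit_speed R) y l ->
  (forall t, 0 <= dot (y t).2.1 (y 0).2.1) ->
  (forall t, height (y t) <= K) ->
  tangent_bundle S3 A -> collapse e A = y 0 ->
  exists B l', [/\ tangent_bundle S3 B, collapse e B = y 1, up A B l' &
    l' <= lift_distortion K * (l 1 - l 0)].
Proof.
move=> hy yM hl yy yK AM Ay; have hy' := (C1_curveP y).1 hy.
have [c [c' [hc c0 cM cy cv]]] := lift_curve e0 hy' yM yy AM Ay.
have cA : arc_in (tangent_bundle S3) c by split=> //; exact: C1d_curve hc.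
have [m hm] := arclength_exists Fup cA.1.
exists (c 1), (m 1 - m 0); split=> //.
  by have := arc_path_length Fup cA hm; rewrite c0.
rewrite mulrBr; apply: (@increment_le _ m (fun t => lift_distortion K * l t)
  (fun t => berger_speed e (c t) (derive1 c t))
  (fun t => lift_distortion K * limit_speed (y t) (derive1 y t)) 0 1 ler01 hm).
  by move=> t /hl dl; exact: (@is_deriveZ _ _ _ l (lift_distortion K)).
move=> t t01; rewrite (C1dE hc).
have cT : \forall s \near t, tangent_bundle S3 (c s).
  by apply: (@nearW _ (nbhs t)) => s; exact: cM.
have [pp' pv'] := TS3_curve hc cT.
have ceq : collapse e \o c = y by apply/funext => s; exact: cy.
have y't : derive1 y t = dcollapse e (c t) (c' t).
  by rewrite -ceq (C1dE (C1d_collapse e hc)).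
have sq := collapse_sqnorm e (cM t) pp' pv'; rewrite cy -y't in sq.
have hK : berger_height e (c t) <= K by rewrite berger_heightE // cy.
have [h _] := form_compare (dot (c' t).1 (hopf_field (c t).1))
  (dot (c' t).1 (jfield (c t).1)) (dot (c' t).1 (kfield (c t).1))
  (dot (c' t).2 (hopf_field (c t).1) + dot (c t).2 (hopf_field (c' t).1))
  (dot (c' t).2 (jfield (c t).1) + dot (c t).2 (jfield (c' t).1))
  (dot (c' t).2 (kfield (c t).1) + dot (c t).2 (kfield (c' t).1))
  e0 (berger_height_le hK).
rewrite -sq in h.
have yT : \forall s \near t, limit_space (y s).
  by apply: (@nearW _ (nbhs t)) => s; exact: yM.
have [xx _ _ _] := limit_curve hy' yT.
have qE : limit_sqnorm (y t) (derive1 y t) =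
   dot (derive1 y t).2.1 (derive1 y t).2.1 + ((derive1 y t).1 ^+ 2 +
    dot ((derive1 y t).2.2 - (4 * dot (derive1 y t).2.2 (y t).2.1) *: (y t).2.1)
     ((derive1 y t).2.2 - (4 * dot (derive1 y t).2.2 (y t).2.1) *: (y t).2.1)).
  by rewrite /limit_sqnorm round_sasaki_sqnormE // addrCA.
have q1 : dot (derive1 y t).2.1 (derive1 y t).2.1 <= limit_sqnorm (y t) (derive1 y t).
  by rewrite qE lerDl addr_ge0 ?sqr_ge0 ?dot_ge0.
have q0 : 0 <= limit_sqnorm (y t) (derive1 y t).
  by apply: le_trans q1; exact: dot_ge0.
apply: sqrt_le_scale => //.
  rewrite /lift_distortion -[leLHS]mulr1 ler_pM ?distortion_ge1 //.
  by rewrite lerDl sqr_ge0.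
apply: (le_trans h); rewrite /lift_distortion -mulrA ler_wpM2l ?distortion_ge0 //.
rewrite mulrDl mul1r lerD2l exprMn ler_wpM2l ?sqr_ge0 //.
exact: le_trans (cv t) q1.
Qed.

(** The subarc is reparametrized so as to stay inside [a, b] at all times. *)
Lemma lift_subarc (y : R -> R^o * (V3 * V3)) l (A : V4 * V4) K a b :
  0 <= a -> a <= b -> b <= 1 ->
  arc_in limit_space y -> arclength_of (@limit_speed R) y l ->
  (forall t, a <= t <= b -> 0 <= dot (y t).2.1 (y a).2.1) ->
  (forall t, 0 <= t <= 1 -> height (y t) <= K) ->
  tangent_bundle S3 A -> collapse e A = y a ->
  exists B l', [/\ tangent_bundle S3 B, collapse e B = y b, up A B l' &
    l' <= lift_distortion K * (l b - l a)].
Proof.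
move=> a0 ab b1 yM hl yy yK AM Ay.
have [s [s' [hs s0 s1 s01 s'0]]] := @smooth_step_exists R.
pose tau t := a + (b - a) * s t.
have ht := C1dD (C1d_cst a) (C1dM (C1d_cst (b - a)) hs).
have ba0 : 0 <= b - a by rewrite subr_ge0.
have tab t : a <= tau t <= b.
  have /andP[h1 h2] := s01 t; rewrite /tau lerDl mulr_ge0 //=.
  by rewrite -lerBrDl ler_piMr.
have t01 t : 0 <= tau t <= 1.
  by have /andP[h1 h2] := tab t; rewrite (le_trans a0) ?(le_trans h2).
have tau0 : tau 0 = a by rewrite /tau s0 mulr0 addr0.
have tau1 : tau 1 = b by rewrite /tau s1 mulr1 addrC subrK.
have h1 : C1_curve (y \o tau).
  exact: C1d_curve (C1d_comp ((C1_curveP y).1 yM.1) ht).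
have h2 t : limit_space ((y \o tau) t) by apply: yM.2.
have h3 : arclength_of (@limit_speed R) (y \o tau) (fun t => 1 * l (tau t)).
  apply: (arclength_reparam Fdown yM.1 hl ht (fun t _ => t01 t)) => t tt.
  by rewrite mul1r add0r mul0r add0r ger0_norm // mulr_ge0 // s'0.
have h4 t : 0 <= dot ((y \o tau) t).2.1 ((y \o tau) 0).2.1.
  by rewrite /comp tau0; exact: yy.
have h5 t : height ((y \o tau) t) <= K by exact: yK.
have h6 : collapse e A = (y \o tau) 0 by rewrite /comp tau0.
have [B [l' [BM By pAB l'le]]] := lift_full_arc h1 h2 h3 h4 h5 AM h6.
rewrite tau0 tau1 !mul1r in l'le; rewrite /comp tau1 in By.
by exists B, l'.
Qed.

(** The product of x a and x t is 1/4 at t = a, and its derivative is bounded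
    below by -C, with C a bound for the velocity of the base curve. *)
Lemma arc_uniform_step (y : R -> R^o * (V3 * V3)) : arc_in limit_space y ->
  exists2 N : nat, (0 < N)%N & forall a b : R, 0 <= a -> a <= b -> b <= 1 ->
    b - a <= N%:R^-1 -> 0 <= dot (y b).2.1 (y a).2.1.
Proof.
move=> [hy yM]; have hy' := (C1_curveP y).1 hy.
have hx := C1d_fst (C1d_snd hy').
have hq := continuous_dot hx.2 hx.2.
have [z zI zmax] := EVT_max (@ler01 R) (continuous_subspaceT hq).
pose C := 1 + dot (derive1 y z).2.1 (derive1 y z).2.1.
have C1 : 1 <= C by rewrite lerDl dot_ge0.
have C0 : 0 < C by apply: lt_le_trans C1.
exists (Num.truncn (4 * C)).+1 => // a b a0 ab b1 bN.
have xx t : 0 <= t <= 1 -> dot (y t).2.1 (y t).2.1 = 4^-1.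
  by move=> /yM[_ /tangent_bundle_S2P[]].
have a1 : a <= 1 by apply: le_trans b1.
have h := C1d_dot hx (C1d_cst (y a).2.1).
have aa : 0 <= a <= 1 by rewrite a0.
have bC : (b - a) * C <= 4^-1.
  have N0 : 0 < (Num.truncn (4 * C)).+1%:R :> R by rewrite ltr0n.
  rewrite -[X in _ * X](mulfK (_ : 4 != 0)) ?pnatr_eq0 // mulrA.
  rewrite ler_pdivrMr // mulVf ?pnatr_eq0 // mulrC [C * 4]mulrC.
  apply: (@le_trans _ _ ((4 * C) * (Num.truncn (4 * C)).+1%:R^-1)).
    by rewrite ler_wpM2l // mulr_ge0 // ltW.
  rewrite ler_pdivrMr // mul1r ltW //.
  by have /andP[] := truncn_itv (ltW (mulr_gt0 (ltr0n R 4) C0)).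
have : - C * b - - C * a <= dot (y b).2.1 (y a).2.1 - dot (y a).2.1 (y a).2.1.
  apply: (@increment_le _ (fun t => - C * t) (fun t => dot (y t).2.1 (y a).2.1)
    (fun=> - C * 1) (fun t => dot (derive1 y t).2.1 (y a).2.1 + dot (y t).2.1 0)
    a b ab (fun t _ => @is_deriveZ _ _ _ id (- C) t 1 1 (is_derive_id t 1))
    (fun t _ => h.1 t)) => t /andP[ta tb].
  rewrite mulr1 dot0r addr0 lerNl -dotNl; apply: le_sqr; first exact: ltW.
  apply: le_trans (dot_cauchy _ _) _; rewrite (xx a aa) dotNl dotNr opprK.
  have hz : dot (derive1 y t).2.1 (derive1 y t).2.1 <= C.
    apply: (@le_trans _ _ (dot (derive1 y z).2.1 (derive1 y z).2.1)).
      apply: zmax; rewrite in_itv/= (le_trans a0 (ltW ta)).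
      exact: le_trans (ltW tb) b1.
    by rewrite lerDr.
  apply: (@le_trans _ _ (C * 1)); last by rewrite expr2 ler_wpM2l // ltW.
  apply: ler_pM => //; first exact: dot_ge0.
  by rewrite invf_le1 // ler1n.
rewrite (xx a aa) mulNr mulNr opprK => hC.
have : C * (b - a) <= 4^-1 by rewrite mulrC.
rewrite mulrBr; move: hC; lra.
Qed.

(** The arc is cut into N pieces, and each is lifted by the section based at the
    end of the lift of the previous one. *)
Lemma lift_arc (y : R -> R^o * (V3 * V3)) l (A : V4 * V4) K :
  arc_in limit_space y -> arclength_of (@limit_speed R) y l ->
  height (y 0) + (l 1 - l 0) <= K ->
  tangent_bundle S3 A -> collapse e A = y 0 ->
  exists B l', [/\ tangent_bundle S3 B, collapse e B = y 1, up A B l' &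
    l' <= lift_distortion K * (l 1 - l 0)].
Proof.
move=> yM hl yK AM Ay; have [N N0 hN] := arc_uniform_step yM.
have NR : 0 < N%:R :> R by rewrite ltr0n.
have hK (t : R) : 0 <= t <= 1 -> height (y t) <= K.
  move=> t01; have := lipschitz_arc height_lipschitz yM hl t01.
  have : l t <= l 1.
    by case/andP: t01 => t0 t1; exact: (arclength_mono Fdown t0 t1 (lexx 1) hl).
  lra.
suff : forall i, (0 < i <= N)%N -> exists B l', [/\ tangent_bundle S3 B,
    collapse e B = y (i%:R / N%:R), up A B l' &
    l' <= lift_distortion K * (l (i%:R / N%:R) - l 0)].
  by move=> /(_ N); rewrite N0 leqnn divff ?gt_eqF // => /(_ isT).
have step i B : (i < N)%N -> tangent_bundle S3 B ->
    collapse e B = y (i%:R / N%:R) -> exists B' l', [/\ tangent_bundle S3 B',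
    collapse e B' = y (i.+1%:R / N%:R), up B B' l' &
    l' <= lift_distortion K * (l (i.+1%:R / N%:R) - l (i%:R / N%:R))].
  move=> iN BM By.
  have h0 : 0 <= i%:R / N%:R :> R by rewrite divr_ge0.
  have h1 : i%:R / N%:R <= i.+1%:R / N%:R :> R.
    by rewrite ler_pM2r ?invr_gt0 // ler_nat.
  have h2 : i.+1%:R / N%:R <= 1 :> R by rewrite ler_pdivrMr // mul1r ler_nat.
  apply: (lift_subarc h0 h1 h2 yM hl _ hK BM By) => t /andP[ta tb].
  apply: hN => //; first exact: le_trans h2.
  apply: (@le_trans _ _ (i.+1%:R / N%:R - i%:R / N%:R)); first by rewrite lerB.
  by rewrite -mulrBl -natrB // subSnn mul1r.
elim=> [//|[|i] ih] /andP[_ iN].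
  have [|B [l' hB]] := step 0%N A N0 AM; first by rewrite mul0r.
  by exists B, l'; move: hB; rewrite mul0r.
have [|B [l1 [BM By pAB l1le]]] := ih; first by rewrite /= ltnW.
have [B' [l2 [B'M B'y pBB' l2le]]] := step _ B iN BM By.
exists B', (l1 + l2); split=> //; first exact: path_cat pAB pBB'.
apply: (le_trans (lerD l1le l2le)); rewrite -mulrDr.
by rewrite addrC addrA subrK.
Qed.

Lemma lift_path y y' l (A : V4 * V4) K : down y y' l -> height y + l <= K ->
  tangent_bundle S3 A -> collapse e A = y ->
  exists B l', [/\ tangent_bundle S3 B, collapse e B = y', up A B l' &
    l' <= lift_distortion K * l].
Proof.
move=> h; elim/(path_length_arc_ind Fdown): h A => {y y' l}
    [c l cM hl A hK AM Ay|y1 y2 y3 l l' p12 ih p23 ih' A hK AM Ay].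
  exact: (lift_arc cM hl).
have l'0 := path_length_ge0 Fdown p23.
have h2 := lipschitz_path Fdown height_lipschitz p12.
have [|B [m [BM By pAB ml]]] := ih A _ AM Ay; first by lra.
have [|B' [m' [B'M B'y pBB' ml']]] := ih' B _ BM By; first by lra.
exists B', (m + m'); split=> //; first exact: path_cat pAB pBB'.
by rewrite mulrDr; exact: lerD.
Qed.

End PathTransfer.

(** * Fibres of the collapsing map *)

Section Fibres.
Context {R : realType}.
Local Notation V4 := 'rV[R]_4.
Local Notation V3 := 'rV[R]_3.
Implicit Types (p u v w : V4).

(** Multiplication by the complex number a + i b, the Hopf action when
    a^2 + b^2 = 1. *)
Definition hopf_action (a b : R) u : V4 := a *: u + b *: hopf_field u.

Lemma hopf_action_TS3 a b p v : a ^+ 2 + b ^+ 2 = 1 ->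
  tangent_bundle S3 (p, v) ->
  tangent_bundle S3 (hopf_action a b p, hopf_action a b v).
Proof.
move=> ab /tangent_bundle_S3P[/= pp pv]; apply/tangent_bundle_S3P; split=> /=.
  transitivity ((a ^+ 2 + b ^+ 2) * dot p p); last by rewrite ab pp mulr1.
  by rewrite !(dot4E, mxE) /=; ring.
transitivity ((a ^+ 2 + b ^+ 2) * dot p v); last by rewrite pv mulr0.
by rewrite !(dot4E, mxE) /=; ring.
Qed.

Lemma collapse_hopf_action e a b p v : a ^+ 2 + b ^+ 2 = 1 ->
  collapse e (hopf_action a b p, hopf_action a b v) = collapse e (p, v).
Proof.
move=> ab; rewrite /collapse /=; congr (_ * _, (_, _)).
- transitivity ((a ^+ 2 + b ^+ 2) * dot v (hopf_field p)); last first.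
    by rewrite ab mul1r.
  by rewrite !(dot4E, mxE) /=; ring.
- transitivity ((a ^+ 2 + b ^+ 2) *: hopf p); last by rewrite ab scale1r.
  by apply: row3P; rewrite !mxE /=; field.
- transitivity ((a ^+ 2 + b ^+ 2) *: dhopf p v); last by rewrite ab scale1r.
  by apply: row3P; rewrite !mxE /=; ring.
Qed.

(** The number a + i b is the Hermitian product of p' and p; its modulus is given
    by the product of the images in S^2, and is 1 when these coincide. *)
Lemma hopf_fibre p p' : dot p p = 1 -> dot p' p' = 1 -> hopf p = hopf p' ->
  let a := dot p p' in let b := dot (hopf_field p) p' in
  a ^+ 2 + b ^+ 2 = 1 /\ p' = hopf_action a b p.
Proof.
move=> pp pp' hpp' a b.
have ab : a ^+ 2 + b ^+ 2 = 1.
  transitivity (dot p p * dot p' p' / 2 + 2 * dot (hopf p) (hopf p')).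
    by rewrite /a /b !(dot3E, dot4E, mxE) /=; field.
  have -> : dot (hopf p) (hopf p') = 4^-1.
    by rewrite -hpp'; apply/dot_S2/hopf_S2; rewrite /S3 /sphere /= expr1n.
  by rewrite pp pp'; field.
split=> //; apply/eqP; rewrite -subr_eq0; apply/eqP/dot_eq0.
have f1 : dot (hopf_field p) (hopf_field p) = 1.
  by apply: hopf_field_unit; rewrite /S3 /sphere /= expr1n.
have pf := hopf_field_tangent p.
rewrite /hopf_action !dotE pp f1 pp' (dotC p') -/a (dotC p') -/b.
rewrite (dotC (hopf_field p) p) pf -/b.
transitivity (1 - (a ^+ 2 + b ^+ 2)); last by rewrite ab subrr.
by ring.
Qed.

Lemma angle_exists (a b : R) : a ^+ 2 + b ^+ 2 = 1 ->
  exists2 th : R, a = cos th /\ b = sin th & `|th| <= pi.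
Proof.
move=> ab; have b2 : b ^+ 2 = 1 - a ^+ 2 by rewrite -ab addrC addKr.
have a1 : -1 <= a <= 1.
  rewrite -ler_norml; apply: le_sqr => //.
  by rewrite real_normK ?num_real // expr1n -subr_ge0 -b2 sqr_ge0.
have s : sin (acos a) = `|b| by rewrite sin_acos // -b2 sqrtr_sqr.
have pos : `|acos a| <= pi by rewrite ger0_norm ?acos_ge0 // acos_lepi.
have [b0|b0] := leP 0 b.
  by exists (acos a) => //; rewrite acosK // s ger0_norm.
exists (- acos a); last by rewrite normrN.
by rewrite cosN sinN acosK // s ltr0_norm // opprK.
Qed.

Lemma C1d_cos_sin (th : R) :
  C1d (fun t => cos (th * t)) (fun t => th * - sin (th * t)) /\
  C1d (fun t => sin (th * t)) (fun t => th * cos (th * t)).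
Proof.
have hl : C1d (fun t => th * t) (fun t => 0 * t + th * 1).
  by apply: C1dM; [exact: C1d_cst|exact: C1d_id].
have hc : C1d (@cos R) (fun t => - sin t).
  by split=> t; [exact: is_derive_cos|apply: cvgN; exact: continuous_sin].
have hs : C1d (@sin R) cos.
  by split=> t; [exact: is_derive_sin|exact: continuous_cos].
have lE : (fun t : R => 0 * t + th * 1) = fun=> th.
  by apply/funext => t; rewrite mul0r add0r mulr1.
rewrite lE in hl; split; [exact: C1d_comp hc hl|exact: C1d_comp hs hl].
Qed.

Lemma C1d_hopf_action (th : R) u : C1d
  (fun t => hopf_action (cos (th * t)) (sin (th * t)) u)
  (fun t => th *: hopf_field (hopf_action (cos (th * t)) (sin (th * t)) u)).
Proof.
have [hc hs] := C1d_cos_sin th.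
have := C1dD (C1dZ hc (C1d_cst u)) (C1dZ hs (C1d_cst (hopf_field u))).
set d := (d in C1d _ d -> _); set d' := (d in _ -> C1d _ d).
rewrite (_ : d = d') //; apply/funext => t; rewrite /d /d'.
by apply: row4P; rewrite !mxE /=; ring.
Qed.

(** The Hopf circles have length O(e), and parallel transport along them rotates
    horizontal vectors, relative to the Hopf action, at a rate O(e^2). *)
Lemma fibre_speed e th p v K : 0 < e -> tangent_bundle S3 (p, v) ->
  berger_height e (p, v) <= K ->
  berger_speed e (p, v) (th *: hopf_field p, th *: hopf_field v) <=
  e * `|th| * (1 + e * K).
Proof.
move=> e0 /tangent_bundle_S3P[/= pp pv] hK.
have K0 : 0 <= K by apply: le_trans hK; exact: sqrtr_ge0.
have := berger_height_le hK; rewrite /berger_vec_sqnorm /= => h.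
apply: le_sqr.
  by rewrite !mulr_ge0 ?addr_ge0 ?mulr_ge0 ?(ltW e0).
rewrite /berger_speed sqr_sqrtr ?berger_sasaki_sqnorm_ge0 //.
rewrite /berger_sasaki_sqnorm /=.
have -> : dot (th *: hopf_field p) (hopf_field p) = th.
  by rewrite dotZl hopf_field_unit ?mulr1 // /S3 /sphere /= expr1n.
have -> : dot (th *: hopf_field p) (jfield p) = 0.
  by rewrite dotZl dot4E !mxE /=; ring.
have -> : dot (th *: hopf_field p) (kfield p) = 0.
  by rewrite dotZl dot4E !mxE /=; ring.
have -> : dot (th *: hopf_field v) (hopf_field p) +
    dot v (hopf_field (th *: hopf_field p)) = 0.
  by rewrite !(dot4E, mxE) /=; ring.
have -> : dot (th *: hopf_field v) (jfield p) +
    dot v (jfield (th *: hopf_field p)) = - 2 * th * dot v (kfield p).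
  by rewrite !(dot4E, mxE) /=; ring.
have -> : dot (th *: hopf_field v) (kfield p) +
    dot v (kfield (th *: hopf_field p)) = 2 * th * dot v (jfield p).
  by rewrite !(dot4E, mxE) /=; ring.
move: (dot v (hopf_field p)) (dot v (jfield p)) (dot v (kfield p)) h.
move=> n1 n2 n3 h.
have h2 : n2 ^+ 2 + n3 ^+ 2 <= K ^+ 2.
  by apply: le_trans h; rewrite -addrA lerDr sqr_ge0.
rewrite /berger_sasaki_form.
rewrite [leLHS](_ : _ = e ^+ 2 * th ^+ 2 * (1 + e ^+ 2 * (n2 ^+ 2 + n3 ^+ 2)));
  last by ring.
rewrite [leRHS]exprMn [(e * `|th|) ^+ 2]exprMn real_normK ?num_real //.
apply: ler_wpM2l; first by rewrite mulr_ge0 ?sqr_ge0.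
apply: (@le_trans _ _ (1 + e ^+ 2 * K ^+ 2)).
  by rewrite lerD2l ler_wpM2l // sqr_ge0.
rewrite -subr_ge0 [leRHS](_ : _ = 2 * (e * K)); last by ring.
by rewrite mulr_ge0 // mulr_ge0 // ltW.
Qed.

(** The points are joined by an arc of the Hopf circle action, which leaves the
    image under [collapse e] constant. *)
Lemma fibre_path e gS (A B : V4 * V4) K : 0 < e ->
  sasaki_metric S3 (berger_metric e) gS ->
  tangent_bundle S3 A -> tangent_bundle S3 B -> collapse e A = collapse e B ->
  berger_height e A <= K ->
  exists2 l, path_length (tangent_bundle S3) gS A B l & l <= e * pi * (1 + e * K).
Proof.
move=> e0 hgS; case: A => p v; case: B => p' v' AM BM AB hK.
have Fup := berger_speedE e0 hgS.
have K0 : 0 <= K by apply: le_trans hK; exact: sqrtr_ge0.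
have [pp _] := (tangent_bundle_S3P _).1 AM.
have [pp' _] := (tangent_bundle_S3P _).1 BM.
have [ab p'E] := hopf_fibre pp pp' (congr1 (fun y => y.2.1) AB).
have [th [aE bE] thpi] := angle_exists ab.
rewrite /= aE bE in p'E.
have cs (s : R) : cos s ^+ 2 + sin s ^+ 2 = 1 by rewrite cos2Dsin2.
pose c t := (hopf_action (cos (th * t)) (sin (th * t)) p,
             hopf_action (cos (th * t)) (sin (th * t)) v).
have hc := C1d_pair (C1d_hopf_action th p) (C1d_hopf_action th v).
have cM t : tangent_bundle S3 (c t) by exact: hopf_action_TS3.
have c0 : c 0 = (p, v).
  by rewrite /c mulr0 cos0 sin0 /hopf_action !scale1r !scale0r !addr0.
have c1 : c 1 = (p', v').
  have h1 : (c 1).1 = p' by rewrite /c /= mulr1.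
  rewrite [LHS]surjective_pairing h1; congr (_, _).
  apply: (collapse_inj e0 (p := p')) => //.
    by rewrite -{1}h1 -surjective_pairing.
  by rewrite -{1}h1 -surjective_pairing /c collapse_hopf_action.
have cA : arc_in (tangent_bundle S3) c by split=> //; exact: C1d_curve hc.
have [m hm] := arclength_exists Fup cA.1.
exists (m 1 - m 0).
  by have := arc_path_length Fup cA hm; rewrite c0 c1.
set k := e * pi * (1 + e * K).
rewrite [leRHS](_ : _ = k * 1 - k * 0); last by rewrite mulr0 subr0 mulr1.
apply: (@increment_le _ m (fun t => k * t)
  (fun t => berger_speed e (c t) (derive1 c t)) (fun=> k * 1)
  0 1 ler01 hm (fun t _ => @is_deriveZ _ _ _ id k t 1 1 (is_derive_id t 1))).
move=> t _; rewrite (C1dE hc) mulr1.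
have hKt : berger_height e (c t) <= K.
  by rewrite berger_heightE // /c collapse_hopf_action // -berger_heightE.
apply: le_trans (fibre_speed th e0 (cM t) hKt) _.
rewrite /k ler_wpM2r ?addr_ge0 ?mulr_ge0 ?(ltW e0) //.
by rewrite ler_wpM2l // ltW.
Qed.

End Fibres.

(** * Connectedness and reflections of the limit space *)

Section LimitSpace.
Context {R : realType}.
Local Notation V4 := 'rV[R]_4.
Local Notation V3 := 'rV[R]_3.
Variable hS : V3 * V3 -> V3 * V3 -> V3 * V3 -> R.
Hypothesis hSP : sasaki_metric S2 (@euclidean_metric R 3) hS.
Local Notation g0 := (prod_metric (@line_metric R) hS).
Local Notation down := (path_length limit_space g0).
Local Notation d0 := (riem_dist limit_space g0).
Let Fdown := limit_speedE hSP.

Let joined y z := exists l, down y z l.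

Lemma joined_arc c : arc_in limit_space c -> joined (c 0) (c 1).
Proof.
move=> cM; have [l hl] := arclength_exists Fdown cM.1.
by exists (l 1 - l 0); exact: (arc_path_length Fdown cM hl).
Qed.

Lemma joined_trans y z w : joined y z -> joined z w -> joined y w.
Proof. by move=> [l hl] [l' hl']; exists (l + l'); exact: path_cat hl hl'. Qed.

Lemma joined_sym y z : joined y z -> joined z y.
Proof. by move=> [l /(path_length_sym Fdown)]; exists l. Qed.

Lemma joined_zero (a : R) (x w : V3) : limit_space (a, (x, w)) ->
  joined (a, (x, w)) (0, (x, 0)).
Proof.
move=> [_ /tangent_bundle_S2P[/= xx xw]].
have h := C1dB (C1d_cst (1 : R)) (@C1d_id R).
have hc := C1d_pair (C1dM h (C1d_cst a)) (C1d_pair (C1d_cst x) (C1dZ h (C1d_cst w))).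
have := @joined_arc (fun t => ((1 - t) * a : R^o, (x, (1 - t) *: w))).
rewrite /= !subr0 !subrr mul1r mul0r scale1r scale0r; apply.
split; first exact: C1d_curve hc.
move=> t _; split=> //; apply/tangent_bundle_S2P; split=> //=.
by rewrite dotZr xw mulr0.
Qed.

Lemma S2_zero (x : V3) : S2 x -> limit_space (0, (x, 0)).
Proof.
by move=> /dot_S2 xx; split=> //; apply/tangent_bundle_S2P; rewrite /= dot0r.
Qed.

(** The chord between two points that are not antipodal avoids the origin and is
    projected radially. *)
Lemma joined_S2 (x q : V3) : S2 x -> S2 q -> q != - x ->
  joined (0, (x, 0)) (0, (q, 0)).
Proof.
move=> /dot_S2 xx /dot_S2 qq qx.
have k0 : 0 < 4^-1 + dot x q.
  have h : 0 < dot (q + x) (q + x).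
    rewrite lt_neqAle dot_ge0 andbT eq_sym; apply: contra qx => /eqP /dot_eq0 /eqP.
    by rewrite addr_eq0.
  move: h; rewrite !dotE xx qq (dotC q x) => h; lra.
have ht := @C1d_id R.
have hu := C1dD (C1d_cst x) (C1dZ ht (C1d_cst (q - x))).
pose u t := x + t *: (q - x).
have hn := C1dM (C1d_cst (4 : R)) (C1d_dot hu hu).
have uE t : dot (u t) (u t) = (2^-1 * (4^-1 + dot x q)) +
    2 * (4^-1 - dot x q) * (t - 2^-1) ^+ 2.
  by rewrite /u !dotE xx qq (dotC q x); field.
have k1 : 0 <= 4^-1 - dot x q.
  have := dot_ge0 (q - x); rewrite !dotE xx qq (dotC q x) => h; lra.
have u0 t : 0 < 4 * dot (u t) (u t).
  rewrite mulr_gt0 // uE ltr_pwDl ?mulr_gt0 ?invr_gt0 //.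
  by rewrite mulr_ge0 ?sqr_ge0 // mulr_ge0.
have [r' hr] := C1d_rsqrt hn u0.
have hc := C1d_pair (C1d_cst (0 : R^o)) (C1d_pair (C1dZ hr hu) (C1d_cst (0 : V3))).
have c0 : (Num.sqrt (4 * dot (u 0) (u 0)))^-1 *: u 0 = x.
  by rewrite /u scale0r addr0 xx mulfV ?pnatr_eq0 // sqrtr1 invr1 scale1r.
have c1 : (Num.sqrt (4 * dot (u 1) (u 1)))^-1 *: u 1 = q.
  rewrite /u scale1r addrC subrK qq mulfV ?pnatr_eq0 // sqrtr1 invr1.
  by rewrite scale1r.
have := @joined_arc (fun t => (0 : R^o,
  ((Num.sqrt (4 * dot (u t) (u t)))^-1 *: u t, 0))).
rewrite c0 c1; apply; split; first exact: C1d_curve hc.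
move=> t _; apply: S2_zero; apply/dot_S2.
rewrite dotZl dotZr mulrA -expr2 exprVn sqr_sqrtr ?(ltW (u0 t)) //.
by have := lt0r_neq0 (u0 t); rewrite mulf_eq0 negb_or => /andP[_ ?]; field.
Qed.

(** Vectors are scaled to zero; antipodal points are joined through a third point
    z of the sphere. *)
Lemma limit_space_connected : path_connected limit_space g0.
Proof.
have S2_joined x q : S2 x -> S2 q -> joined (0, (x, 0)) (0, (q, 0)).
  move=> xS qS; have [qx|qx] := eqVneq q (- x); last exact: joined_S2.
  pose z : V3 := if x 0 0 == 0 then \row_k [:: 2^-1; 0; 0]`_k
    else \row_k [:: 0; 2^-1; 0]`_k.
  have zS : S2 z.
    by apply/dot_S2; rewrite /z; case: ifP => _; rewrite dot3E !mxE /=; field.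
  have zx (k : R) : k != 0 -> z != k *: x.
    move=> k0; rewrite /z; have [x0|x0] := eqVneq (x 0 0) 0.
      apply/eqP => /rowP /(_ 0); rewrite !mxE /= x0 mulr0 => /eqP.
      by rewrite invr_eq0 pnatr_eq0.
    apply/eqP => /rowP /(_ 0); rewrite !mxE /= => /esym /eqP.
    by rewrite mulf_eq0 (negPf k0) (negPf x0).
  apply: (@joined_trans _ (0, (z, 0))).
    by apply: joined_S2 => //; rewrite -scaleN1r zx // oppr_eq0 oner_eq0.
  apply: joined_S2 => //; rewrite qx eqr_opp eq_sym -[x]scale1r zx //.
move=> [a [x w]] [b [q v]] hy hz.
have xS : S2 x by case: hy => _ [].
have qS : S2 q by case: hz => _ [].
apply: joined_trans (joined_zero hy) _.
exact: joined_trans (S2_joined _ _ xS qS) (joined_sym (joined_zero hz)).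
Qed.

(** Division by zero makes this the identity for n = 0, so that
    [reflection (u - v)] exchanges vectors u and v of equal norm even if they
    coincide. *)
Definition reflection (n x : V3) : V3 := x - (2 * dot x n / dot n n) *: n.

Lemma linear_reflection n : linear (reflection n).
Proof.
move=> a u v; rewrite /reflection !dotE.
by apply: row3P; rewrite !mxE; ring.
Qed.

Lemma dot_reflection n u v : dot (reflection n u) (reflection n v) = dot u v.
Proof.
have [/dot_eq0 n0|n0] := eqVneq (dot n n) 0.
  by rewrite /reflection n0 !scaler0 !subr0.
by rewrite /reflection !dotE (dotC n v); field.
Qed.

Lemma reflectionK n : involutive (reflection n).
Proof.
move=> u; have [/dot_eq0 n0|n0] := eqVneq (dot n n) 0.
  by rewrite /reflection n0 !scaler0 !subr0.
rewrite {1}/reflection; have -> : dot (reflection n u) n = - dot u n.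
  by rewrite /reflection !dotE; field.
by rewrite /reflection mulrN mulNr scaleNr opprK subrK.
Qed.

Lemma reflection_swap u v : dot u u = dot v v -> reflection (u - v) u = v.
Proof.
move=> uv; have [->|nuv] := eqVneq u v.
  by rewrite /reflection subrr scaler0 subr0.
have n0 : dot (u - v) (u - v) != 0.
  by apply/eqP => /dot_eq0 /eqP; rewrite subr_eq0 (negPf nuv).
have e : 2 * dot u (u - v) = dot (u - v) (u - v).
  by rewrite !dotE -uv (dotC v u); ring.
by rewrite /reflection e mulfV // scale1r opprB addrC subrK.
Qed.

Definition reflect_limit (n : V3) (y : R^o * (V3 * V3)) : R^o * (V3 * V3) :=
  (y.1, (reflection n y.2.1, reflection n y.2.2)).

Lemma reflect_limitK n : involutive (reflect_limit n).
Proof. by case=> a [x w]; rewrite /reflect_limit /= !reflectionK. Qed.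

Lemma reflect_limit_in n y : limit_space y -> limit_space (reflect_limit n y).
Proof.
move=> [_ /tangent_bundle_S2P[h1 h2]]; split=> //; apply/tangent_bundle_S2P.
by rewrite /= !dot_reflection.
Qed.

Lemma reflect_dist_le n y z : limit_space y -> limit_space z ->
  d0 (reflect_limit n y) (reflect_limit n z) <= d0 y z.
Proof.
move=> yM zM; apply: lb_le_inf; first exact: limit_space_connected.
move=> l hl.
have [||l' hl' l'l] := path_length_map (Phi := reflect_limit n) (k := 1)
  (K := height y + l) Fdown Fdown height_lipschitz _ _ hl (lexx _).
- move=> c [/C1_curveP hc cM]; split; last first.
    by move=> t /cM; exact: reflect_limit_in.
  have hy := C1d_snd hc.
  exact: C1d_curve (C1d_pair (C1d_fst hc) (C1d_pair
    (C1d_linear (linear_reflection n) (C1d_fst hy))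
    (C1d_linear (linear_reflection n) (C1d_snd hy)))).
- move=> c t [/C1_curveP hc _] _ _; have hy := C1d_snd hc.
  have h := C1d_pair (C1d_fst hc) (C1d_pair
    (C1d_linear (linear_reflection n) (C1d_fst hy))
    (C1d_linear (linear_reflection n) (C1d_snd hy))).
  rewrite (C1dE h) mul1r /limit_speed /limit_sqnorm /round_sasaki_sqnorm /=.
  by rewrite !dot_reflection.
by rewrite mul1r in l'l; apply: le_trans l'l; exact: (riem_dist_le Fdown).
Qed.

Lemma reflect_dist n y z : limit_space y -> limit_space z ->
  d0 (reflect_limit n y) (reflect_limit n z) = d0 y z.
Proof.
move=> yM zM; apply/eqP; rewrite eq_le reflect_dist_le //=.
rewrite -[in leLHS](reflect_limitK n y) -[in leLHS](reflect_limitK n z).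
by apply: reflect_dist_le; exact: reflect_limit_in.
Qed.

End LimitSpace.

(** * Almost isometry between balls *)

Section Shrinking.
Context {R : realType}.

Lemma path_length_ends (V : normedModType R) (M : set V) g y z l :
  path_length M g y z l -> M y /\ M z.
Proof.
elim=> [c _ cM|y1 y2 y3 m m' _ [My _] _ [_ Mz]]; last by [].
by split; apply: cM; rewrite in_itv01 lexx ler01.
Qed.

(** An almost minimizing path is cut at length s. *)
Lemma dist_shrink (V : normedModType R) (M : set V) g F y z (s t : R) :
  speed_of M g F -> path_connected M g -> M y -> M z -> 0 <= s -> 0 < t ->
  riem_dist M g y z < s + t ->
  exists z' l, [/\ path_length M g y z' l, l <= s & riem_dist M g z' z <= t].
Proof.
move=> Fg conn My Mz s0 t0 dyz.
have [l hl lst] := riem_dist_lt Fg conn My Mz dyz.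
have [ls|/ltW ls] := leP l s.
  exists z, l; split=> //.
  exact: le_trans (riem_dist_le Fg (path_length_refl Fg Mz)) (ltW t0).
have [|z' [l1 [l2 [h1 h2 l1s l2s]]]] := path_length_split Fg hl (s := s).
  by rewrite s0.
exists z', l1; split=> //; apply: (le_trans (riem_dist_le Fg h2)); lra.
Qed.

End Shrinking.

Section AlmostIsometry.
Context {R : realType}.
Local Notation V4 := 'rV[R]_4.
Local Notation V3 := 'rV[R]_3.
Variables (e : R) (gS : V4 * V4 -> V4 * V4 -> V4 * V4 -> R).
Variable hS : V3 * V3 -> V3 * V3 -> V3 * V3 -> R.
Hypothesis e0 : 0 < e.
Hypothesis gSP : sasaki_metric S3 (berger_metric e) gS.
Hypothesis hSP : sasaki_metric S2 (@euclidean_metric R 3) hS.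
Local Notation TS3 := (tangent_bundle S3).
Local Notation g0 := (prod_metric (@line_metric R) hS).
Local Notation up := (path_length TS3 gS).
Local Notation down := (path_length limit_space g0).
Local Notation d := (riem_dist TS3 gS).
Local Notation d0 := (riem_dist limit_space g0).
Local Notation Phi := (collapse e).
Let Fup := berger_speedE e0 gSP.
Let Fdown := limit_speedE hSP.
Let conn := limit_space_connected hSP.

Lemma TS3_connected : path_connected TS3 gS.
Proof.
move=> A B AM BM; have AL := collapse_limit_space e AM.
have BL := collapse_limit_space e BM; have [l hl] := conn AL BL.
have [B' [l1 [B'M B'B p1 _]]] := lift_path e0 gSP hSP hl (lexx _) AM erefl.
have [l2 p2 _] := fibre_path e0 gSP B'M BM B'B (lexx _).
by exists (l1 + l2); exact: path_cat p1 p2.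
Qed.

Variables (r delta : R) (x : V4 * V4).
Hypotheses (r0 : 0 < r) (delta0 : 0 < delta) (delta1 : delta <= 1).
Hypotheses (xM : TS3 x) (x_height : berger_height e x = 1).

(** Heights are at most 1 + r on the ball of radius r, and the longest path that
    is projected or lifted has length at most 4 r + 3. *)
Definition height_bound : R := 5 * r + 4.
Local Notation K := height_bound.

Hypothesis hD : distortion e (K ^+ 2) <= 1 + delta.
Hypothesis hL : lift_distortion e K <= 1 + delta.
Hypothesis hF : e * pi * (1 + e * K) <= delta.

Lemma ball_height A : TS3 A -> d x A < r -> berger_height e A <= 1 + r.
Proof.
move=> AM xA; have [l hl lr] := riem_dist_lt Fup TS3_connected xM AM xA.
have := lipschitz_path Fup (berger_height_lipschitz e0) hl.
by rewrite x_height => h; apply: (le_trans h); rewrite lerD2l ltW.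
Qed.

Lemma ball_dist A B : TS3 A -> TS3 B -> d x A < r -> d x B < r -> d A B < 2 * r.
Proof.
move=> AM BM xA xB.
have := riem_dist_triangle Fup TS3_connected AM xM BM.
rewrite (riem_dist_sym Fup A x); lra.
Qed.

Lemma collapse_dist_le A B : TS3 A -> TS3 B -> d x A < r -> d x B < r ->
  d0 (Phi A) (Phi B) <= (1 + delta) * (d A B + delta).
Proof.
move=> AM BM xA xB; have hA := ball_height AM xA.
have rp := r0; have dp := delta0; have d1 := delta1.
have dAB := ball_dist AM BM xA xB.
have [|l hl lt] := @riem_dist_lt _ _ _ _ _ Fup A B (d A B + delta) TS3_connected AM BM.
  by rewrite ltrDl.
have [|l' hl' l'l] := collapse_path (K := K) e0 gSP hSP hl.
  rewrite /height_bound; lra.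
apply: (le_trans (riem_dist_le Fdown hl')); apply: (le_trans l'l).
have l0 := path_length_ge0 Fup hl.
apply: ler_pM => //; last exact: ltW.
exact: distortion_ge0.
Qed.

(** A lifted path ends in the fibre of the prescribed endpoint, and fibres are
    short. *)
Lemma dist_le_collapse A B : TS3 A -> TS3 B -> d x A < r -> d x B < r ->
  d A B <= (1 + delta) * (d0 (Phi A) (Phi B) + delta) + delta.
Proof.
have rp := r0; have dp := delta0; have d1 := delta1.
move=> AM BM xA xB; have hA := ball_height AM xA; have hB := ball_height BM xB.
have dAB := ball_dist AM BM xA xB; have d0AB := collapse_dist_le AM BM xA xB.
have AL := collapse_limit_space e AM; have BL := collapse_limit_space e BM.
have [|l hl lt] := @riem_dist_lt _ _ _ _ _ Fdown (Phi A) (Phi B)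
    (d0 (Phi A) (Phi B) + delta) conn AL BL.
  by rewrite ltrDl.
have d0le : d0 (Phi A) (Phi B) <= 4 * r + 2.
  apply: (le_trans d0AB); apply: (@le_trans _ _ (2 * (2 * r + 1))); last lra.
  have dAB0 : 0 <= d A B.
    apply: lb_le_inf => [|m]; last exact: (path_length_ge0 Fup).
    exact: TS3_connected.
  by apply: ler_pM; lra.
have [|B' [l1 [B'M B'B p1 l1l]]] := lift_path (K := K) e0 gSP hSP hl _ AM erefl.
  by rewrite -berger_heightE // /height_bound; lra.
have [|l2 p2 l2l] := fibre_path (K := K) e0 gSP B'M BM B'B.
  by rewrite berger_heightE // B'B -berger_heightE // /height_bound; lra.
apply: (le_trans (riem_dist_le Fup (path_cat p1 p2))); apply: lerD.
  apply: (le_trans l1l); have l0 := path_length_ge0 Fdown hl.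
  by apply: ler_pM => //; [exact: lift_distortion_ge0|exact: ltW].
exact: le_trans l2l hF.
Qed.

Lemma lift_dist z l : down (Phi x) z l -> l <= r ->
  exists A, [/\ TS3 A, Phi A = z & d x A <= (1 + delta) * l].
Proof.
move=> hl lr; have rp := r0.
have [|B [l1 [BM Bz p1 l1l]]] := lift_path (K := K) e0 gSP hSP hl _ xM erefl.
  by rewrite -berger_heightE // x_height /height_bound; lra.
exists B; split=> //; apply: (le_trans (riem_dist_le Fup p1)).
apply: (le_trans l1l); rewrite ler_wpM2r //; exact: (path_length_ge0 Fdown hl).
Qed.

Lemma dist_refl0 y : limit_space y -> d0 y y <= 0.
Proof. by move=> yM; exact: (riem_dist_le Fdown (path_length_refl Fdown yM)). Qed.

(** The map from the ball of TS^3 to the ball of the limit is [collapse e],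
    followed by a reflection that matches the base points and by a small
    displacement of the points that would leave the ball. *)
Lemma ball_approximation (n : V3) (y : R^o * (V3 * V3)) (eta : R) :
  reflect_limit n (Phi x) = y -> delta * (r + 2) < r ->
  delta * (8 * r + 13) < eta ->
  exists f : V4 * V4 -> R^o * (V3 * V3),
  [/\ forall a, oball TS3 d x r a -> oball limit_space d0 y r (f a),
      f x = y,
      forall a b, oball TS3 d x r a -> oball TS3 d x r b ->
        `|d0 (f a) (f b) - d a b| < eta
    & forall b, oball limit_space d0 y r b ->
        exists2 a, oball TS3 d x r a & d0 (f a) b < eta].
Proof.
move=> xy; pose s := delta * (r + 2); rewrite -/s => sr seta.
have rp := r0; have dp := delta0; have d1 := delta1.
have s0 : 0 < s by rewrite mulr_gt0 // addr_gt0.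
have sE : s = delta * r + 2 * delta by rewrite /s; ring.
have etaE : delta * (8 * r + 13) = 8 * (delta * r) + 13 * delta by ring.
have dr : 0 < delta * r by rewrite mulr_gt0.
have dd : delta * delta <= delta by rewrite ler_piMr // ltW.
have xL := collapse_limit_space e xM.
have xx : d x x < r.
  exact: le_lt_trans (riem_dist_le Fup (path_length_refl Fup xM)) rp.
have rs0 : 0 <= r - s by rewrite subr_ge0 ltW.
have s20 : 0 < 2 * s by rewrite mulr_gt0.
have shrink z : limit_space z -> d0 (Phi x) z < r - s + 2 * s ->
    exists z' l, [/\ down (Phi x) z' l, l <= r - s & d0 z' z <= 2 * s].
  by move=> zL; exact: (dist_shrink Fdown conn xL zL rs0 s20).
have : forall A, exists z, (TS3 A /\ d x A < r ->
      [/\ limit_space z, d0 (Phi x) z < r & d0 z (Phi A) <= 2 * s]) /\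
    (TS3 A -> d0 (Phi x) (Phi A) < r -> z = Phi A).
  move=> A; have [[AM Ar]|far] := pselect (TS3 A /\ d0 (Phi x) (Phi A) < r).
    exists (Phi A); split=> // _; split=> //; first exact: collapse_limit_space.
    exact: le_trans (dist_refl0 (collapse_limit_space e AM)) (ltW s20).
  have [[AM xA]|out] := pselect (TS3 A /\ d x A < r); last first.
    by exists (Phi A); split.
  have AL := collapse_limit_space e AM.
  have [|z [l [hl ls zA]]] := shrink _ AL.
    apply: le_lt_trans (collapse_dist_le xM AM xx xA) _.
    rewrite mulrDl mul1r mulrDr sE.
    have : delta * d x A < delta * r by rewrite ltr_pM2l.
    lra.
  exists z; split=> [_|_ h]; last by case: far.
  have [_ zL] := path_length_ends hl; split=> //.
  by apply: le_lt_trans (riem_dist_le Fdown hl) _; lra.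
move=> /choice[g hg].
have gball A : TS3 A -> d x A < r ->
    [/\ limit_space (g A), d0 (Phi x) (g A) < r & d0 (g A) (Phi A) <= 2 * s].
  by move=> AM xA; have [h _] := hg A; exact: h.
have gE A : TS3 A -> d0 (Phi x) (Phi A) < r -> g A = Phi A.
  by move=> AM xA; have [_ h] := hg A; exact: h.
exists (fun A => reflect_limit n (g A)); split.
- move=> A [AM xA]; have [gL gr _] := gball A AM xA; split.
    exact: reflect_limit_in.
  by rewrite -xy (reflect_dist hSP).
- by rewrite gE //; exact: le_lt_trans (dist_refl0 xL) rp.
- move=> A B [AM xA] [BM xB].
  have [gAL _ gA] := gball A AM xA; have [gBL _ gB] := gball B BM xB.
  rewrite (reflect_dist hSP) //.
  have AL := collapse_limit_space e AM; have BL := collapse_limit_space e BM.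
  have t1 := riem_dist_triangle Fdown conn gAL AL gBL.
  have t2 := riem_dist_triangle Fdown conn AL BL gBL.
  have t3 := riem_dist_triangle Fdown conn AL gAL BL.
  have t4 := riem_dist_triangle Fdown conn gAL gBL BL.
  rewrite (riem_dist_sym Fdown (Phi A) (g A)) in t3.
  rewrite (riem_dist_sym Fdown (Phi B) (g B)) in t2.
  have h1 := collapse_dist_le AM BM xA xB.
  have h2 := dist_le_collapse AM BM xA xB.
  have h3 := ball_dist AM BM xA xB.
  rewrite mulrDl mul1r mulrDr in h1; rewrite mulrDl mul1r mulrDr in h2.
  have h4 : delta * d A B <= delta * (2 * r) by rewrite ler_pM2l // ltW.
  have h4E : delta * (2 * r) = 2 * (delta * r) by ring.
  have h5 : delta * d0 (Phi A) (Phi B) <= delta * (4 * r + 2).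
    by rewrite ler_pM2l //; lra.
  have h5E : delta * (4 * r + 2) = 4 * (delta * r) + 2 * delta by ring.
  rewrite ltr_norml; apply/andP; split; lra.
- move=> b [bL yb].
  have b0L := reflect_limit_in n bL.
  have xb : d0 (Phi x) (reflect_limit n b) < r.
    rewrite -(reflect_dist hSP n) // reflect_limitK xy; exact: yb.
  have [|z [l [hl ls zb]]] := shrink _ b0L; first by lra.
  have l0 := path_length_ge0 Fdown hl.
  have [|A [AM Az xA]] := lift_dist hl; first by lra.
  have dl : delta * l <= delta * (r - s) by rewrite ler_pM2l.
  have xAr : d x A < r.
    apply: le_lt_trans xA _; rewrite mulrDl mul1r.
    have ds : 0 < delta * s by rewrite mulr_gt0.
    by move: dl; rewrite mulrBr; lra.
  exists A; first by split.
  rewrite gE // ?Az; last by apply: le_lt_trans (riem_dist_le Fdown hl) _; lra.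
  have [_ zL] := path_length_ends hl.
  rewrite -[b](reflect_limitK n) (reflect_dist hSP) //.
  by apply: le_lt_trans zb _; lra.
Qed.

End AlmostIsometry.


(** * The limit of small parameters *)

Section SmallParameters.
Context {R : realType}.

Lemma small_distortion (K delta : R) : 0 <= K -> 0 < delta ->
  exists2 e1 : R, 0 < e1 & forall e, 0 < e -> e < e1 ->
    [/\ distortion e (K ^+ 2) <= 1 + delta, lift_distortion e K <= 1 + delta &
        e * pi * (1 + e * K) <= delta].
Proof.
move=> K0 d0; pose a := 1 + 4 * K ^+ 2; pose C := 2 * a + 1 + pi * (1 + K).
have K2 : 0 <= K ^+ 2 by exact: sqr_ge0.
have a1 : 1 <= a by rewrite lerDl mulr_ge0.
have p0 : 0 <= pi * (1 + K) by rewrite mulr_ge0 ?pi_ge0 // addr_ge0.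
have C0 : 0 < C by rewrite /C; lra.
exists (Num.min 1 (delta / C)); first by rewrite lt_min ltr01 divr_gt0.
move=> e e0; rewrite lt_min => /andP[/ltW e1]; rewrite ltr_pdivlMr // => eC.
have ee : e ^+ 2 <= e by rewrite expr2 ler_piMr // ltW.
have hD : distortion e (K ^+ 2) <= 1 + e * a.
  rewrite /distortion /a.
  have : e ^+ 2 * K ^+ 2 <= e * K ^+ 2 by rewrite ler_wpM2r.
  move=> h; rewrite [leRHS](_ : _ = 1 + e + 4 * (e * K ^+ 2)); last by ring.
  rewrite [leLHS](_ : _ = 1 + e + 2 * (e * K ^+ 2) + 2 * (e ^+ 2 * K ^+ 2));
    last by ring.
  lra.
have eCE : e * C = 2 * (e * a) + e + e * (pi * (1 + K)) by rewrite /C; ring.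
have ea : 0 <= e * a by rewrite mulr_ge0 ?(ltW e0) // (le_trans ler01).
have ep : 0 <= e * (pi * (1 + K)) by rewrite mulr_ge0 // ltW.
split; first by lra.
  apply: (@le_trans _ _ ((1 + e * a) * (1 + e))).
    apply: ler_pM => //; last by rewrite lerD2l.
      exact: le_trans ler01 (distortion_ge1 e0 K).
    by rewrite addr_ge0 ?sqr_ge0.
  have : e * (e * a) <= e * a by rewrite ler_piMl.
  have -> : (1 + e * a) * (1 + e) = 1 + e + e * a + e * (e * a) by ring.
  lra.
apply: (@le_trans _ _ (e * (pi * (1 + K)))); last by lra.
rewrite -mulrA ler_wpM2l ?(ltW e0) // ler_wpM2l ?pi_ge0 // lerD2l.
by rewrite ler_piMl.
Qed.

Lemma small_delta (r eta : R) : 0 < r -> 0 < eta -> exists delta : R,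
  [/\ 0 < delta, delta <= 1, delta * (r + 2) < r & delta * (8 * r + 13) < eta].
Proof.
move=> r0 eta0; have h1 : 0 < r + 2 by lra.
have h2 : 0 < 8 * r + 13 by lra.
have d1 : 0 < r / (2 * (r + 2)) by rewrite divr_gt0 // mulr_gt0.
have d2 : 0 < eta / (2 * (8 * r + 13)) by rewrite divr_gt0 // mulr_gt0.
exists (Num.min 1 (Num.min (r / (2 * (r + 2))) (eta / (2 * (8 * r + 13))))).
split.
- by rewrite !lt_min ltr01 d1.
- by rewrite ge_min lexx.
- rewrite -ltr_pdivlMr // !gt_min; apply/orP; right; apply/orP; left.
  by rewrite ltr_pM2l // ltf_pV2 ?posrE ?mulr_gt0 //; lra.
- rewrite -ltr_pdivlMr // !gt_min; apply/orP; right; apply/orP; right.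
  by rewrite ltr_pM2l // ltf_pV2 ?posrE ?mulr_gt0 //; lra.
Qed.

End SmallParameters.

Section ZeroVectors.
Context {R : realType}.
Variable p : 'rV[R]_4.
Hypothesis pS : S3 p.

Lemma zero_TS3 : tangent_bundle S3 (p, 0).
Proof. by apply/tangent_bundle_S3P; rewrite dot_S3 // dot0r. Qed.

Lemma berger_height_zero e : berger_height e (p, 0) = 1.
Proof.
rewrite /berger_height /berger_vec_sqnorm /= !dot0l mulr0 expr0n /= !addr0.
exact: sqrtr1.
Qed.

Lemma collapse_zero e : collapse e (p, 0) = (0, (hopf p, 0)).
Proof.
rewrite /collapse /= dot0l mulr0.
by have [M ->] := linear_mulmx (linear_dhopf p); rewrite mul0mx.
Qed.

Lemma reflect_collapse_zero e q : S2 q ->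
  reflect_limit (hopf p - q) (collapse e (p, 0)) = (0, (q, 0)).
Proof.
move=> /dot_S2 qq; rewrite collapse_zero /reflect_limit /= reflection_swap.
  by rewrite /reflection dot0l mulr0 mul0r scale0r subrr.
by rewrite qq; apply/dot_S2/hopf_S2.
Qed.

End ZeroVectors.

Theorem corollary5p2 (R : realType) (eps : nat -> R)
  (eps_gt0 : forall n, 0 < eps n) (eps_cvg0 : eps @ \oo --> (0 : R))
  (gS : nat -> ('rV[R]_4 * 'rV[R]_4) -> ('rV[R]_4 * 'rV[R]_4) ->
        ('rV[R]_4 * 'rV[R]_4) -> R)
  (gS_sasaki : forall n, sasaki_metric S3 (berger_metric (eps n)) (gS n))
  (hS : ('rV[R]_3 * 'rV[R]_3) -> ('rV[R]_3 * 'rV[R]_3) ->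
        ('rV[R]_3 * 'rV[R]_3) -> R)
  (hS_sasaki : sasaki_metric S2 (@euclidean_metric R 3) hS)
  (p : nat -> 'rV[R]_4) (p_S3 : forall n, S3 (p n))
  (q : 'rV[R]_3) (q_S2 : S2 q) :
  pointed_GH_cvg
    (fun _ => tangent_bundle S3)
    (fun n => riem_dist (tangent_bundle S3) (gS n))
    (fun n => (p n, 0))
    ([set: R^o] `*` tangent_bundle S2)
    (riem_dist ([set: R^o] `*` tangent_bundle S2)
       (prod_metric (@line_metric R) hS))
    (0, (q, 0)).

Proof.
move=> r eta r0 eta0.
have [delta [delta0 delta1 dr deta]] := small_delta r0 eta0.
have K0 : 0 <= height_bound r by rewrite /height_bound addr_ge0 // mulr_ge0 // ltW.
have [e1 e10 he1] := small_distortion K0 delta0.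
have [N _ hN] := (cvgrPdist_lt _ _).1 eps_cvg0 e1 e10.
exists N => i Ni.
have ei : eps i < e1.
  by have := hN i (ltnW Ni); rewrite /= sub0r normrN gtr0_norm.
have [hD hL hF] := he1 _ (eps_gt0 i) ei.
exact: (ball_approximation (eps_gt0 i) (gS_sasaki i) hS_sasaki r0 delta0 delta1
  (zero_TS3 (p_S3 i)) (berger_height_zero (p i) (eps i)) hD hL hF
  (reflect_collapse_zero (p_S3 i) (eps i) q_S2) dr deta).
Qed.
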